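(* Let $\Gamma\subset\operatorname{Isom}(\mathbb{H}^{n+1})$ be a non-elementary geometrically finite Kleinian group with critical exponent $\delta$. Then the set $BA(\Gamma)$ of badly approximable limit points (equivalently, the set of limit points $x\in\Lambda(\Gamma)$ such that geodesic rays in $\mathbb{H}^{n+1}$ terminating at $x$ have bounded projection in $\mathbb{H}^{n+1}/\Gamma$) has Hausdorff dimension $\delta$.
   Context: $\mathbb{H}^{n+1}$ is taken in the ball model $\{x\in\mathbb{R}^{n+1}:|x|<1\}$ with metric $ds=|dx|/(1-|x|^2)$ and boundary the unit sphere $S^n$, on which isometries act by extension; $|\cdot|$ is the Euclidean norm, and Hausdorff dimension is with respect to the Euclidean (equivalently spherical) metric on $S^n$. A Kleinian group is a discrete subgroup $\Gamma$ of $\operatorname{Isom}(\mathbb{H}^{n+1})$. Its limit set $\Lambda(\Gamma)\subset S^n$ is the set of accumulation points in $S^n$ of an orbit $\Gamma\cdot o$, $o\in\mathbb{H}^{n+1}$; $\Gamma$ is non-elementary if $\Lambda(\Gamma)$ is infinite. An isometry is parabolic if it fixes exactly one point of $S^n$ and no point of $\mathbb{H}^{n+1}$; a point $p\in\Lambda(\Gamma)$ is parabolic if it is the fixed point of a parabolic element of $\Gamma$. A point $x\in\Lambda(\Gamma)$ is conical if there is a sequence $\gamma_i\in\Gamma$ such that $\gamma_i(o)$ converges to $x$ and there is a constant $k=k(x)$ with $|x-\gamma_i(o)|<k(1-|\gamma_i(o)|)$ for all $i$. $\Gamma$ is geometrically finite if it is finitely generated and its limit set is a disjoint union of conical and parabolic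 limit points. The critical exponent of $\Gamma$ is the infimum of all $s\ge 0$ for which the Poincaré series $\sum_{g\in\Gamma}e^{-s\,d(o,g(o))}$ converges, where $d$ is the hyperbolic distance normalized to have constant curvature $-1$. Let $P$ be a set of mutually $\Gamma$-inequivalent parabolic fixed points such that every parabolic fixed point has the form $g(p)$ with $g\in\Gamma$, $p\in P$. For $p\in P$, $BA(\Gamma,p)$ is the set of $x\in\Lambda(\Gamma)$ for which there exists a constant $k(x,p)>0$ with $$|x-g(p)|>k(x,p)\,(1-|g(0)|)\quad\text{for all } g\in\Gamma,$$ and $BA(\Gamma)=\bigcap_{p\in P}BA(\Gamma,p)$ (a subset of $\Lambda(\Gamma)$). *)

(* Defs.v *)
From HB Require Import structures.
From mathcomp Require Import all_boot all_order all_algebra.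
From mathcomp Require Import all_classical all_reals all_analysis.

Set Implicit Arguments.
Unset Strict Implicit.
Unset Printing Implicit Defensive.

Import Order.TTheory GRing.Theory Num.Theory.
Import numFieldNormedType.Exports.

Local Open Scope classical_set_scope.
Local Open Scope ring_scope.

Section HausdorffDimension.
Context {R : realType} {m : nat}.
Implicit Types (A : set 'rV[R]_m) (x : 'rV[R]_m).

(* The library norm of 'rV[R]_m is the sup norm, hence a separate definition
   (the topology is the same). *)
Definition enorm x : R := Num.sqrt (\sum_i x 0 i ^+ 2).

(* The point 0 is added so that the empty set has diameter 0. *)
Definition ediam A : \bar R :=
  ereal_sup (0%E |` [set (enorm (z.1 - z.2))%:E | z in A `*` A]).

Definition hausdorff_premeasure (s e : R) A : \bar R :=
  ereal_inf [set (\sum_(0 <= k <oo) poweR (ediam (U k)) s)%E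
            | U in [set U : nat -> set 'rV[R]_m |
                     A `<=` \bigcup_k U k /\
                     forall k, (ediam (U k) <= e%:E)%E]].

(* Only used for s > 0, where 0 ^ s = 0. *)
Definition hausdorff_measure (s : R) A : \bar R :=
  ereal_sup [set hausdorff_premeasure s e A | e in [set e : R | 0 < e]].

Definition hausdorff_dim A : \bar R :=
  ereal_inf [set s%:E | s in [set s : R | 0 < s /\ hausdorff_measure s A = 0%E]].

End HausdorffDimension.

Section HyperbolicSpace.
Context {R : realType} {n : nat}.

Definition unit_ball : set 'rV[R]_n.+1 := [set x | enorm x < 1].
Definition unit_sphere : set 'rV[R]_n.+1 := [set x | enorm x = 1].

Definition hyp : Type := set_type unit_ball.
Definition hval (x : hyp) : 'rV[R]_n.+1 := set_val x.

Lemma unit_ball0 : unit_ball 0.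
Proof.
rewrite /unit_ball /= /enorm big1 ?sqrtr0 ?ltr01// => i _.
by rewrite mxE expr0n.
Qed.

Definition origin : hyp := exist _ 0 (mem_set unit_ball0).

Definition C1_path (x y : hyp) (c : R -> 'rV[R]_n.+1) : Prop :=
  [/\ forall t, derivable c t 1, continuous (derive1 c),
      forall t, 0 <= t <= 1 -> unit_ball (c t),
      c 0 = hval x & c 1 = hval y].

(* Length for ds = |dx| / (1 - |x|^2). *)
Definition path_length (c : R -> 'rV[R]_n.+1) : R :=
  Rintegral lebesgue_measure `[0, 1]
    (fun t => enorm (derive1 c t) / (1 - enorm (c t) ^+ 2)).

(* ds has curvature -4; the factor 2 normalizes the curvature to -1. *)
Definition hdist (x y : hyp) : R :=
  2 * inf [set path_length c | c in C1_path x y].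

Implicit Types (g h : hyp -> hyp) (G : set (hyp -> hyp)) (o : hyp).

Definition is_isometry g : Prop :=
  (forall x y, hdist (g x) (g y) = hdist x y) /\ bijective g.

(* The action of an isometry on the sphere, by continuous extension:
   the limit of g z as z in the open ball tends to x. *)
Definition bext g (x : 'rV[R]_n.+1) : 'rV[R]_n.+1 :=
  lim (hval (g z) @[z --> filter_from (nbhs x) (preimage hval)]).

Definition isom_subgroup G : Prop :=
  [/\ forall g, G g -> is_isometry g,
      G id,
      forall g h, G g -> G h -> G (g \o h) &
      forall g, G g -> exists2 h, G h & cancel g h /\ cancel h g].

(* Discreteness is with respect to the compact-open topology. *)
Definition kleinian G : Prop :=
  isom_subgroup G /\ G `<=` isolated (G : set {compact-open, hyp -> hyp}).

Definition finitely_generated G : Prop :=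
  exists S : set (hyp -> hyp),
    [/\ finite_set S, S `<=` G & G = smallest isom_subgroup S].

Definition limit_set G o : set 'rV[R]_n.+1 :=
  unit_sphere `&` limit_point [set hval (g o) | g in G].

Definition non_elementary G o : Prop := infinite_set (limit_set G o).

Definition is_parabolic g : Prop :=
  [/\ is_isometry g, forall z, g z <> z &
      exists! x, unit_sphere x /\ bext g x = x].

Definition parabolic_points G o : set 'rV[R]_n.+1 :=
  limit_set G o `&`
  [set p : 'rV[R]_n.+1 | exists g, [/\ G g, is_parabolic g & bext g p = p]].

Definition conical_points G o : set 'rV[R]_n.+1 :=
  limit_set G o `&`
  [set x : 'rV[R]_n.+1 | exists u : nat -> hyp -> hyp,
     [/\ forall i, G (u i), hval (u i o) @[i --> \oo] --> x &
         exists k : R, forall i,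
           enorm (x - hval (u i o)) < k * (1 - enorm (hval (u i o)))]].

Definition geometrically_finite G o : Prop :=
  [/\ finitely_generated G,
      limit_set G o = conical_points G o `|` parabolic_points G o &
      conical_points G o `&` parabolic_points G o = set0].

Definition critical_exponent G o : \bar R :=
  ereal_inf [set s%:E | s in [set s : R | 0 <= s /\
    (\esum_(g in G) (expR (- (s * hdist o (g o))))%:E < +oo)%E]].

Definition parabolic_representatives G o (P : set 'rV[R]_n.+1) : Prop :=
  [/\ P `<=` parabolic_points G o,
      forall p q, P p -> P q -> (exists2 g, G g & bext g p = q) -> p = q &
      forall x, parabolic_points G o x ->
        exists g p, [/\ G g, P p & x = bext g p]].

Definition badly_approximable_at G o (p : 'rV[R]_n.+1) : set 'rV[R]_n.+1 :=
  limit_set G o `&`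
  [set x : 'rV[R]_n.+1 | exists2 k : R, 0 < k &
     forall g, G g ->
       enorm (x - bext g p) > k * (1 - enorm (hval (g origin)))].

(* The intersection with the limit set matters when P is empty. *)
Definition badly_approximable G o (P : set 'rV[R]_n.+1) : set 'rV[R]_n.+1 :=
  limit_set G o `&` \bigcap_(p in P) badly_approximable_at G o p.

Definition geodesic_ray (c : R -> hyp) : Prop :=
  forall s t, 0 <= s -> 0 <= t -> hdist (c s) (c t) = `|s - t|.

(* The quotient metric on the space of G-orbits, on representatives. *)
Definition quotient_dist G (x y : hyp) : R :=
  inf [set hdist x (g y) | g in G].

Definition bounded_limit_points G o : set 'rV[R]_n.+1 :=
  limit_set G o `&`
  [set x : 'rV[R]_n.+1 | forall c : R -> hyp, geodesic_ray c ->
     hval (c t) @[t --> +oo] --> x ->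
     exists M : R, forall s t, 0 <= s -> 0 <= t ->
       quotient_dist G (c s) (c t) <= M].

End HyperbolicSpace.

Arguments hyp : clear implicits.

(* Main.v *)
Require Import Defs.
From HB Require Import structures.
From mathcomp Require Import all_boot all_order all_algebra.
From mathcomp Require Import all_classical all_reals all_analysis.
From mathcomp Require Import ring lra zify.

(** The hyperbolic distance is eliminated at the start: [hdistE] says that
    [cosh d(x, y) = 1 + 2 |x - y|^2 / ((1 - |x|^2) (1 - |y|^2))], the upper bound
    coming from an explicit geodesic and the lower bound from a differential
    inequality along a path. An isometry therefore satisfies the two-point identity
    [|f x - f y|^2 = f'(x) f'(y) |x - y|^2], with an explicit derivative ([conf]), first
    in the ball and, being Lipschitz, on the closed ball after extension ([conf_ext]).
    Discreteness becomes local finiteness of the orbit of the centre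
    ([kleinian_finite]: infinitely many equi-Lipschitz maps accumulate). Everything
    else is about groups of such maps of the closed ball ([kgroup]).

    Bounded rays and bad approximability. In the half space model with a parabolic
    fixed point [p] at infinity ([E p] is the Euclidean metric, [T p] the height), the
    stabilizer of [p] acts by Euclidean isometries preserving the height. The key fact
    is [cusp_bounded]: the orbit stays below some height, and every orbit or limit
    point is boundedly close to a translate of [0] by the stabilizer. It is usually
    derived from the compactness of the thick part of the convex core; here it follows
    from the decomposition of the limit set into conical and parabolic points. First,
    geodesics between [p] and the [g p] come within bounded distance of the orbit:
    otherwise a rapidly converging chain of cusps would have a limit that is neither
    conical nor parabolic ([cusp_geodesics]). Next, bring to [0] the orbit point which
    is highest above [p] near such a geodesic; the images of [p] so obtained are
    uniformly separated, since an orbit point near a short geodesic between two of them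
    would be too high above one of them, hence finitely many ([pulled_finite]). Given this,
    a ray entering deep into a cusp has an end point very well approximated by the cusp,
    and conversely ([bounded_bad], [bad_bounded]).

    Dimension. A badly approximable point is conical, and conical points lie in
    infinitely many balls centred at orbit points of radius [W^(s/t)], where [W] is
    [1 - |.|^2]; if the Poincare series converges at [s], the [t]-dimensional measure
    vanishes for [t > s] ([conic_hausdorff]). If the series diverges at [s > t], its mass
    concentrates near a pair of points [X], [Y] that can be taken distinct, and at one
    scale [lam] one finds more than a constant times [lam^-t] well separated elements
    carrying the complement of a neighbourhood of [Y] into a neighbourhood of [X]
    ([heavy_pair], [select]). They generate a semigroup of contractions, whose limit
    points have bounded rays, as the orbit points along a word accompany the ray; a
    counting argument on words shows that this limit set has positive
    [t]-dimensional measure ([coding_hausdorff], [heavy_hausdorff]). *)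

Set Implicit Arguments.
Unset Strict Implicit.
Unset Printing Implicit Defensive.

Import Order.TTheory GRing.Theory Num.Theory.
Import numFieldNormedType.Exports.

Local Open Scope classical_set_scope.
Local Open Scope ring_scope.

(** * The Euclidean norm *)

Section Euclid.
Context {R : realType} {m : nat}.
Implicit Types (x y z p : 'rV[R]_m) (a b : R).

Definition dot x y : R := \sum_i x 0 i * y 0 i.

Lemma dotC x y : dot x y = dot y x.
Proof. by apply: eq_bigr => i _; rewrite mulrC. Qed.

Lemma dotDl x y z : dot (x + y) z = dot x z + dot y z.
Proof. by rewrite -big_split; apply: eq_bigr => i _; rewrite mxE mulrDl. Qed.

Lemma dotZl a x y : dot (a *: x) y = a * dot x y.
Proof. by rewrite /dot mulr_sumr; apply: eq_bigr => i _; rewrite mxE mulrA. Qed.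

Lemma dotNl x y : dot (- x) y = - dot x y.
Proof. by rewrite -scaleN1r dotZl mulN1r. Qed.

Lemma dotBl x y z : dot (x - y) z = dot x z - dot y z.
Proof. by rewrite dotDl dotNl. Qed.

Lemma dotDr x y z : dot z (x + y) = dot z x + dot z y.
Proof. by rewrite dotC dotDl !(dotC z). Qed.

Lemma dotZr a x y : dot y (a *: x) = a * dot y x.
Proof. by rewrite dotC dotZl (dotC y). Qed.

Lemma dotNr x y : dot y (- x) = - dot y x.
Proof. by rewrite dotC dotNl (dotC y). Qed.

Lemma dotBr x y z : dot z (x - y) = dot z x - dot z y.
Proof. by rewrite dotDr dotNr. Qed.

Lemma dot0l x : dot 0 x = 0.
Proof. by rewrite /dot big1 // => i _; rewrite mxE mul0r. Qed.

Lemma dot0r x : dot x 0 = 0. Proof. by rewrite dotC dot0l. Qed.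

Definition dotE := (dotDl, dotDr, dotBl, dotBr, dotNl, dotNr, dotZl, dotZr,
                    dot0l, dot0r).

Lemma dot_ge0 x : 0 <= dot x x.
Proof. by apply: sumr_ge0 => i _; rewrite -expr2 sqr_ge0. Qed.

Lemma enormE x : enorm x = Num.sqrt (dot x x).
Proof. by congr Num.sqrt; apply: eq_bigr => i _; rewrite expr2. Qed.

Lemma sqr_enorm x : enorm x ^+ 2 = dot x x.
Proof. by rewrite enormE sqr_sqrtr // dot_ge0. Qed.

Lemma enorm_ge0 x : 0 <= enorm x. Proof. exact: sqrtr_ge0. Qed.

Lemma enorm0 : enorm (0 : 'rV[R]_m) = 0.
Proof. by rewrite enormE dot0l sqrtr0. Qed.

Lemma enorm_eq0 x : (enorm x == 0) = (x == 0).
Proof.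
apply/eqP/eqP => [/(congr1 (fun t => t ^+ 2))|->]; last exact: enorm0.
rewrite sqr_enorm expr0n /= => /eqP.
rewrite psumr_eq0 => [/allP h|i _]; last by rewrite -expr2 sqr_ge0.
apply/rowP => i; rewrite mxE; apply/eqP.
by have := h i (mem_index_enum _); rewrite -expr2 sqrf_eq0.
Qed.

Lemma enorm_gt0 x : (0 < enorm x) = (x != 0).
Proof. by rewrite lt_def enorm_ge0 andbT enorm_eq0. Qed.

Lemma enorm_sub_eq0 x y : (enorm (x - y) == 0) = (x == y).
Proof. by rewrite enorm_eq0 subr_eq0. Qed.

Lemma enorm_sub_gt0 x y : (0 < enorm (x - y)) = (x != y).
Proof. by rewrite enorm_gt0 subr_eq0. Qed.

Lemma sqr_dot_le x y : dot x y ^+ 2 <= dot x x * dot y y.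
Proof.
have [y0|yN0] := eqVneq (dot y y) 0.
  have /eqP : enorm y ^+ 2 = 0 by rewrite sqr_enorm.
  rewrite sqrf_eq0 enorm_eq0 => /eqP ->.
  by rewrite !dot0r expr0n /= mulr0.
have yp : 0 < dot y y by rewrite lt_def yN0 dot_ge0.
have := dot_ge0 (dot y y *: x - dot x y *: y).
rewrite !dotE (dotC y x) => h.
have : 0 <= dot y y * (dot x x * dot y y - dot x y ^+ 2) by nra.
by rewrite pmulr_rge0 // subr_ge0.
Qed.

Lemma dot_le x y : dot x y <= enorm x * enorm y.
Proof.
have := sqr_dot_le x y; rewrite -!sqr_enorm => h.
have := mulr_ge0 (enorm_ge0 x) (enorm_ge0 y).
move: h; rewrite -exprMn; move: (enorm x * enorm y) (dot x y) => a b; nra.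
Qed.

Lemma enormD x y : enorm (x + y) <= enorm x + enorm y.
Proof.
rewrite -(@ler_pXn2r _ 2) ?nnegrE ?addr_ge0 ?enorm_ge0 //.
rewrite sqr_enorm !dotE (dotC y x).
rewrite sqrrD !sqr_enorm mulr2n; have := dot_le x y.
by move: (enorm x * enorm y) (dot x y) (dot x x) (dot y y) => *; lra.
Qed.

Lemma enormZ a x : enorm (a *: x) = `|a| * enorm x.
Proof. by rewrite !enormE !dotE mulrA -expr2 sqrtrM ?sqr_ge0 // sqrtr_sqr. Qed.

Lemma enormN x : enorm (- x) = enorm x.
Proof. by rewrite -scaleN1r enormZ normrN1 mul1r. Qed.

Lemma enormC x y : enorm (x - y) = enorm (y - x).
Proof. by rewrite -enormN opprB. Qed.

Lemma enorm_tri x y z : enorm (x - z) <= enorm (x - y) + enorm (y - z).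
Proof. by have := enormD (x - y) (y - z); rewrite addrA subrK. Qed.

Lemma enorm_subl x y : enorm x - enorm y <= enorm (x - y).
Proof. by have := enormD (x - y) y; rewrite subrK; lra. Qed.

Lemma sqr_enormB x y :
  enorm (x - y) ^+ 2 = enorm x ^+ 2 - 2 * dot x y + enorm y ^+ 2.
Proof. by rewrite !sqr_enorm !dotE (dotC y x); ring. Qed.

(** Inversion in a sphere centred at [p] turns Ptolemy's inequality into the
    triangle inequality. *)
Lemma ptolemy p x y z : x != p -> y != p -> z != p ->
  enorm (x - z) / (enorm (x - p) * enorm (z - p)) <=
  enorm (x - y) / (enorm (x - p) * enorm (y - p)) +
  enorm (y - z) / (enorm (y - p) * enorm (z - p)).
Proof.
move=> xp yp zp.
pose inv u := (enorm (u - p) ^- 2) *: (u - p).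
have invE u v : u != p -> v != p ->
    enorm (u - v) / (enorm (u - p) * enorm (v - p)) = enorm (inv u - inv v).
  move=> up vp.
  have u0 : 0 < enorm (u - p) by rewrite enorm_sub_gt0.
  have v0 : 0 < enorm (v - p) by rewrite enorm_sub_gt0.
  apply: (pexpIrn (n := 2)) => //; rewrite ?nnegrE ?enorm_ge0 //.
    by rewrite divr_ge0 ?enorm_ge0 // mulr_ge0 ?enorm_ge0.
  have -> : u - v = (u - p) - (v - p) by rewrite opprB addrA subrK.
  rewrite /inv exprMn exprVn exprMn.
  move: u0 v0; move: (u - p) (v - p) => a b u0 v0.
  have nE (w : 'rV[R]_m) : `|enorm w ^- 2| = enorm w ^- 2.
    by rewrite ger0_norm // invr_ge0 sqr_ge0.
  rewrite !sqr_enormB !enormZ !nE !dotE.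
  move: u0 v0; set U := enorm a; set V := enorm b => u0 v0.
  set D := dot _ _; field.
  by rewrite !gt_eqF.
by rewrite !invE //; exact: enorm_tri.
Qed.

Lemma le_mxnorm_enorm x : `|x| <= enorm x.
Proof.
rewrite [leLHS]mx_normrE; apply: bigmax_le; first exact: enorm_ge0.
move=> [i j] _ /=; rewrite (ord1 i) -(@ler_pXn2r _ 2) ?nnegrE ?enorm_ge0 //.
rewrite sqr_enorm real_normK ?num_real // /dot (bigD1 j) //= expr2 lerDl.
by apply: sumr_ge0 => k _; rewrite -expr2 sqr_ge0.
Qed.

Lemma le_enorm_mxnorm x : enorm x <= m.+1%:R * `|x|.
Proof.
rewrite -(@ler_pXn2r _ 2) ?nnegrE ?enorm_ge0 ?mulr_ge0 //.
rewrite sqr_enorm exprMn.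
have h i : x 0 i * x 0 i <= `|x| ^+ 2.
  rewrite -expr2 -real_normK ?num_real // ler_pXn2r ?nnegrE //.
  have := @le_bigmax _ R _ (0:R) (fun i : 'I_1 * 'I_m => `|x i.1 i.2|) (0, i).
  by rewrite /= [X in _ -> _ <= X]mx_normrE.
apply: (@le_trans _ _ (\sum_(i < m) `|x| ^+ 2)); first exact: ler_sum.
rewrite sumr_const card_ord -[_ *+ m]mulr_natl ler_wpM2r ?sqr_ge0 //.
rewrite -natrX ler_nat; nia.
Qed.

Lemma nbhs_enormP x (A : set 'rV[R]_m) :
  nbhs x A <-> exists2 e, 0 < e & forall y, enorm (x - y) < e -> A y.
Proof.
split => [/nbhs_ballP[e /= e0 eA]|[e e0 eA]].
  exists e => // y xy; apply: eA; rewrite -ball_normE /=.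
  exact: le_lt_trans (le_mxnorm_enorm _) xy.
apply/nbhs_ballP; exists (e / m.+1%:R) => /=; first by rewrite divr_gt0.
move=> y; rewrite -ball_normE /= ltr_pdivlMr // mulrC => xy; apply: eA.
exact: le_lt_trans (le_enorm_mxnorm _) xy.
Qed.

Lemma cvg_enormP {T} (F : set_system T) {FF : Filter F} (f : T -> 'rV[R]_m) x :
  f @ F --> x <-> forall e, 0 < e -> \forall t \near F, enorm (f t - x) < e.
Proof.
split => [fx e e0|h A /nbhs_enormP[e e0 eA]].
  have := fx [set y | enorm (y - x) < e]; apply.
  by apply/nbhs_enormP; exists e => // y; rewrite enormC.
by apply: filterS (h e e0) => t; rewrite enormC; exact: eA.
Qed.

(** Sequential compactness of the closed ball, stated as the existence of a
    cluster point: passing to subsequences is avoided throughout. *)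
Lemma cluster_point (u : nat -> 'rV[R]_m) : (forall i, enorm (u i) <= 1) ->
  exists2 x, enorm x <= 1 &
    forall e N, 0 < e -> exists2 i, (N <= i)%N & enorm (u i - x) < e.
Proof.
move=> u1.
pose A := [set x : 'rV[R]_m | `|x| <= 1].
have cA : compact A.
  apply: bounded_closed_compact.
    by exists 1; split => // M M1 x /= /le_trans; apply; exact: ltW.
  have : closed ((fun x : 'rV[R]_m => `|x|) @^-1` [set r : R | r <= 1]); last by [].
  by apply: preimage_closed; [move=> x _; exact: norm_continuous|exact: closed_le].
have uA : (u @ \oo) A.
  by exists 0%N => // i _; exact: le_trans (le_mxnorm_enorm _) (u1 i).
have [x [xA cx]] := cA (u @ \oo) _ uA.
have cl e N : 0 < e -> exists2 i, (N <= i)%N & enorm (u i - x) < e.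
  move=> e0.
  have h1 : (u @ \oo) [set y | exists2 i, (N <= i)%N & y = u i].
    by exists N => // i /= Ni; exists i.
  have h2 : nbhs x [set y | enorm (y - x) < e].
    by apply/nbhs_enormP; exists e => // y; rewrite enormC.
  by have [y [[i Ni ->] xy]] := cx _ _ h1 h2; exists i.
exists x => //; apply/ler_addgt0Pr => e e0.
have [i _ ie] := cl e 0%N e0.
have := enorm_subl x (u i); rewrite enormC; have := u1 i; lra.
Qed.

End Euclid.

(** * Conformal maps of the ball *)

Section Conf.
Context {R : realType} {m : nat}.
Notation V := 'rV[R]_m.
Implicit Types (x y z p a b : V) (f g h : V -> V).

(** Twice the reciprocal of the conformal factor of the hyperbolic metric of
    curvature -1. In terms of the distance [d] from [0], [W = cosh(d/2)^-2]. *)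
Definition W x : R := 1 - enorm x ^+ 2.

Lemma W0 : W 0 = 1. Proof. by rewrite /W enorm0 expr0n subr0. Qed.

Lemma W_ge0 x : (0 <= W x) = (enorm x <= 1).
Proof. by rewrite subr_ge0 -[X in _ <= X](expr1n _ 2) ler_pXn2r ?nnegrE ?enorm_ge0. Qed.

Lemma W_gt0 x : (0 < W x) = (enorm x < 1).
Proof. by rewrite subr_gt0 -[X in _ < X](expr1n _ 2) ltr_pXn2r ?nnegrE ?enorm_ge0. Qed.

Lemma W_eq0 x : (W x == 0) = (enorm x == 1).
Proof.
have := W_ge0 x; have := W_gt0 x; rewrite !lt_def !eq_le.
have := enorm_ge0 x; rewrite /W; move: (enorm x) => t t0 _ _.
by apply/idP/idP => /andP[h1 h2]; apply/andP; split; nra.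
Qed.

Lemma W_le1 x : W x <= 1.
Proof. by rewrite /W gerBl sqr_ge0. Qed.

Lemma W_le_dist x p : enorm p = 1 -> enorm x <= 1 -> W x <= 2 * enorm (x - p).
Proof.
move=> p1 x1; have := enorm_subl p x; rewrite p1 enormC /W.
have := enorm_ge0 x; nra.
Qed.

(** The hyperbolic distance [d] is determined by [qd x y = sinh(d/2)^2]. *)
Definition qd x y : R := enorm (x - y) ^+ 2 / (W x * W y).

Lemma qdC x y : qd x y = qd y x.
Proof. by rewrite /qd enormC mulrC [W x * _]mulrC mulrC. Qed.

Lemma qd0 x : enorm x < 1 -> 1 + qd x 0 = (W x)^-1.
Proof.
by rewrite -W_gt0 /qd W0 subr0 mulr1 => h; rewrite /W in h *; field; rewrite gt_eqF.
Qed.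

(** The derivative of the extension of an isometry at [x], in terms of the images of [x]
    and [0] only. *)
Definition jac f x : R := W (f x) + enorm (f x - f 0) ^+ 2 / W (f 0).

(** The extension of a hyperbolic isometry to the closed ball is conformal with factor
    [jac f]; the two-point form of this property involves no differentiation. *)
Definition conf f := forall x, enorm x <= 1 ->
  [/\ 0 < jac f x, W (f x) = jac f x * W x &
      forall y, enorm y <= 1 ->
        enorm (f x - f y) ^+ 2 = jac f x * jac f y * enorm (x - y) ^+ 2].

Definition sj f x := Num.sqrt (jac f x).

Lemma enorm0_le1 : enorm (0 : V) <= 1. Proof. by rewrite enorm0. Qed.
Lemma enorm0_lt1 : enorm (0 : V) < 1. Proof. by rewrite enorm0. Qed.
Hint Resolve enorm0_le1 enorm0_lt1 : core.

Lemma jac0 f : jac f 0 = W (f 0).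
Proof. by rewrite /jac subrr enorm0 expr0n mul0r addr0. Qed.

Section Basic.
Variables (f : V -> V) (cf : conf f).

Lemma jac_gt0 x : enorm x <= 1 -> 0 < jac f x. Proof. by case/cf. Qed.
Lemma conf_W x : enorm x <= 1 -> W (f x) = jac f x * W x. Proof. by case/cf. Qed.
Lemma conf_sqr x y : enorm x <= 1 -> enorm y <= 1 ->
  enorm (f x - f y) ^+ 2 = jac f x * jac f y * enorm (x - y) ^+ 2.
Proof. by move=> /cf[_ _]; exact. Qed.

Lemma sj_gt0 x : enorm x <= 1 -> 0 < sj f x.
Proof. by move=> /jac_gt0; rewrite sqrtr_gt0. Qed.

Lemma sqr_sj x : enorm x <= 1 -> sj f x ^+ 2 = jac f x.
Proof. by move=> /jac_gt0 h; rewrite sqr_sqrtr // ltW. Qed.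

Lemma conf_dist x y : enorm x <= 1 -> enorm y <= 1 ->
  enorm (f x - f y) = sj f x * sj f y * enorm (x - y).
Proof.
move=> x1 y1; apply: (pexpIrn (n := 2)) => //; rewrite ?nnegrE ?enorm_ge0 //.
  by rewrite !mulr_ge0 ?enorm_ge0 // ltW ?sj_gt0.
by rewrite conf_sqr // !exprMn !sqr_sj.
Qed.

Lemma conf_le1 x : enorm x <= 1 -> enorm (f x) <= 1.
Proof. by move=> x1; rewrite -W_ge0 conf_W // mulr_ge0 ?W_ge0 // ltW ?jac_gt0. Qed.

Lemma conf_lt1 x : enorm x < 1 -> enorm (f x) < 1.
Proof.
move=> x1; rewrite -W_gt0 conf_W ?(ltW x1) //.
by rewrite mulr_gt0 ?W_gt0 // jac_gt0 // ltW.
Qed.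

Lemma conf_eq1 x : enorm x = 1 -> enorm (f x) = 1.
Proof.
move=> x1; have W0x : W x = 0 by apply/eqP; rewrite W_eq0 x1.
by apply/eqP; rewrite -W_eq0 conf_W ?x1 // W0x mulr0.
Qed.

Lemma conf_inj x y : enorm x <= 1 -> enorm y <= 1 -> f x = f y -> x = y.
Proof.
move=> x1 y1 /eqP; rewrite -enorm_sub_eq0 conf_dist // !mulf_eq0.
by rewrite (gt_eqF (sj_gt0 x1)) (gt_eqF (sj_gt0 y1)) /= enorm_sub_eq0 => /eqP.
Qed.

Lemma conf_neq x y : enorm x <= 1 -> enorm y <= 1 -> x != y -> f x != f y.
Proof. by move=> x1 y1; apply: contra => /eqP /conf_inj ->. Qed.

Lemma conf_qd x y : enorm x < 1 -> enorm y < 1 -> qd (f x) (f y) = qd x y.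
Proof.
move=> x1 y1; rewrite /qd conf_sqr ?ltW // !conf_W ?ltW //.
have := jac_gt0 (ltW x1); have := jac_gt0 (ltW y1).
rewrite -W_gt0 in x1; rewrite -W_gt0 in y1.
by move=> *; field; rewrite !gt_eqF.
Qed.

Section Preimage.
Variable a : V.
Hypotheses (a1 : enorm a < 1) (fa : f a = 0).

Lemma jac_denom_gt0 x : enorm x <= 1 -> 0 < W a * W x + enorm (x - a) ^+ 2.
Proof.
move=> x1; have Wa : 0 < W a by rewrite W_gt0.
have Wx : 0 <= W x by rewrite W_ge0.
have [xa|xa] := eqVneq x a.
  by rewrite xa subrr enorm0 expr0n addr0 mulr_gt0.
have : 0 < enorm (x - a) by rewrite enorm_sub_gt0.
by move=> h; have := mulr_ge0 (ltW Wa) Wx; nra.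
Qed.

(** The pole [a = f^-1 0] determines the derivative: [f] expands near [a] only. *)
Lemma jacE x : enorm x <= 1 ->
  jac f x = W a / (W a * W x + enorm (x - a) ^+ 2).
Proof.
move=> x1; have Wa : 0 < W a by rewrite W_gt0.
have d0 := jac_denom_gt0 x1.
have ja : jac f a = (W a)^-1.
  have := conf_W (ltW a1); rewrite fa W0 => h.
  by apply: (mulIf (lt0r_neq0 Wa)); rewrite -h mulVf // gt_eqF.
have := conf_sqr x1 (ltW a1); rewrite fa subr0 ja.
have := conf_W x1; rewrite {1}/W => h1 h2.
have e : 1 = jac f x * ((W a * W x + enorm (x - a) ^+ 2) / W a).
  have -> : 1 = jac f x * W x + enorm (f x) ^+ 2 by rewrite -h1; ring.
  by rewrite h2; field; rewrite gt_eqF.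
have {1}-> : W a / (W a * W x + enorm (x - a) ^+ 2) =
  W a / (W a * W x + enorm (x - a) ^+ 2) * 1 by rewrite mulr1.
by rewrite e; field; rewrite !gt_eqF.
Qed.

Lemma W_f0 : W (f 0) = W a.
Proof.
rewrite -jac0 jacE // W0 mulr1 sub0r enormN /W subrK divr1 //.
Qed.

Lemma jac_denom_le x : enorm x <= 1 -> W a * W x + enorm (x - a) ^+ 2 <= 4.
Proof.
move=> x1; rewrite sqr_enormB /W.
have : - dot x a <= enorm x * enorm a by rewrite -dotNl -(enormN x) dot_le.
have := enorm_ge0 x; have := enorm_ge0 a; have := ltW a1.
move: (enorm x) (enorm a) (dot x a) x1 => s t d *.
have h : s * t <= 1 by nra.
have : 0 <= s * t by nra.
nra.
Qed.

Lemma jac_ge x : enorm x <= 1 -> W a / 4 <= jac f x.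
Proof.
move=> x1; rewrite jacE // ler_pM2l ?W_gt0 // lef_pV2 ?posrE ?jac_denom_gt0 //.
exact: jac_denom_le.
Qed.

Lemma jac_le x e : enorm x <= 1 -> 0 < e -> e <= enorm (x - a) -> jac f x <= W a / e ^+ 2.
Proof.
move=> x1 e0 ea; rewrite jacE // ler_pM2l ?W_gt0 //.
rewrite lef_pV2 ?posrE ?jac_denom_gt0 ?exprn_gt0 //.
have : e ^+ 2 <= enorm (x - a) ^+ 2 by rewrite ler_pXn2r ?nnegrE ?enorm_ge0 // ltW.
have : 0 <= W a * W x by rewrite mulr_ge0 // ?W_ge0 // ltW ?W_gt0.
lra.
Qed.

Lemma jac_le4 x : enorm x <= 1 -> jac f x <= 4 / W a.
Proof.
move=> x1; have Wa : 0 < W a by rewrite W_gt0.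
have d0 := jac_denom_gt0 x1.
rewrite jacE // ler_pdivrMr // mulrAC ler_pdivlMr //.
suff : W a ^+ 2 <= 4 * (W a * W x + enorm (x - a) ^+ 2) by rewrite expr2.
rewrite sqr_enormB.
have := dot_le x a; have := enorm_ge0 x; have := enorm_ge0 a; have := ltW a1.
rewrite /W; move: (enorm x) (enorm a) (dot x a) x1 => s t d *.
have t1 : t <= 1 by [].
have st : s * t <= t by nra.
have st0 : 0 <= (t - s * t) * (2 - t - s * t) by apply: mulr_ge0; lra.
have e1 : (1 - t ^+ 2) ^+ 2 = (1 - t) ^+ 2 * (1 + t) ^+ 2 by ring.
have e2 : (1 + t) ^+ 2 <= 4 by nra.
have e3 : (1 - t) ^+ 2 * (1 + t) ^+ 2 <= (1 - t) ^+ 2 * 4.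
  by apply: ler_wpM2l => //; exact: sqr_ge0.
nra.
Qed.

End Preimage.
End Basic.

Lemma conf_comp f g : conf f -> conf g ->
  conf (f \o g) /\
  forall x, enorm x <= 1 -> jac (f \o g) x = jac f (g x) * jac g x.
Proof.
move=> cf cg.
have jE x : enorm x <= 1 -> jac (f \o g) x = jac f (g x) * jac g x.
  move=> x1; rewrite {1}/jac /= !(conf_W cf) ?(conf_le1 cg) //.
  rewrite (conf_sqr cf) ?(conf_le1 cg) // (conf_sqr cg) // !(conf_W cg) //.
  rewrite W0 subr0 mulr1.
  have h1 := jac_gt0 cf (conf_le1 cg enorm0_le1).
  have h2 := jac_gt0 cg enorm0_le1.
  have -> : jac f (g x) * (jac g x * W x) +
    jac f (g x) * jac f (g 0) * (jac g x * jac g 0 * enorm x ^+ 2) /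
    (jac f (g 0) * jac g 0) = jac f (g x) * jac g x * (W x + enorm x ^+ 2).
    by field; rewrite !gt_eqF.
  by rewrite /W subrK mulr1.
split => // x x1; split.
- by rewrite jE // mulr_gt0 ?(jac_gt0 cf) ?(jac_gt0 cg) ?(conf_le1 cg).
- by rewrite jE //= (conf_W cf) ?(conf_le1 cg) // (conf_W cg) // mulrA.
move=> y y1.
rewrite (conf_sqr cf) ?(conf_le1 cg) // (conf_sqr cg) // !jE //; ring.
Qed.

(** A point [p] of the sphere seen as the point at infinity of an upper half
    space: [E p] is the Euclidean metric there and [T p] the height. *)
Definition E p x y := enorm (x - y) / (enorm (x - p) * enorm (y - p)).
Definition T p x := W x / enorm (x - p) ^+ 2.

Lemma E_ge0 p x y : 0 <= E p x y.
Proof. by rewrite divr_ge0 ?mulr_ge0 ?enorm_ge0. Qed.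

Lemma EC p x y : E p x y = E p y x.
Proof. by rewrite /E enormC (mulrC (enorm (x - p))). Qed.

Lemma Exx p x : E p x x = 0.
Proof. by rewrite /E subrr enorm0 mul0r. Qed.

Lemma E_tri p x y z : x != p -> y != p -> z != p -> E p x z <= E p x y + E p y z.
Proof. exact: ptolemy. Qed.

Lemma T_ge0 p x : enorm x <= 1 -> 0 <= T p x.
Proof. by rewrite -W_ge0 => h; rewrite divr_ge0 ?sqr_ge0. Qed.

(** Moving the point at infinity by [f] is, in the half space models, a similarity
    of ratio [1 / jac f p]. *)
Lemma conf_E f p x y : conf f -> enorm p <= 1 -> enorm x <= 1 -> enorm y <= 1 ->
  x != p -> y != p -> E (f p) (f x) (f y) = E p x y / jac f p.
Proof.
move=> cf p1 x1 y1 xp yp; rewrite /E !(conf_dist cf) // -sqr_sj //.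
rewrite -enorm_sub_gt0 in xp; rewrite -enorm_sub_gt0 in yp.
have := sj_gt0 cf x1; have := sj_gt0 cf y1; have := sj_gt0 cf p1.
by move=> *; field; rewrite !gt_eqF.
Qed.

Lemma conf_T f p x : conf f -> enorm p <= 1 -> enorm x <= 1 -> x != p ->
  T (f p) (f x) = T p x / jac f p.
Proof.
move=> cf p1 x1 xp; rewrite /T (conf_sqr cf) // (conf_W cf) //.
rewrite -enorm_sub_gt0 in xp.
have := jac_gt0 cf x1; have := jac_gt0 cf p1.
by move=> *; field; rewrite !gt_eqF.
Qed.

(** [kap y a b] is, up to a factor 2, the hyperbolic cosine of the distance from [y]
    to the geodesic with end points [a] and [b]. *)
Definition kap y a b := enorm (y - a) * enorm (y - b) / (W y * enorm (a - b)).

Lemma kapC y a b : kap y a b = kap y b a.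
Proof. by rewrite /kap mulrC (mulrC (enorm (y - a))) (enormC a) mulrC. Qed.

Lemma conf_kap f y a b : conf f -> enorm y < 1 -> enorm a <= 1 -> enorm b <= 1 ->
  a != b -> kap (f y) (f a) (f b) = kap y a b.
Proof.
move=> cf y1 a1 b1 ab; have y1' := ltW y1; rewrite /kap !(conf_dist cf) // (conf_W cf) //.
rewrite -(sqr_sj cf) //.
rewrite -enorm_sub_gt0 in ab; have := y1; rewrite -W_gt0.
have := sj_gt0 cf (ltW y1); have := sj_gt0 cf a1; have := sj_gt0 cf b1.
by move=> *; field; rewrite !gt_eqF.
Qed.

Lemma E_kap p y b : y != p -> b != p -> enorm y < 1 -> E p y b = kap y p b * T p y.
Proof.
move=> yp bp; rewrite -W_gt0 /E /kap /T (enormC p).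
rewrite -enorm_sub_gt0 in yp; rewrite -enorm_sub_gt0 in bp.
by move=> *; field; rewrite !gt_eqF.
Qed.

(** The familiar formula [q = |x - y|^2 / (height x * height y)] of the half space. *)
Lemma qd_E p x y : x != p -> y != p -> enorm x < 1 -> enorm y < 1 ->
  E p x y ^+ 2 = qd x y * T p x * T p y.
Proof.
move=> xp yp; rewrite -!W_gt0 /E /qd /T.
rewrite -enorm_sub_gt0 in xp; rewrite -enorm_sub_gt0 in yp.
by move=> *; field; rewrite !gt_eqF.
Qed.

Lemma neq_in_out x p : enorm x < 1 -> enorm p = 1 -> x != p.
Proof. by move=> x1 p1; apply/eqP => xp; move: x1; rewrite xp p1 ltxx. Qed.

Lemma T0 p : enorm p = 1 -> T p 0 = 1.
Proof. by move=> p1; rewrite /T W0 sub0r enormN p1 expr1n divr1. Qed.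

End Conf.
#[export] Hint Resolve enorm0_le1 enorm0_lt1 : core.

(** * Discrete groups of conformal maps *)

Section RealAux.
Context {R : realType}.

Lemma exp_large (l M : R) : 1 < l -> exists k, M < l ^+ k.
Proof.
move=> l1; have bern k : 1 + k%:R * (l - 1) <= l ^+ k.
  elim: k => [|k IH]; first by rewrite mul0r addr0 expr0.
  rewrite exprS -natr1; have := mulr_ge0 (ler0n R k) (sqr_ge0 (l - 1)).
  have : l * (1 + k%:R * (l - 1)) <= l * l ^+ k by apply: ler_wpM2l => //; lra.
  nra.
have [k Mk] : exists k, M < k%:R * (l - 1).
  have l10 : 0 < l - 1 by lra.
  exists (Num.truncn (M / (l - 1))).+1; rewrite -ltr_pdivrMr //.
  exact: truncnS_gt.
by exists k; have := bern k; lra.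
Qed.

Lemma exp_small (q e : R) : 0 <= q < 1 -> 0 < e -> exists k, q ^+ k < e.
Proof.
move=> /andP[q0 q1] e0; have [->|qN0] := eqVneq q 0.
  by exists 1%N; rewrite expr1.
have qp : 0 < q by rewrite lt_def qN0.
have [|k hk] := @exp_large q^-1 e^-1; first by rewrite invf_gt1.
by exists k; move: hk; rewrite exprVn ltf_pV2 // posrE exprn_gt0.
Qed.

Lemma repeated_value {U} (A : set U) (u : nat -> U) : finite_set A ->
  (forall i, A (u i)) -> exists i j, (i < j)%N /\ u i = u j.
Proof.
move=> fA uA; apply: contrapT => H.
have inj : injective u.
  move=> i j uij; apply: contrapT => ij; apply: H.
  have : i != j by apply/eqP.
  by rewrite neq_ltn => /orP[] h; [exists i, j | exists j, i].
apply: infinite_nat.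
have -> : [set: nat] = u @^-1` A by apply/seteqP; split => i _ //=; exact: uA.
by apply: finite_preimage => // i j _ _; exact: inj.
Qed.

Lemma infinite_seq {U} (A : set U) : infinite_set A ->
  exists2 u : nat -> U, (forall i, A (u i)) & injective u.
Proof.
elim/Ppointed: U => U in A *; first by rewrite emptyE => /(_ (finite_set0 _)).
move=> /infiniteP /pcard_leP /injfunPex[/= u uA inj]; exists u.
  by move=> i; exact: uA.
by move=> i j; apply: inj; rewrite inE.
Qed.

(** Uniformity over a finite set for a property that only weakens when the
    bound grows. *)
Lemma finite_bound {U} (S : set U) (P : U -> R -> Prop) : finite_set S ->
  (forall s a b, P s a -> a <= b -> P s b) ->
  (forall s, S s -> exists a, P s a) -> exists a, forall s, S s -> P s a.
Proof.
move=> fS mono ex.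
have [f fP] : exists f : U -> R, forall s, S s -> P s (f s).
  have : forall s, exists a, S s -> P s a.
    move=> s; have [Ss|nS] := pselect (S s); last by exists 0.
    by have [a ?] := ex s Ss; exists a.
  by move=> /choice[f fP]; exists f.
have [r rE] := (finite_seqP _).1 (finite_image f fS).
exists (\sum_(a <- r) `|a|) => s Ss; apply: (mono _ _ _ (fP _ Ss)).
have : f s \in r by have : (f @` S) (f s) by [exists s]; rewrite rE.
move=> fr; rewrite (big_rem _ fr) /=; apply: (le_trans (ler_norm _)).
by rewrite lerDl sumr_ge0.
Qed.

End RealAux.

Section KGroup.
Context {R : realType} {m : nat}.
Notation V := 'rV[R]_m.
Implicit Types (x y z p a b : V) (f g h c : V -> V).

(** A discrete group of conformal maps. The field [kg_ext] makes equality of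
    elements depend only on the closed ball; [kg_fin] is discreteness, in the form of
    local finiteness of the orbit of [0]. *)
Record kgroup (Gam : set (V -> V)) : Prop := KGroup {
  kg_conf : forall f, Gam f -> conf f;
  kg_id : Gam id;
  kg_comp : forall f g, Gam f -> Gam g -> Gam (f \o g);
  kg_inv : forall f, Gam f -> exists2 h, Gam h &
    forall x, enorm x <= 1 -> h (f x) = x /\ f (h x) = x;
  kg_ext : forall f g, Gam f -> Gam g ->
    (forall x, enorm x <= 1 -> f x = g x) -> f = g;
  kg_fin : forall r, 0 < r -> finite_set [set f | Gam f /\ r <= W (f 0)] }.

Variables (Gam : set (V -> V)) (kg : kgroup Gam).

Definition limpt x := enorm x = 1 /\
  forall e, 0 < e -> exists2 f, Gam f & enorm (f 0 - x) < e.

(** One condition for each [e] instead of a sequence, which is recovered by choice. *)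
Definition conic x := enorm x = 1 /\ exists k, forall e, 0 < e ->
  exists f, [/\ Gam f, enorm (f 0 - x) < e & enorm (f 0 - x) <= k * W (f 0)].

Definition stab p c := Gam c /\ c p = p.

Lemma kg_lt1 f : Gam f -> enorm (f 0) < 1.
Proof. by move=> /(kg_conf kg) cf; apply: (conf_lt1 cf). Qed.

Lemma kg_le1 f : Gam f -> enorm (f 0) <= 1.
Proof. by move=> /kg_lt1/ltW. Qed.

Lemma kg_Wgt0 f : Gam f -> 0 < W (f 0).
Proof. by move=> /kg_lt1; rewrite W_gt0. Qed.

(** The inverse [h] comes with the point [h 0] that determines the derivative of [f] by
    [jacE]. *)
Lemma kg_invP f : Gam f -> exists h, [/\ Gam h,
  forall x, enorm x <= 1 -> h (f x) = x, forall x, enorm x <= 1 -> f (h x) = x,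
  f (h 0) = 0 & W (h 0) = W (f 0)].
Proof.
move=> Gf; have [h Gh hf] := kg_inv kg Gf; exists h.
have f0 : f (h 0) = 0 by apply: (hf 0 _).2; rewrite enorm0.
split=> // [x x1|x x1|]; [exact: (hf x x1).1|exact: (hf x x1).2|].
by rewrite (W_f0 (kg_conf kg Gf) (kg_lt1 Gh) f0).
Qed.

Lemma kg_iter f k : Gam f -> Gam (iter k f).
Proof.
by move=> Gf; elim: k => [|k IH]; [exact: (kg_id kg)|exact: (kg_comp kg Gf IH)].
Qed.

Lemma jac_invM f h x : Gam f -> Gam h -> enorm x <= 1 ->
  (forall x, enorm x <= 1 -> h (f x) = x) -> jac h (f x) * jac f x = 1.
Proof.
move=> /(kg_conf kg) cf /(kg_conf kg) ch x1 hf.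
have [_ <- //] := conf_comp ch cf.
have h0 : enorm (0 : V) <= 1 by rewrite enorm0.
by rewrite /jac /= !hf // W0 divr1 subr0 /W subrK.
Qed.

Lemma kg_lip f : Gam f -> exists2 K, 0 < K & forall x y,
  enorm x <= 1 -> enorm y <= 1 -> enorm (f x - f y) <= K * enorm (x - y).
Proof.
move=> Gf; have [h [Gh _ _ fh0 Wh]] := kg_invP Gf.
have cf := kg_conf kg Gf.
exists (4 / W (f 0)); first by rewrite divr_gt0 ?kg_Wgt0.
move=> x y x1 y1; rewrite -(@ler_pXn2r _ 2) ?nnegrE ?enorm_ge0 //; last first.
  by rewrite mulr_ge0 ?enorm_ge0 // divr_ge0 // ltW ?kg_Wgt0.
rewrite (conf_sqr cf) // exprMn ler_wpM2r ?sqr_ge0 // expr2.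
have jl z : enorm z <= 1 -> 0 <= jac f z <= 4 / W (f 0).
  by move=> z1; rewrite ltW ?(jac_gt0 cf) //= -Wh (jac_le4 cf (kg_lt1 Gh)).
by have /andP[? ?] := jl x x1; have /andP[? ?] := jl y y1; rewrite ler_pM.
Qed.

Lemma lim_inv f x : Gam f -> limpt x -> limpt (f x).
Proof.
move=> Gf [x1 Lx]; split; first exact: (conf_eq1 (kg_conf kg Gf)).
move=> e e0; have [K K0 lK] := kg_lip Gf.
have [|g Gg gx] := Lx (e / K); first by rewrite divr_gt0.
exists (f \o g); first exact: kg_comp.
apply: le_lt_trans (lK _ _ (kg_le1 Gg) _) _; first by rewrite x1.
by rewrite mulrC -ltr_pdivlMr.
Qed.

Lemma lim_W x e : limpt x -> 0 < e ->
  exists f, [/\ Gam f, enorm (f 0 - x) < e & W (f 0) < e].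
Proof.
move=> [x1 Lx] e0; have [|f Gf fx] := Lx (e / 2); first by rewrite divr_gt0.
exists f; split => //; first by lra.
by have := W_le_dist x1 (kg_le1 Gf); lra.
Qed.

Lemma stab_E p c x y : enorm p = 1 -> stab p c -> enorm x <= 1 -> enorm y <= 1 ->
  x != p -> y != p -> E p (c x) (c y) = E p x y / jac c p.
Proof.
move=> p1 [Gc cp] x1 y1 xp yp.
by rewrite -{1}cp (conf_E (kg_conf kg Gc)) // p1.
Qed.

Lemma stab_T p c x : enorm p = 1 -> stab p c -> enorm x <= 1 ->
  x != p -> T p (c x) = T p x / jac c p.
Proof.
move=> p1 [Gc cp] x1 xp.
by rewrite -{1}cp (conf_T (kg_conf kg Gc)) // p1.
Qed.

Lemma stab_neq p c x : enorm p = 1 -> stab p c -> enorm x <= 1 -> x != p -> c x != p.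
Proof.
move=> p1 [Gc cp] x1 xp; rewrite -cp.
by apply: (conf_neq (kg_conf kg Gc)); rewrite // p1.
Qed.

Lemma stab_iter p c k : stab p c -> stab p (iter k c).
Proof. by move=> [Gc cp]; split; [exact: kg_iter|elim: k => //= k ->]. Qed.

Lemma stab_inv p c : enorm p = 1 -> stab p c -> exists h, [/\ stab p h,
  forall x, enorm x <= 1 -> h (c x) = x, forall x, enorm x <= 1 -> c (h x) = x
  & W (h 0) = W (c 0)].
Proof.
move=> p1 [Gc cp]; have [h [Gh hc ch _ Wh]] := kg_invP Gc.
by exists h; split => //; split => //; rewrite -{1}cp hc // p1.
Qed.

Lemma T_le_dist p x : enorm p = 1 -> enorm x < 1 -> T p x * enorm (x - p) <= 2.
Proof.
move=> p1 x1; have := neq_in_out x1 p1; rewrite -enorm_sub_gt0 => d0.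
rewrite /T -mulrA expr2 invfM -mulrA mulVf ?gt_eqF // mulr1 ler_pdivrMr //.
by rewrite W_le_dist // ltW.
Qed.

(** Iterating an element that expands the half space at [p] moves [0] towards [p] inside
    a cone: displacement and height both grow geometrically. *)
Lemma loxodromic_con p c : enorm p = 1 -> stab p c -> jac c p < 1 -> conic p.
Proof.
move=> p1 sc j1; have Gc := sc.1; have cc := kg_conf kg Gc.
have j0 : 0 < jac c p by rewrite (jac_gt0 cc) // p1.
pose l := (jac c p)^-1; have l1 : 1 < l by rewrite invf_gt1.
have Gk k : Gam (iter k c) by exact: kg_iter.
have k1 k : enorm (iter k c 0) < 1 by apply: kg_lt1.
have k1' k : enorm (iter k c 0) <= 1 by apply: kg_le1.
have kp k : iter k c 0 != p by exact: neq_in_out.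
pose E1 := E p (c 0) 0.
have Tk k : T p (iter k c 0) = l ^+ k.
  elim: k => [|k IH]; first by rewrite T0.
  by rewrite iterS stab_T ?IH ?exprSr // k1'.
(* the displacements form a geometric series of ratio [l] *)
have Ek k : E p (iter k c 0) 0 <= (l ^+ k - 1) * E1 / (l - 1).
  elim: k => [|k IH]; first by rewrite Exx subrr !mul0r.
  have z0 : 0 != p by have := kp 0%N.
  apply: (le_trans (E_tri (y := c 0) _ _ _)); rewrite ?kp // ?(kp 1%N) //.
  rewrite iterS (stab_E p1 sc) ?k1' ?enorm0 // -/E1.
  have -> : (l ^+ k.+1 - 1) * E1 / (l - 1) = l * ((l ^+ k - 1) * E1 / (l - 1)) + E1.
    by rewrite exprS; field; rewrite subr_eq0 gt_eqF.
  rewrite lerD2r mulrC -/l ler_wpM2l // ltW //.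
  exact: lt_trans l1.
have E10 : 0 <= E1 by exact: E_ge0.
split=> //; exists (2 * (E1 / (l - 1))) => e e0.
have [k hk] := exp_large (4 + 2 / e) l1.
exists (iter k c); set y := iter k c 0.
have yp : 0 < enorm (y - p) by rewrite enorm_sub_gt0 kp.
have := T_le_dist p1 (k1 k); rewrite Tk -/y => Ty.
have e20 : 0 < 2 / e by rewrite divr_gt0.
have small : enorm (y - p) < 1 / 2.
  rewrite ltNge; apply/negP => h; have : 2 < l ^+ k * (1 / 2) by lra.
  have : l ^+ k * (1 / 2) <= l ^+ k * enorm (y - p) by apply: ler_wpM2l => //; lra.
  lra.
have y12 : 1 / 2 <= enorm y.
  by have := enorm_subl p y; rewrite p1 enormC; lra.
split => //.
  rewrite ltNge; apply/negP => h; have : 2 / e * e < l ^+ k * e.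
    by rewrite ltr_pM2r //; lra.
  rewrite divfK ?gt_eqF //.
  have : l ^+ k * e <= l ^+ k * enorm (y - p) by apply: ler_wpM2l => //; lra.
  lra.
have := Ek k; rewrite /E subr0 sub0r enormN p1 mulr1 -/y.
have le1 : (l ^+ k - 1) * E1 / (l - 1) <= l ^+ k * (E1 / (l - 1)).
  rewrite -mulrA; apply: ler_wpM2r; last by lra.
  by rewrite divr_ge0 //; lra.
move=> /le_trans /(_ le1); rewrite -(Tk k) -/y /T.
rewrite ler_pdivrMr // => h.
have e2 : W y / enorm (y - p) ^+ 2 * (E1 / (l - 1)) * enorm (y - p) =
   W y * (E1 / (l - 1)) / enorm (y - p).
  by field; rewrite gt_eqF //= subr_eq0 gt_eqF.
move: h; rewrite e2 ler_pdivlMr // => h.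
have : 1 / 2 * enorm (y - p) <= enorm y * enorm (y - p) by apply: ler_wpM2r => //; exact: ltW.
have -> : 2 * (E1 / (l - 1)) * W y = 2 * (W y * (E1 / (l - 1))) by ring.
lra.
Qed.

(** Either [c] or its inverse would otherwise expand the half space at [p], making [p]
    conical; so the stabilizer of a cusp acts by Euclidean isometries of the half space
    and preserves heights. *)
Lemma stab_jac p c : enorm p = 1 -> ~ conic p -> stab p c -> jac c p = 1.
Proof.
move=> p1 ncp sc; have [h [sh hc ch _]] := stab_inv p1 sc.
have pl : enorm p <= 1 by rewrite p1.
have := jac_invM sc.1 sh.1 pl hc; rewrite sc.2 => jj.
have j0 := jac_gt0 (kg_conf kg sc.1) pl.
have [lt1|gt1|//] := ltgtP (jac c p) 1.
  by case: ncp; exact: (loxodromic_con p1 sc lt1).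
case: ncp; apply: (loxodromic_con p1 sh).
by have := jac_gt0 (kg_conf kg sh.1) pl; nra.
Qed.

End KGroup.

(** * Fixed points and the stabilizer of a cusp *)

Section FixedPoint.
Context {R : realType} {m : nat}.
Notation V := 'rV[R]_m.
Implicit Types (x y z p a b : V) (f g h c : V -> V).

(** The sum of the hyperbolic cosines of the distances to finitely many points is a
    function [fun z => ((1 + |z|^2) N - 2 z.S) / W z], where the vector [(N, S)] is
    time-like; it has a single minimum, the centre of the points. *)
Lemma unique_center k (y : 'I_k.+1 -> V) : (forall i, enorm (y i) < 1) ->
  exists z0 mu, enorm z0 < 1 /\ forall z, enorm z < 1 ->
    \sum_i (1 + 2 * qd z (y i)) = mu <-> z = z0.
Proof.
move=> y1.
have Wy i : 0 < W (y i) by rewrite W_gt0.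
pose N0 := \sum_i (1 + enorm (y i) ^+ 2) / W (y i).
pose Ns := \sum_i (2 / W (y i)) *: y i.
have fE z : enorm z < 1 -> \sum_i (1 + 2 * qd z (y i)) =
    ((1 + enorm z ^+ 2) * N0 - 2 * dot z Ns) / W z.
  move=> z1; have Wz : 0 < W z by rewrite W_gt0.
  have -> : dot z Ns = \sum_i (2 / W (y i)) * dot z (y i).
    rewrite /Ns; elim/big_rec2: _ => [|i u v _ <-]; first exact: dot0r.
    by rewrite dotDr dotZr.
  rewrite /N0 !mulr_sumr -sumrB mulr_suml; apply: eq_bigr => i _.
  rewrite /qd sqr_enormB; have := Wy i; move: Wz; rewrite /W => h1 h2.
  by field; rewrite !gt_eqF.
have sN : enorm Ns < N0.
  apply: (@le_lt_trans _ _ (\sum_i 2 / W (y i) * enorm (y i))).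
    rewrite /Ns; elim/big_rec2: _ => [|i u v _ uv]; first by rewrite enorm0.
    apply: (le_trans (enormD _ _)); rewrite enormZ ger0_norm ?lerD //.
    by rewrite divr_ge0 // ltW.
  apply: ltr_sum => [|i _]; last first.
    rewrite mulrAC ltr_pM2r ?invr_gt0 //.
    by have := y1 i; have := enorm_ge0 (y i); nra.
  by apply/hasP; exists ord0; rewrite ?mem_index_enum.
have s0 := enorm_ge0 Ns.
have m0 : 0 < N0 ^+ 2 - enorm Ns ^+ 2 by nra.
pose mu := Num.sqrt (N0 ^+ 2 - enorm Ns ^+ 2).
have mu0 : 0 < mu by rewrite sqrtr_gt0.
have mu2 : mu ^+ 2 = N0 ^+ 2 - enorm Ns ^+ 2 by rewrite sqr_sqrtr // ltW.
have Nm : 0 < N0 + mu by lra.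
exists ((N0 + mu)^-1 *: Ns), mu; split.
  rewrite enormZ ger0_norm ?invr_ge0 ?(ltW Nm) // mulrC ltr_pdivrMr //; lra.
move=> z z1; have Wz : 0 < W z by rewrite W_gt0.
rewrite fE //.
(* [N0], [Ns] and [mu] are the time and space components of a vector of Minkowski
   space and its length; the difference vanishes only in the direction of the vector *)
have key : ((1 + enorm z ^+ 2) * N0 - 2 * dot z Ns) / W z - mu =
    (N0 + mu) / W z * enorm (z - (N0 + mu)^-1 *: Ns) ^+ 2.
  rewrite sqr_enormB dotZr enormZ exprMn real_normK ?num_real //.
  have -> : enorm Ns ^+ 2 = N0 ^+ 2 - mu ^+ 2 by rewrite mu2; ring.
  by move: Wz; rewrite /W => Wz; field; rewrite !gt_eqF.
split => [h|ze].
  move: key; rewrite h subrr => /esym/eqP; rewrite mulf_eq0 gt_eqF ?divr_gt0 //=.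
  by rewrite sqrf_eq0 enorm_sub_eq0 => /eqP.
by apply/eqP; rewrite -subr_eq0 key -ze subrr enorm0 expr0n /= mulr0.
Qed.

(** The centre of a finite orbit is fixed. *)
Lemma periodic_fixed f k : conf f -> iter k.+1 f 0 = 0 ->
  exists2 z, enorm z < 1 & f z = z.
Proof.
move=> cf fk.
have y1 i : enorm (iter i f 0) < 1.
  by elim: i => [|i IH]; [rewrite enorm0|exact: (conf_lt1 cf)].
have [z0 [mu [z01 H]]] := @unique_center k (fun i => iter i f 0) (fun i => y1 i).
exists z0 => //; apply/(H _ (conf_lt1 cf z01)).
rewrite -((H _ z01).2 erefl) big_ord_recl big_ord_recr /= addrC; congr (_ + _).
  by have := conf_qd cf z01 (y1 k); rewrite -iterS fk => ->.
by apply: eq_bigr => i _; rewrite add0n (conf_qd cf).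
Qed.

Variables (Gam : set (V -> V)) (kg : kgroup Gam).

(** The orbit of [0] under [f] cannot be finite, so it tends to the sphere; as
    heights at [p] are preserved, it does so at [p]. *)
Lemma small_stab p f e : enorm p = 1 -> ~ conic Gam p -> stab Gam p f ->
  (forall z, enorm z < 1 -> f z <> z) -> 0 < e ->
  exists2 c, stab Gam p c & enorm (c 0 - p) < e.
Proof.
move=> p1 ncp sf nfix e0.
have [k Wk] : exists k, W (iter k f 0) < e ^+ 2.
  apply: contrapT => /forallNP H.
  have e20 : 0 < e ^+ 2 by rewrite exprn_gt0.
  have [|i [j [ij fij]]] := @repeated_value _ _ (fun k x => iter k f x) (kg_fin kg e20).
    move=> k; split; first exact: (kg_iter kg k sf.1).
    by rewrite leNgt; apply/negP/H.
  have cf := kg_conf kg sf.1.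
  have [k jik] : exists k, j = (i + k.+1)%N by exists (j - i.+1)%N; rewrite addnS -addSn subnKC.
  have [] := @periodic_fixed f k cf; last by move=> z z1; exact: nfix.
  have i1 n : enorm (iter n f 0) <= 1 by exact: (kg_le1 kg (kg_iter kg n sf.1)).
  have /(congr1 (fun g : V -> V => g 0)) := fij; rewrite jik iterD.
  elim: {ij fij jik H} i => [/esym//|i IH] /= h; apply: IH.
  apply: (conf_inj cf) h; first exact: i1.
  by rewrite -iterS -iterD; exact: i1.
exists (iter k f); first exact: (stab_iter kg k sf).
have sk := stab_iter kg k sf.
have kp : iter k f 0 != p by apply: neq_in_out p1; exact: (kg_lt1 kg sk.1).
have jk := stab_jac kg p1 ncp sk.
have := stab_T kg p1 sk enorm0_le1 (neq_in_out enorm0_lt1 p1); rewrite T0 // jk divr1 /T => h.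
rewrite -(@ltr_pXn2r _ 2) ?nnegrE ?enorm_ge0 //; last exact: ltW.
apply: le_lt_trans Wk; rewrite -enorm_sub_gt0 in kp.
move: h => /(congr1 (fun t => t * enorm (iter k f 0 - p) ^+ 2)).
by rewrite mul1r divfK ?expf_neq0 ?gt_eqF // => ->.
Qed.

(** If [c 0] is close to [p], the inverse of [c] has its pole close to [p], hence
    sends [b] close to [p]. This supplies arbitrarily short moves of any point towards
    a cusp. *)
Lemma stab_attract p f b e : enorm p = 1 -> ~ conic Gam p -> stab Gam p f ->
  (forall z, enorm z < 1 -> f z <> z) -> enorm b <= 1 -> b != p -> 0 < e ->
  exists2 c, stab Gam p c & enorm (c b - p) < e.
Proof.
move=> p1 ncp sf nfix b1 bp e0.
have d0 : 0 < enorm (b - p) by rewrite enorm_sub_gt0.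
set d := enorm (b - p) in d0 *.
have e10 : 0 < e ^+ 2 / 16 by rewrite divr_gt0 ?exprn_gt0.
have [|c sc cp] := @small_stab p f (Num.min (d / 2) (e ^+ 2 / 16)) p1 ncp sf nfix.
  by rewrite lt_min divr_gt0.
move: cp; rewrite lt_min => /andP[cp1 cp2].
have [h [sh hc ch Wh]] := stab_inv kg p1 sc.
have h0 : h (c 0) = 0 by rewrite hc ?enorm0.
have cfh := kg_conf kg sh.1.
exists h => //.
have c1 := kg_lt1 kg sc.1.
have p1' : enorm p <= 1 by rewrite p1.
rewrite -sh.2 -(@ltr_pXn2r _ 2) ?nnegrE ?enorm_ge0 //; last exact: ltW.
rewrite (conf_sqr cfh) // (stab_jac kg p1 ncp sh) mulr1 -/d.
have ba : d / 2 <= enorm (b - c 0).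
  by have := enorm_tri b (c 0) p; rewrite -/d; lra.
have d20 : 0 < d / 2 by rewrite divr_gt0.
have jb := jac_le cfh c1 h0 b1 d20 ba.
have Wc := W_le_dist p1 (ltW c1).
apply: (@le_lt_trans _ _ (4 * W (c 0))).
  apply: (@le_trans _ _ (W (c 0) / (d / 2) ^+ 2 * d ^+ 2)).
    by apply: ler_wpM2r jb; exact: sqr_ge0.
  by rewrite le_eqVlt; apply/orP; left; apply/eqP; field; rewrite gt_eqF.
lra.
Qed.

End FixedPoint.

(** * Elements moving a given point of the sphere *)

Section NoFix.
Context {R : realType} {m : nat}.
Notation V := 'rV[R]_m.
Implicit Types (x y z p a b q s : V) (f g h c d : V -> V).
Variables (Gam : set (V -> V)) (kg : kgroup Gam).

(** All orbit points have height 1 at [p], and the only point of the sphere adherent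
    to a horosphere is its centre. *)
Lemma horospheric_limpt p : enorm p = 1 ->
  (forall g, Gam g -> stab Gam p g /\ jac g p = 1) -> limpt Gam `<=` [set p].
Proof.
move=> p1 fixp x Lx /=; apply: contrapT => /eqP; rewrite -enorm_sub_gt0.
set d := enorm (x - p) => d0.
have [|g [Gg gx Wg]] := @lim_W _ _ _ kg x (Num.min (d / 2) (d ^+ 2 / 4)) Lx.
  by rewrite lt_min !divr_gt0 ?exprn_gt0.
move: gx Wg; rewrite !lt_min => /andP[gx _] /andP[_ Wg].
have gp := neq_in_out (kg_lt1 kg Gg) p1; rewrite -enorm_sub_gt0 in gp.
have := stab_T kg p1 (fixp g Gg).1 enorm0_le1 (neq_in_out enorm0_lt1 p1).
rewrite T0 // (fixp g Gg).2 divr1 /T.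
move=> /(congr1 (fun t => t * enorm (g 0 - p) ^+ 2)).
rewrite mul1r divfK ?expf_neq0 ?gt_eqF // => WE.
have : d / 2 <= enorm (g 0 - p).
  by have := enorm_tri x (g 0) p; rewrite -/d (enormC x); lra.
nra.
Qed.

Lemma stab_iter_E p d k x y : enorm p = 1 -> stab Gam p d -> enorm x <= 1 ->
  enorm y <= 1 -> x != p -> y != p ->
  E p (iter k d x) (iter k d y) = (jac d p)^-1 ^+ k * E p x y.
Proof.
move=> p1 sd x1 y1 xp yp; elim: k => [|k IH]; first by rewrite expr0 mul1r.
have sk := stab_iter kg k sd.
have cl z : enorm z <= 1 -> enorm (iter k d z) <= 1 := @conf_le1 _ _ _ (kg_conf kg sk.1) z.
rewrite !iterS (stab_E kg p1 sd) ?cl //; try exact: (stab_neq kg p1 sk).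
by rewrite IH exprS mulrC mulrA.
Qed.

(** The orbit of [0] under [d] is Cauchy for [E p], which [d] contracts, so it stays away
    from [p]. Its limit is fixed, and lies on the sphere since [d] contracts heights too. *)
Lemma second_fixed_point p d : enorm p = 1 -> stab Gam p d -> 1 < jac d p ->
  exists b, [/\ enorm b = 1, b != p & d b = b].
Proof.
move=> p1 sd j1; pose mu := (jac d p)^-1.
have j0 : 0 < jac d p by exact: lt_trans j1.
have mu0 : 0 < mu by rewrite invr_gt0.
have mu1 : mu < 1 by rewrite invf_lt1.
have Gk k := kg_iter kg k sd.1.
pose y k := iter k d 0.
have y1 k : enorm (y k) < 1 := kg_lt1 kg (Gk k).
have yl k : enorm (y k) <= 1 := ltW (y1 k).
have yp k : y k != p := neq_in_out (y1 k) p1.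
have [E1 E1E] : exists E1, E1 = E p (d 0) 0 by eexists.
have E10 : 0 <= E1 by rewrite E1E E_ge0.
have Es k : E p (y k.+1) (y k) = mu ^+ k * E1.
  rewrite /y iterSr (stab_iter_E k p1 sd) ?E1E ?enorm0 //; [exact: (yl 1%N)|exact: (yp 1%N)|].
  exact: (yp 0%N).
have [B [B0 BE]] : exists B : R, 0 <= B /\ forall k, E p (y k) 0 <= B.
  exists (E1 / (1 - mu)); split; first by rewrite divr_ge0 //; lra.
  have m10 : 0 < 1 - mu by lra.
  suff H k : E p (y k) 0 <= (1 - mu ^+ k) * E1 / (1 - mu).
    move=> k; apply: (le_trans (H k)); rewrite ler_pM2r ?invr_gt0 //.
    rewrite -[X in _ <= X]mul1r ler_wpM2r // gerBl exprn_ge0 //; exact: ltW.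
  elim: k => [|k IH]; first by rewrite expr0 subrr !mul0r Exx.
  apply: (le_trans (E_tri (yp _) (yp k) (yp 0%N))); rewrite Es.
  apply: (@le_trans _ _ (mu ^+ k * E1 + (1 - mu ^+ k) * E1 / (1 - mu))).
    by rewrite lerD2l.
  by rewrite le_eqVlt; apply/orP; left; apply/eqP; rewrite exprS; field; rewrite gt_eqF.
have [b b1 cb] := cluster_point yl.
have bp : b != p.
  apply/eqP => bp; rewrite bp in cb.
  have Be : 0 < (2 * (B + 2))^-1 by rewrite invr_gt0; lra.
  have [k _ kb] := cb _ 0%N Be.
  have := BE k; rewrite /E subr0 sub0r enormN p1 mulr1 ler_pdivrMr ?enorm_sub_gt0 //.
  have := enorm_subl p (y k); rewrite p1 (enormC p).
  move: kb; rewrite -[X in _ < X]mul1r ltr_pdivlMr; last by lra.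
  have := enorm_ge0 (y k - p); nra.
have sb : d b = b.
  apply/eqP; rewrite -enorm_sub_eq0 eq_le enorm_ge0 andbT; apply/ler_addgt0Pr => e e0.
  have [K K0 lK] := kg_lip kg sd.1.
  have [||N hN] := @exp_small R mu (e / 2 / (4 * E1 + 1)); first by rewrite ltW.
    by rewrite divr_gt0 ?divr_gt0 //; lra.
  have e20 : 0 < e / 2 / (K + 1) by rewrite divr_gt0 ?divr_gt0 //; lra.
  have [k Nk kb] := cb _ N e20.
  have h1 := lK _ _ b1 (yl k).
  have h2 : enorm (y k.+1 - y k) <= e / 2.
    have := Es k; rewrite /E => /(congr1 (fun t => t * (enorm (y k.+1 - p) * enorm (y k - p)))).
    have n0 : 0 < enorm (y k.+1 - p) * enorm (y k - p) by rewrite mulr_gt0 ?enorm_sub_gt0.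
    rewrite divfK ?gt_eqF // => ->.
    have l2 i : enorm (y i - p) <= 2.
      by have := enormD (y i) (- p); rewrite enormN p1; have := yl i; lra.
    have h3 : enorm (y k.+1 - p) * enorm (y k - p) <= 2 * 2.
      by rewrite ler_pM ?enorm_ge0.
    have h4 : mu ^+ k <= mu ^+ N by rewrite ler_wiXn2l ?ltW.
    have m0 : 0 <= mu ^+ k by rewrite exprn_ge0 // ltW.
    apply: (@le_trans _ _ (mu ^+ k * E1 * (2 * 2))); first by rewrite ler_wpM2l // mulr_ge0.
    move: hN; rewrite ltr_pdivlMr; last by lra.
    have : mu ^+ k * (4 * E1 + 1) <= mu ^+ N * (4 * E1 + 1) by rewrite ler_wpM2r //; lra.
    lra.
  have h5 := enorm_tri (d b) (y k.+1) b; have h6 := enorm_tri (y k.+1) (y k) b.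
  rewrite /y iterS -/(y k) in h5 h6 h2; rewrite (enormC b (y k)) in h1.
  move: kb; rewrite ltr_pdivlMr; last by lra.
  nra.
exists b; split => //; apply/eqP; rewrite -W_eq0.
have := stab_T kg p1 sd b1 bp; rewrite sb -/mu => h.
have T0' : T p b = 0 by nra.
rewrite -enorm_sub_gt0 in bp.
by move/eqP: T0'; rewrite /T mulf_eq0 invr_eq0 expf_eq0 /= (gt_eqF bp) orbF.
Qed.

(** If every element fixes [p], and some [d] scales the half space at [p], then conjugation
    by powers of [d] takes any element into a finite set; hence every element also fixes the
    second fixed point [b] of [d], and there are no other limit points than [p] and [b]. *)
Lemma no_global_fix p : infinite_set (limpt Gam) -> enorm p = 1 ->
  exists2 h, Gam h & h p != p.
Proof.
move=> inf p1; apply: contrapT => H.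
have p1' : enorm p <= 1 by rewrite p1.
have fixp g : Gam g -> stab Gam p g.
  by move=> Gg; split => //; apply: contrapT => /eqP gp; apply: H; exists g.
have [all1|] := pselect (forall g, Gam g -> jac g p = 1).
  apply: inf; apply: (@sub_finite_set _ _ [set p]); last exact: finite_set1.
  by apply: horospheric_limpt => // g Gg; split; [exact: fixp|exact: all1].
move=> /existsNP[g1 /not_implyP[Gg1 /eqP jg1]].
have [d [c [Gd Gc dc cd jd]]] : exists d c, [/\ Gam d, Gam c,
    forall x, enorm x <= 1 -> d (c x) = x, forall x, enorm x <= 1 -> c (d x) = x & 1 < jac d p].
  have [h [Gh hg gh _ _]] := kg_invP kg Gg1.
  have jj := jac_invM kg Gg1 Gh p1' hg; rewrite (fixp _ Gg1).2 in jj.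
  have [lt1|gt1|/eqP e1] := ltgtP (jac g1 p) 1; last by rewrite e1 in jg1.
    exists h, g1; split => //.
    by have := jac_gt0 (kg_conf kg Gg1) p1'; nra.
  by exists g1, h.
have sd := fixp d Gd; have sc := fixp c Gc.
have [b [b1 bp db]] := second_fixed_point p1 sd jd.
have b1' : enorm b <= 1 by rewrite b1.
have cb : c b = b by rewrite -{1}db cd.
pose mu := (jac d p)^-1.
have jd0 : 0 < jac d p by exact: lt_trans jd.
have mu0 : 0 < mu by rewrite invr_gt0.
have mu1 : mu < 1 by rewrite invf_lt1.
have jc : jac c p = mu.
  have := jac_invM kg Gd Gc p1' cd; rewrite sd.2 => h.
  by rewrite /mu -[LHS](mulfK (lt0r_neq0 jd0)) h mul1r.
have zp : (0 : V) != p by apply: neq_in_out p1; rewrite enorm0.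
have itb k : iter k d b = b by elim: k => //= k ->.
have itcb k : iter k c b = b by elim: k => //= k ->.
have e0' : enorm (0 : V) <= 1 by rewrite enorm0.
have all_fix g : Gam g -> g b = b.
  move=> Gg; have sg := fixp g Gg; have jg := jac_gt0 (kg_conf kg Gg) p1'.
  have gb1 : enorm (g b) <= 1 := conf_le1 (kg_conf kg Gg) b1'.
  have gbp : g b != p := stab_neq kg p1 sg b1' bp.
  (* [u k] has the height of [g] at [p], and bounded displacement because [d]
     contracts what its inverse has stretched *)
  pose u k := iter k d \o g \o iter k c.
  have Gu k : Gam (u k).
    by apply: (kg_comp kg); [apply: (kg_comp kg)|]; rewrite //; apply: (kg_iter kg).
  have ck1 k : enorm (iter k c 0) <= 1 := kg_le1 kg (kg_iter kg k Gc).
  have ckp k : iter k c 0 != p := neq_in_out (kg_lt1 kg (kg_iter kg k Gc)) p1.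
  have gck k : enorm (g (iter k c 0)) <= 1 := conf_le1 (kg_conf kg Gg) (ck1 k).
  have gckp k : g (iter k c 0) != p := stab_neq kg p1 sg (ck1 k) (ckp k).
  have mm k : mu ^+ k * mu^-1 ^+ k = 1 by rewrite -exprMn mulfV ?gt_eqF // expr1n.
  have Eu k : E p (u k 0) b <= E p 0 b / jac g p + E p (g b) b.
    rewrite /u /= -{1}(itb k) (stab_iter_E k p1 sd) //.
    apply: (@le_trans _ _ (mu ^+ k * (mu^-1 ^+ k * E p 0 b / jac g p + E p (g b) b))).
      rewrite ler_pM2l ?exprn_gt0 //; apply: (le_trans (E_tri (y := g b) _ _ _)) => //.
      rewrite lerD2r (stab_E kg p1 sg) // -{1}(itcb k) (stab_iter_E k p1 sc) //.
      by rewrite jc.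
    have := E_ge0 p (g b) b; move: (E p 0 b) (E p (g b) b) => e1 e2 e20.
    have -> : mu ^+ k * (mu^-1 ^+ k * e1 / jac g p + e2) =
      (mu ^+ k * mu^-1 ^+ k) * (e1 / jac g p) + mu ^+ k * e2 by rewrite mulrDr !mulrA.
    rewrite mm mul1r lerD2l -[X in _ <= X]mul1r ler_wpM2r //.
    by rewrite exprn_ile1 // ltW.
  have Tit f k x : stab Gam p f -> enorm x <= 1 -> x != p ->
      T p (iter k f x) = (jac f p)^-1 ^+ k * T p x.
    move=> sf x1 xp; elim: k => [|k IH]; first by rewrite expr0 mul1r.
    have sk := stab_iter kg k sf.
    rewrite iterS (stab_T kg p1 sf); last exact: (stab_neq kg p1 sk).
      by rewrite IH exprS mulrAC [_ ^+ k * _]mulrC.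
    exact: (conf_le1 (kg_conf kg sk.1)).
  have Tu k : T p (u k 0) = (jac g p)^-1.
    rewrite /u /= Tit // (stab_T kg p1 sg) // Tit // T0 // jc -/mu mulr1 mulrA mm.
    by rewrite mul1r.
  have [B [B0 BE]] : exists B : R, 0 < B /\ forall k, E p (u k 0) 0 <= B.
    exists (E p 0 b / jac g p + E p (g b) b + E p b 0 + 1); split.
      have := E_ge0 p (g b) b; have := E_ge0 p b 0.
      have : 0 <= E p 0 b / jac g p by rewrite divr_ge0 ?E_ge0 // ltW.
      lra.
    move=> k; have ukp : u k 0 != p := neq_in_out (kg_lt1 kg (Gu k)) p1.
    by have := Eu k; have := E_tri ukp bp zp; lra.
  have [r r0 Wr] : exists2 r : R, 0 < r & forall k, r <= W (u k 0).
    exists (Num.min (3 / 4) ((jac g p)^-1 / (4 * B ^+ 2))).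
      by rewrite lt_min !divr_gt0 ?invr_gt0 ?mulr_gt0 ?exprn_gt0.
    move=> k; have uk1 := kg_lt1 kg (Gu k).
    have ukp := neq_in_out uk1 p1; rewrite -enorm_sub_gt0 in ukp.
    have [yl|yl] := leP (enorm (u k 0)) (1 / 2).
      rewrite ge_min; apply/orP; left; rewrite /W; have := enorm_ge0 (u k 0); nra.
    rewrite ge_min; apply/orP; right.
    have := Tu k; rewrite /T => /(congr1 (fun t => t * enorm (u k 0 - p) ^+ 2)).
    rewrite divfK ?expf_neq0 ?gt_eqF // => ->; rewrite ler_pM2l ?invr_gt0 //.
    have := BE k; rewrite /E subr0 sub0r enormN p1 mulr1 ler_pdivrMr // => h.
    rewrite -[X in X <= _]mul1r ler_pdivrMr ?mulr_gt0 ?exprn_gt0 //.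
    have : (1 / 2) ^+ 2 <= (B * enorm (u k 0 - p)) ^+ 2.
      have n1 : 0 <= 1 / 2 :> R by lra.
      have n2 : 0 <= B * enorm (u k 0 - p) by rewrite mulr_ge0 // ltW.
      by rewrite ler_pXn2r ?nnegrE // (le_trans (ltW yl) h).
    rewrite exprMn; move: (enorm (u k 0 - p)) => N hN; lra.
  (* two of the [u k] coincide; then a power of [d] fixes [g b], hence [g b = b] *)
  have [|i [j [ij uij]]] := @repeated_value _ _ u (kg_fin kg r0); first by move=> k; split.
  have /(congr1 (fun f : V -> V => f b)) := uij.
  have [k jE] : exists k, j = (i + k.+1)%N by exists (j - i.+1)%N; rewrite addnS -addSn subnKC.
  rewrite /u /= !itcb jE iterD => h.
  have ci := kg_conf kg (kg_iter kg i Gd).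
  have ck := kg_conf kg (kg_iter kg k.+1 Gd).
  have {}h := conf_inj ci gb1 (conf_le1 ck gb1) h.
  have := stab_iter_E k.+1 p1 sd gb1 b1' gbp bp; rewrite itb -h -/mu => EE.
  have mk1 : mu ^+ k.+1 < 1 by rewrite exprn_ilt1 // ltW.
  have E0 : E p (g b) b = 0 by have := E_ge0 p (g b) b; nra.
  rewrite -enorm_sub_gt0 in gbp; have bp' := bp; rewrite -enorm_sub_gt0 in bp'.
  move/eqP: E0; rewrite /E mulf_eq0 invr_eq0 mulf_eq0 (gt_eqF gbp) (gt_eqF bp') !orbF.
  by rewrite enorm_sub_eq0 => /eqP.
apply: inf; apply: (@sub_finite_set _ _ [set p; b]); last first.
  by rewrite finite_setU; split; exact: finite_set1.
move=> x Lx; apply: contrapT => /not_orP[/eqP xp /eqP xb].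
rewrite -enorm_sub_gt0 in xp; rewrite -enorm_sub_gt0 in xb.
have [|g [Gg gx Wg]] := @lim_W _ _ _ kg x
  (Num.min (Num.min (enorm (x - p) / 2) (enorm (x - b) / 2))
    (enorm (x - p) * enorm (x - b) / 4)) Lx.
  by rewrite !lt_min !divr_gt0 ?mulr_gt0.
move: gx Wg; rewrite !lt_min => /andP[/andP[gx1 gx2] _] /andP[_ Wg].
have cg := kg_conf kg Gg; have sg := fixp g Gg.
have h1 := conf_sqr cg p1' e0'; have h2 := conf_sqr cg b1' e0'; have h3 := conf_sqr cg p1' b1'.
rewrite sg.2 jac0 subr0 p1 expr1n mulr1 in h1.
rewrite (all_fix g Gg) jac0 subr0 b1 expr1n mulr1 in h2.
rewrite sg.2 (all_fix g Gg) in h3.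
(* [p] and [b] are fixed by all elements, so that the orbit of [0] stays in a
   neighbourhood of the geodesic from [p] to [b], which meets the sphere only there *)
have jj : jac g p * jac g b = 1.
  have n0 : enorm (p - b) ^+ 2 != 0.
    by rewrite expf_neq0 // enorm_eq0 subr_eq0 eq_sym.
  by apply: (mulIf n0); rewrite -h3 mul1r.
have h4 : (enorm (p - g 0) * enorm (b - g 0)) ^+ 2 = W (g 0) ^+ 2.
  rewrite exprMn h1 h2; have -> : jac g p * W (g 0) * (jac g b * W (g 0)) =
    (jac g p * jac g b) * W (g 0) ^+ 2 by ring.
  by rewrite jj mul1r.
have h5 : enorm (p - g 0) * enorm (b - g 0) = W (g 0).
  apply: (pexpIrn (n := 2)) => //; rewrite nnegrE ?mulr_ge0 ?enorm_ge0 //.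
  by rewrite ltW ?(kg_Wgt0 kg).
have h6 : enorm (x - p) / 2 <= enorm (p - g 0).
  by have := enorm_tri x (g 0) p; rewrite (enormC x (g 0)) (enormC (g 0) p); lra.
have h7 : enorm (x - b) / 2 <= enorm (b - g 0).
  by have := enorm_tri x (g 0) b; rewrite (enormC x (g 0)) (enormC (g 0) b); lra.
have h8 : enorm (x - p) / 2 * (enorm (x - b) / 2) <= enorm (p - g 0) * enorm (b - g 0).
  by apply: ler_pM => //; rewrite divr_ge0 // ltW.
lra.
Qed.

End NoFix.

(** * Geodesics between cusps *)

Section Chains.
Context {R : realType} {m : nat}.
Notation V := 'rV[R]_m.
Implicit Types (x y z p a b : V).

Section Chain.
Variable xi : nat -> V.
Hypothesis xi1 : forall n, enorm (xi n) = 1.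
Let eps n := enorm (xi n - xi n.+1).
Hypothesis eps0 : forall n, 0 < eps n.
Hypothesis epsS : forall n, eps n.+1 <= eps n / 10.

Lemma chain_cauchy k n : enorm (xi (n + k)%N - xi n) <= 10 / 9 * eps n.
Proof.
elim: k n => [|k IH] n.
  by rewrite addn0 subrr enorm0 mulr_ge0 // ltW.
have := enorm_tri (xi (n + k.+1)%N) (xi n.+1) (xi n).
rewrite [enorm (xi n.+1 - _)]enormC -/(eps n) -addSnnS.
by have := IH n.+1; have := epsS n; lra.
Qed.

Lemma chain_limit : exists2 x, enorm x = 1 & forall n, enorm (x - xi n) <= 10 / 9 * eps n.
Proof.
have [|x x1 cx] := @cluster_point _ _ xi; first by move=> i; rewrite xi1.
have xn n : enorm (x - xi n) <= 10 / 9 * eps n.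
  apply/ler_addgt0Pr => e e0; have [i ni ie] := cx e n e0.
  have := enorm_tri x (xi i) (xi n); have := chain_cauchy (i - n) n.
  by rewrite subnKC // enormC in ie *; lra.
exists x => //; apply/eqP; rewrite eq_le x1 /=; apply/ler_addgt0Pr => e e0.
have [i _ ie] := cx e 0%N e0; have := enorm_subl (xi i) x; rewrite xi1; lra.
Qed.

Lemma eps_anti i j : (i <= j)%N -> eps j <= eps i.
Proof.
elim: j => [|j IH]; first by rewrite leqn0 => /eqP ->.
rewrite leq_eqVlt => /orP[/eqP -> //|]; rewrite ltnS => /IH.
by have := epsS j; have := eps0 j; lra.
Qed.

Lemma eps_small e : 0 < e -> exists n, eps n < e.
Proof.
move=> e0; have [||k hk] := @exp_small R (1 / 10) (e / eps 0%N); first by lra.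
  by rewrite divr_gt0.
exists k; move: hk; rewrite ltr_pdivlMr //; apply: le_lt_trans.
elim: k => [|k IH]; first by rewrite expr0 mul1r.
by rewrite exprS; have := epsS k; lra.
Qed.

(** A point [y] near the limit [x] is at a distance from [x] comprised between two
    successive scales of the chain, so that its cone at [x] is governed by the single
    geodesic from [xi n] to [xi n.+1]. *)
Lemma chain_far (Y : V -> Prop) x : (forall n, enorm (x - xi n) <= 10 / 9 * eps n) ->
  (forall y, Y y -> enorm y < 1) ->
  enorm x = 1 ->
  (forall n y, Y y -> n%:R <= kap y (xi n) (xi n.+1)) ->
  forall k, exists2 e, 0 < e &
    forall y, Y y -> enorm (y - x) < e -> k * W y < enorm (y - x).
Proof.
move=> xn Y1 x1 Yk k.
pose N := (Num.truncn (5 * `|k|)).+1; have Nk : 5 * `|k| < N%:R by exact: truncnS_gt.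
exists (eps N) => // y Yy; have y1 := Y1 y Yy.
have Wy : 0 < W y by rewrite W_gt0.
have : y != x by apply: neq_in_out.
rewrite -enorm_sub_gt0; set s := enorm (y - x) => s0 sN.
rewrite ltNge; apply/negP => sk.
have ex : exists n, eps n.+1 <= s.
  have [n hn] := eps_small s0; exists n.
  by have := eps_anti (leqnSn n); lra.
case: (ex_minnP ex) => n sn minn.
have nN : (N <= n)%N.
  rewrite leqNgt; apply/negP => /eps_anti; lra.
have sn' : s < eps n.
  case: n sn minn nN => [|n] sn minn nN.
    by apply: (lt_le_trans sN); exact: eps_anti.
  by rewrite ltNge; apply/negP => /minn; rewrite ltnn.
have A1 : enorm (y - xi n) <= 19 / 9 * eps n.
  by have := enorm_tri y x (xi n); rewrite -/s; have := xn n; lra.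
have A2 : enorm (y - xi n.+1) <= 19 / 9 * s.
  by have := enorm_tri y x (xi n.+1); rewrite -/s; have := xn n.+1; lra.
have := Yk n y Yy; rewrite /kap (ler_pdivlMr _ _ (mulr_gt0 Wy (eps0 n))) -/(eps n) => h.
have h2 : enorm (y - xi n) * enorm (y - xi n.+1) <= (19 / 9 * eps n) * (19 / 9 * s).
  by apply: ler_pM; rewrite ?enorm_ge0.
have h3 : n%:R * W y <= 361 / 81 * s.
  rewrite -(ler_pM2r (eps0 n)).
  have -> : n%:R * W y * eps n = n%:R * (W y * eps n) by ring.
  have -> : 361 / 81 * s * eps n = 19 / 9 * eps n * (19 / 9 * s) by field.
  lra.
have h4 : N%:R * W y <= n%:R * W y by rewrite ler_wpM2r ?ler_nat // ltW.
have h5 : k * W y <= `|k| * W y by rewrite ler_wpM2r ?ler_norm // ltW.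
have h6 : 5 * `|k| * W y < N%:R * W y by rewrite ltr_pM2r.
have h7 : 0 <= `|k| * W y by rewrite mulr_ge0 // ltW.
lra.
Qed.

End Chain.
End Chains.

Section Cusp.
Context {R : realType} {m : nat}.
Notation V := 'rV[R]_m.
Implicit Types (x y z p a b q : V) (f g h c : V -> V).
Variables (Gam : set (V -> V)) (Par : set V).

(** Geometric finiteness as it enters the argument: a dichotomy on the limit set,
    and parabolic elements given by an action without fixed points in the ball. *)
Record cusped : Prop := Cusped {
  cu_count : countable Par;
  cu_dich : forall x, limpt Gam x -> conic Gam x \/ Par x;
  cu_lim : forall p, Par p -> limpt Gam p;
  cu_ncon : forall p, Par p -> ~ conic Gam p;
  cu_par : forall p, Par p -> exists2 f, stab Gam p f & forall z, enorm z < 1 -> f z <> z;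
  cu_inf : infinite_set (limpt Gam) }.

Variables (kg : kgroup Gam) (cu : cusped).

Lemma countable_enum : exists e : nat -> V, forall p, Par p -> exists n, e n = p.
Proof.
have /countable_injP[f finj] := cu_count cu.
exists (fun n => xget 0 [set p | Par p /\ f p = n]) => p Pp; exists (f p).
case: xgetP => [q _ [Pq fq]|/(_ p)]; last by case.
by apply: finj; rewrite ?inE.
Qed.

(** Otherwise the geodesics from [p] to [g p] go arbitrarily far from the orbit, and
    by [stab_attract] the second end point can be taken arbitrarily close to the first.
    Moving the picture by the group produces a chain of cusps, each much closer to the
    next, with geodesics between neighbours farther and farther from the orbit. Its limit
    [x] is a limit point that is not conical by [chain_far]; but the [n]-th step can be
    chosen so short that [x] differs from the [n]-th parabolic point. This contradicts
    the dichotomy. *)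
Lemma cusp_geodesics p : Par p -> exists r, forall g, Gam g -> g p != p ->
  exists2 h, Gam h & kap (h 0) p (g p) < r.
Proof.
move=> Pp; apply: contrapT => /forallNP H.
have [p1 Lp] := cu_lim cu Pp; have ncp := cu_ncon cu Pp.
have [c0 sc0 nfix] := cu_par cu Pp.
have p1' : enorm p <= 1 by rewrite p1.
have step w d n : Gam w -> 0 < d -> exists w', [/\ Gam w', 0 < enorm (w p - w' p) <= d &
    forall h, Gam h -> n%:R <= kap (h 0) (w p) (w' p)].
  move=> Gw d0; have /existsNP[g /not_implyP[Gg /not_implyP[gp far]]] := H n%:R.
  have far' h : Gam h -> n%:R <= kap (h 0) p (g p).
    by move=> Gh; rewrite leNgt; apply/negP => hn; apply: far; exists h.
  have [K K0 lK] := kg_lip kg Gw.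
  have gp1 : enorm (g p) <= 1 by rewrite (conf_eq1 (kg_conf kg Gg)).
  have [|c sc cp] := @stab_attract _ _ Gam kg p c0 (g p) (d / K) p1 ncp sc0 nfix gp1 gp.
    by rewrite divr_gt0.
  have Gwc : Gam (w \o c) by apply: (kg_comp kg) => //; exact: sc.1.
  have cgp1 : enorm (c (g p)) <= 1 by rewrite (conf_le1 (kg_conf kg sc.1)).
  exists (w \o c \o g); split.
  - exact: (kg_comp kg).
  - rewrite enorm_sub_gt0 /=; apply/andP; split.
      apply: (conf_neq (kg_conf kg Gw)) => //.
      by rewrite eq_sym; exact: (stab_neq kg p1 sc).
    apply: (le_trans (lK _ _ p1' cgp1)); rewrite enormC mulrC -ler_pdivlMr //.
    exact: ltW.
  move=> h Gh; have [v [Gv vw wv _ _]] := kg_invP kg Gwc.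
  have := far' (v \o h) (kg_comp kg Gv Gh).
  have vh1 : enorm (v (h 0)) < 1 := kg_lt1 kg (kg_comp kg Gv Gh).
  rewrite eq_sym in gp.
  rewrite -(conf_kap (kg_conf kg Gwc) vh1 p1' gp1 gp) /= sc.2.
  by rewrite [w (c (v _))](wv _ _) // (kg_le1 kg Gh).
have [e eP] := countable_enum.
(* a step so short that the rest of the chain cannot come back to [e n] *)
pose lim_d (n : nat) (w : V -> V) (d : R) :=
  if e n == w p then d else Num.min d (enorm (e n - w p) / 10).
have lim_d0 n w d : 0 < d -> 0 < lim_d n w d.
  move=> d0; rewrite /lim_d; case: ifPn => // en.
  by rewrite lt_min d0 divr_gt0 // enorm_sub_gt0.
pose ok (s : nat * (V -> V) * R) := Gam s.1.2 /\ 0 < s.2.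
(* a state is the rank, the element giving the current cusp, and the bound on the
   next step *)
pose rel (s t : {s | ok s}) :=
  let: (n, w, d) := sval s in let: (n', w', d') := sval t in
  [/\ n' = n.+1, 0 < enorm (w p - w' p) <= lim_d n w d,
      forall h, Gam h -> n%:R <= kap (h 0) (w p) (w' p) &
      d' = enorm (w p - w' p) / 10].
have ex_rel s : {t | rel s t}.
  apply: cid; case: s => -[[n w] d] [/= Gw d0].
  have [w' [Gw' ww' far]] := step w (lim_d n w d) n Gw (lim_d0 n w d d0).
  have ok' : ok (n.+1, w', enorm (w p - w' p) / 10).
    by split => //=; case/andP: ww' => ? _; rewrite divr_gt0.
  by exists (exist _ _ ok').
have ok0 : ok (0%N, id, 1) by split => //=; exact: (kg_id kg).
have [F [F0 FS]] := dependent_choice ex_rel (exist _ _ ok0).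
have Fn n : (sval (F n)).1.1 = n.
  elim: n => [|n IH]; first by rewrite F0.
  have := FS n; rewrite /rel; case: (sval (F n)) IH => -[n1 w1] d1 /= ->.
  by case: (sval (F n.+1)) => -[n2 w2] d2 /= [].
pose w n := (sval (F n)).1.2; pose d n := (sval (F n)).2.
have Gw n : Gam (w n) by have [] := svalP (F n).
have d0 n : 0 < d n by have [] := svalP (F n).
have relE n : [/\ 0 < enorm (w n p - w n.+1 p) <= lim_d n (w n) (d n),
    forall h, Gam h -> n%:R <= kap (h 0) (w n p) (w n.+1 p) &
    d n.+1 = enorm (w n p - w n.+1 p) / 10].
  have := FS n; have := Fn n; rewrite /rel /w /d.
  case: (sval (F n)) => -[n1 w1] d1 /= ->.
  by case: (sval (F n.+1)) => -[n2 w2] d2 /= [].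
pose xi n := w n p.
have xi1 n : enorm (xi n) = 1 by rewrite (conf_eq1 (kg_conf kg (Gw n))).
have eps0 n : 0 < enorm (xi n - xi n.+1) by have [/andP[]] := relE n.
have limd n w' d' : lim_d n w' d' <= d'.
  by rewrite /lim_d; case: ifP => // _; rewrite ge_min lexx.
have epsS n : enorm (xi n.+1 - xi n.+2) <= enorm (xi n - xi n.+1) / 10.
  have [_ _ <-] := relE n; have [/andP[_ h] _ _] := relE n.+1.
  exact: (le_trans h (limd _ _ _)).
have [x x1 xn] := chain_limit xi1 eps0 epsS.
have Lx : limpt Gam x.
  split => // r r0; have [n nr] := eps_small eps0 epsS (divr_gt0 r0 (ltr0Sn _ 1)).
  have [_ /(_ (r / 4))] := lim_inv kg (Gw n) (cu_lim cu Pp).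
  case=> [|f Gf fx]; first by rewrite divr_gt0.
  exists f => //; have := enorm_tri (f 0) (w n p) x; have := xn n.
  move: fx; rewrite -/(xi n) [enorm (xi n - x)]enormC; move: nr; lra.
have ncx : ~ conic Gam x.
  move=> [_ [k Hk]].
  have [||r r0 far] := @chain_far _ _ xi eps0 epsS (fun y => exists2 h, Gam h & y = h 0)
    x xn _ x1 _ k.
  - by move=> y [h Gh ->]; exact: (kg_lt1 kg Gh).
  - by move=> n y [h Gh ->]; have [_ + _] := relE n; exact.
  have [f [Gf fr fk]] := Hk r r0.
  have := far (f 0) (ex_intro2 _ _ f Gf erefl) fr; lra.
have [//|Px] := cu_dich cu Lx.
have [n en] := eP x Px.
have [/andP[_ le1] _ _] := relE n.
have := xn n; have := xn n.+1; have := epsS n; have := eps0 n.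
have := enorm_tri (xi n) x (xi n.+1).
rewrite [enorm (xi n - x)]enormC.
have [xw|xw] := eqVneq x (xi n).
  by rewrite xw subrr enorm0; lra.
move: le1; rewrite /lim_d en -/(xi n) (negbTE xw) le_min => /andP[_].
rewrite -enorm_sub_gt0 in xw; rewrite -/(xi n.+1); lra.
Qed.

End Cusp.

(** * Heights of orbit points above a cusp *)

Section Cusp.
Context {R : realType} {m : nat}.
Notation V := 'rV[R]_m.
Implicit Types (x y z p a b q s : V) (f g h c : V -> V).
Variables (Gam : set (V -> V)) (Par : set V).
Variables (kg : kgroup Gam) (cu : cusped Gam Par).

Lemma Par_moved p : Par p -> exists2 g, Gam g & g p != p.
Proof. by move=> /(cu_lim cu)[p1 _]; exact: (no_global_fix kg (cu_inf cu)). Qed.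

Section OneCusp.
Variables (p : V) (Pp : Par p) (R0 r : R).
Hypotheses (R00 : 1 <= R0) (R0r : 4 * R0 <= r).
Hypothesis X : forall g, Gam g -> g p != p -> exists2 h, Gam h & kap (h 0) p (g p) < R0.

Let p1 : enorm p = 1. Proof. exact: (cu_lim cu Pp).1. Qed.
Let p1' : enorm p <= 1. Proof. by rewrite p1. Qed.

Lemma r_gt0 : 0 < r. Proof. by have := R00; have := R0r; lra. Qed.

(** [h 0] is, up to a factor 2, the highest orbit point above [p] among those near the
    geodesic from [p] to [q]. *)
Definition nearmax h q := [/\ Gam h, kap (h 0) p q <= r &
  forall h', Gam h' -> kap (h' 0) p q <= r -> T p (h' 0) <= 2 * T p (h 0)].

Lemma Tp_gt0 h : Gam h -> 0 < T p (h 0).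
Proof.
move=> Gh; rewrite /T divr_gt0 ?(kg_Wgt0 kg) // exprn_gt0 // enorm_sub_gt0.
exact: neq_in_out (kg_lt1 kg Gh) p1.
Qed.

(** Since [p] is not conical, the orbit points near the geodesic from [q] to [p] do
    not rise indefinitely. *)
Lemma nearmax_exists g : Gam g -> g p != p -> exists h, nearmax h (g p).
Proof.
move=> Gg gp; set q := g p.
have q1 : enorm q = 1 by rewrite (conf_eq1 (kg_conf kg Gg)).
have r0 := r_gt0.
have rR : R0 <= r by have := R00; have := R0r; lra.
pose S := [set t | exists h, [/\ Gam h, kap (h 0) p q <= r & t = T p (h 0)]].
have [h0 Gh0 kh0] := X Gg gp.
have S0 : S !=set0.
  by exists (T p (h0 0)), h0; split => //; rewrite ltW // (lt_le_trans kh0).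
(* unbounded heights along one geodesic would make [p] conical *)
have Sb : has_ubound S.
  apply: contrapT => nb; apply: (cu_ncon cu Pp); split => //; exists (2 * r) => e e0.
  have d0 : 0 < enorm (p - q) by rewrite enorm_sub_gt0 eq_sym.
  set d := enorm (p - q) in d0 *.
  pose M := 2 / e + 4 / d.
  have e20 : 0 < 2 / e by rewrite divr_gt0.
  have d40 : 0 < 4 / d by rewrite divr_gt0.
  have [h [Gh kh Mh]] : exists h, [/\ Gam h, kap (h 0) p q <= r & M < T p (h 0)].
    apply: contrapT => H; apply: nb; exists M => t [h [Gh kh ->]].
    by rewrite leNgt; apply/negP => hM; apply: H; exists h.
  exists h; have h1 := kg_lt1 kg Gh; have Wh := kg_Wgt0 kg Gh.
  have := neq_in_out h1 p1; rewrite -enorm_sub_gt0.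
  have := T_le_dist p1 h1; move: kh; rewrite /kap ler_pdivrMr ?mulr_gt0 // -/d.
  have := enorm_tri p (h 0) q; rewrite (enormC p (h 0)) -/d.
  set D := enorm (h 0 - p) => tri kh TD D0.
  have MD : M * D < 2 by apply: lt_le_trans TD; rewrite ltr_pM2r.
  have De : 2 / e * D < 2 by apply: le_lt_trans MD; rewrite ler_pM2r // /M; lra.
  have Dd : 4 / d * D < 2 by apply: le_lt_trans MD; rewrite ler_pM2r // /M; lra.
  have {}De : D < e by move: De; rewrite mulrAC ltr_pdivrMr // ltr_pM2l.
  have {}Dd : D < d / 2 by move: Dd; rewrite mulrAC ltr_pdivrMr //; lra.
  split => //; have hq : d / 2 <= enorm (h 0 - q) by lra.
  have : D * (d / 2) <= D * enorm (h 0 - q) by rewrite ler_pM2l.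
  move=> h2; rewrite -(ler_pM2r d0).
  have -> : 2 * r * W (h 0) * d = 2 * (r * (W (h 0) * d)) by ring.
  lra.
have hs : has_sup S by [].
have le_sup t : S t -> t <= sup S by move=> St; apply: sup_ubound.
have s0 : 0 < sup S.
  apply: lt_le_trans (le_sup _ _); first exact: (Tp_gt0 Gh0).
  by exists h0; split => //; rewrite ltW // (lt_le_trans kh0).
have [|_ [h [Gh kh ->]] hh] := @sup_adherent _ S (sup S / 2) _ hs.
  by rewrite divr_gt0.
exists h; split => // h' Gh' kh'.
have := le_sup (T p (h' 0)) (ex_intro _ h' (And3 Gh' kh' erefl)).
by move: hh; move: (sup S) (T p (h 0)) (T p (h' 0)) => *; lra.
Qed.

(** The images of [p] under the elements bringing a highest orbit point back to [0]. *)
Definition pulled s := exists h g, [/\ Gam g, g p != p, nearmax h (g p),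
  enorm s = 1 & h s = p].

(** Transport of [nearmax] by [h]: [q] is the image of the other end of the geodesic,
    at a definite distance since [0] is near the geodesic from [s] to [q], and no orbit
    point near it is higher than 2. *)
Lemma pulled_far s : pulled s -> exists q, [/\ enorm q = 1, r^-1 <= enorm (s - q) &
  forall f, Gam f -> kap (f 0) s q <= r -> T s (f 0) <= 2].
Proof.
move=> [h [g [Gg gp [Gh kh mh] s1 hs]]]; have r0 := r_gt0.
have [v [Gv vh hv _ _]] := kg_invP kg Gh.
have ch := kg_conf kg Gh.
have gp1 : enorm (g p) = 1 by rewrite (conf_eq1 (kg_conf kg Gg)).
have vq1 : enorm (v (g p)) = 1 by rewrite (conf_eq1 (kg_conf kg Gv)).
have hvq : h (v (g p)) = g p by rewrite hv // gp1.
have s1' : enorm s <= 1 by rewrite s1.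
have q1' : enorm (v (g p)) <= 1 by rewrite vq1.
have sq : s != v (g p).
  by apply: contra gp => /eqP e; rewrite -hvq -e hs.
have kE f : Gam f -> kap (f 0) s (v (g p)) = kap (h (f 0)) p (g p).
  by move=> Gf; rewrite -(conf_kap ch (kg_lt1 kg Gf) s1' q1' sq) hs hvq.
exists (v (g p)); split => //.
  move: kh; rewrite -(kE id (kg_id kg)) /= /kap !sub0r !enormN W0 s1 vq1 !mul1r.
  rewrite -[X in _ <= X]invrK lef_pV2 ?posrE ?invr_gt0 ?enorm_sub_gt0 //.
move=> f Gf; rewrite kE // => kf.
have := mh (h \o f) (kg_comp kg Gh Gf) kf; rewrite /= -hs.
have ns g' : Gam g' -> g' 0 != s by move=> Gg'; apply: neq_in_out s1; exact: kg_lt1 Gg'.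
have js : 0 < jac h s by rewrite (jac_gt0 ch).
rewrite (conf_T ch s1' (kg_le1 kg Gf) (ns f Gf)).
rewrite (conf_T ch s1' enorm0_le1 (ns id (kg_id kg))) T0 // mul1r.
by rewrite ler_pM2r // invr_gt0.
Qed.

(** Here [w 0] is near the geodesic from [s] to [s'] and on the side of [s]: it is then
    also near the geodesic from [s] to [q], where heights are at most 2, and a height
    near a short geodesic is large. *)
Lemma pulled_low s s' w : pulled s -> enorm s' = 1 -> Gam w ->
  kap (w 0) s s' < R0 -> s != s' -> enorm (w 0 - s) <= enorm (w 0 - s') ->
  Num.min (8 * R0 ^+ 2)^-1 (2 * R0 * r)^-1 <= enorm (s - s').
Proof.
move=> Ss s'1 Gw kw ss' le1; rewrite leNgt; apply/negP; rewrite lt_min => /andP[e1 e2].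
have r0 := r_gt0; have R1' := R00; have w1 := kg_lt1 kg Gw; have Ww := kg_Wgt0 kg Gw.
have s1 : enorm s = 1 by have [h [g []]] := Ss.
have [q [q1 sq low]] := pulled_far Ss.
have ws := neq_in_out w1 s1; have ws' := neq_in_out w1 s'1.
move: kw le1 (enorm_tri (w 0) s q) (enorm_tri s (w 0) s') (low w Gw) (W_le_dist s'1 (ltW w1)).
move: ws ws' ss'; rewrite -!enorm_sub_gt0 /kap /T (enormC s (w 0)) => ws ws' ss'.
rewrite ltr_pdivrMr ?mulr_gt0 //.
have rV : 0 < r^-1 by rewrite invr_gt0.
have sq0 : 0 < enorm (s - q) := lt_le_trans rV sq.
rewrite ler_pdivrMr ?mulr_gt0 // ler_pdivrMr ?exprn_gt0 //.
(* only elementary inequalities between the distances remain *)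
move: ws ws' ss' sq sq0 e1 e2 Ww.
move: (enorm (w 0 - s)) (enorm (w 0 - s')) (enorm (s - s')) (enorm (s - q))
  (enorm (w 0 - q)) (W (w 0)) => a b d D u t a0 b0 d0 Dr D0 e1 e2 t0 kw ab uD db low' tb.
have ad : a < 2 * R0 * d.
  rewrite -(ltr_pM2r b0); apply: (lt_le_trans kw).
  have -> : 2 * R0 * d * b = R0 * d * (2 * b) by ring.
  have -> : R0 * (t * d) = R0 * d * t by ring.
  by apply: ler_wpM2l => //; rewrite mulr_ge0 //; lra.
have at' : a < 2 * R0 * t.
  rewrite -(ltr_pM2r b0); apply: (lt_le_trans kw).
  have -> : 2 * R0 * t * b = R0 * t * (2 * b) by ring.
  have -> : R0 * (t * d) = R0 * t * d by ring.
  by apply: ler_wpM2l; [rewrite mulr_ge0 //; lra|lra].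
have R1 : 0 < 2 * R0 by lra.
have aD : a < D.
  apply: (lt_le_trans ad); apply: le_trans Dr.
  move: e2; rewrite invfM => e2.
  rewrite -(ler_pM2l (x := (2 * R0)^-1)) ?invr_gt0 // mulKf ?gt_eqF //.
  exact: ltW.
have : a * u <= r * (t * D).
  apply: (@le_trans _ _ (a * (2 * D))); first by rewrite ler_pM2l //; lra.
  have -> : a * (2 * D) = 2 * a * D by ring.
  have -> : r * (t * D) = r * t * D by ring.
  rewrite ler_pM2r //.
  apply: (@le_trans _ _ (4 * R0 * t)); first by lra.
  by rewrite ler_pM2r.
move=> /low'; rewrite expr2 => ta.
have R8 : 0 < 8 * R0 ^+ 2 by rewrite mulr_gt0 // exprn_gt0 //; lra.
move: e1; rewrite -[X in _ < X]mul1r ltr_pdivlMr // => e1.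
have : a * (4 * R0) < 1.
  apply: le_lt_trans e1; have -> : d * (8 * R0 ^+ 2) = 2 * R0 * d * (4 * R0) by ring.
  by rewrite ler_pM2r ?(ltW ad) //; lra.
have : 1 * t < a * (4 * R0) * t.
  rewrite mul1r; apply: (le_lt_trans ta).
  have -> : a * (4 * R0) * t = 2 * (a * (2 * R0 * t)) by ring.
  by rewrite ltr_pM2l // ltr_pM2l.
rewrite ltr_pM2r //; lra.
Qed.

(** If two pulled-back cusps [s] and [s'] were very close, an orbit point near the
    geodesic joining them would lie high above one of them, against maximality. *)
Lemma pulled_sep s s' : pulled s -> pulled s' -> s != s' ->
  Num.min (8 * R0 ^+ 2)^-1 (2 * R0 * r)^-1 <= enorm (s - s').
Proof.
move=> Ss Ss' ss'.
have [h [g [_ _ [Gh _ _] s1 hs]]] := Ss; have [h' [g' [_ _ [Gh' _ _] s1' hs']]] := Ss'.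
have [v [Gv vh hv _ _]] := kg_invP kg Gh.
have [v' [Gv' vh' hv' _ _]] := kg_invP kg Gh'.
have sl : enorm s <= 1 by rewrite s1.
have sl' : enorm s' <= 1 by rewrite s1'.
have hp : h (v' p) = h s' by rewrite -hs' vh'.
have hsp : (h \o v') p != p.
  rewrite /= hp -hs eq_sym.
  exact: (conf_neq (kg_conf kg Gh)).
have [f Gf] := X (kg_comp kg Gh Gv') hsp.
have Gw := kg_comp kg Gv Gf.
rewrite /= hp -{1}hs -[f 0]hv ?(kg_le1 kg Gf) //.
rewrite (conf_kap (kg_conf kg Gh) (kg_lt1 kg Gw)) // => kw.
have [le1|/ltW le1] := leP (enorm (v (f 0) - s)) (enorm (v (f 0) - s')).
  exact: (pulled_low Ss s1' Gw).
rewrite enormC; apply: (pulled_low Ss' s1 Gw) => //; first by rewrite kapC.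
by rewrite eq_sym.
Qed.

(** Separated subsets of the sphere are finite. *)
Lemma pulled_finite : finite_set pulled.
Proof.
apply: contrapT => /infinite_seq[u up inj].
have u1 i : enorm (u i) <= 1 by have [h [g [_ _ _ -> _]]] := up i.
have [x _ cx] := cluster_point u1.
have R1' := R00; set e := Num.min (8 * R0 ^+ 2)^-1 (2 * R0 * r)^-1.
have e0 : 0 < e.
  by rewrite lt_min !invr_gt0 !mulr_gt0 ?exprn_gt0 ?r_gt0 //; lra.
have [i _ ie] := cx (e / 2) 0%N (divr_gt0 e0 (ltr0Sn _ 1)).
have [j ij je] := cx (e / 2) i.+1 (divr_gt0 e0 (ltr0Sn _ 1)).
have uij : u i != u j by apply/eqP => /inj ij'; rewrite ij' ltnn in ij.
have := pulled_sep (up i) (up j) uij; rewrite -/e.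
by have := enorm_tri (u i) x (u j); rewrite (enormC x); lra.
Qed.

(** Finitely many pulled-back cusps mean finitely many orbit points, modulo the
    stabilizer of [p], occurring as highest points; so their heights are bounded, and the
    stabilizer brings [0] boundedly close to each of them. *)
Lemma stab_above : exists A, forall g, Gam g -> g p != p ->
  (exists2 c, stab Gam p c & E p (c 0) (g p) <= A) /\
  forall h, Gam h -> kap (h 0) p (g p) <= r -> T p (h 0) <= A.
Proof.
have ncp := cu_ncon cu Pp.
pose Q s (A : R) := exists f, [/\ Gam f, f s = p, T p (f 0) <= A & E p 0 (f 0) <= A].
have [|s|A HA] := @finite_bound R _ pulled Q pulled_finite.
- by move=> s a b [f [Gf fs Ta Ea]] ab; exists f; split => //; exact: le_trans ab.
- move=> [h [g [_ _ [Gh _ _] _ hs]]]; exists (T p (h 0) + E p 0 (h 0)), h; split => //.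
    by rewrite lerDl E_ge0.
  by rewrite lerDr T_ge0 ?(kg_le1 kg Gh).
exists ((2 + r) * (`|A|)) => g Gg gp.
have r0 := r_gt0; have A0 := normr_ge0 A.
have rA : 0 <= r * `|A| by rewrite mulr_ge0 // ltW.
have [h nm] := nearmax_exists Gg gp; have [Gh kh mh] := nm.
have [v [Gv vh hv _ _]] := kg_invP kg Gh.
have Sv : pulled (v p).
  exists h, g; split => //; first by rewrite (conf_eq1 (kg_conf kg Gv)).
  by rewrite hv.
have [f [Gf fs Tf Ef]] := HA _ Sv.
have [f' [Gf' f'f ff' _ _]] := kg_invP kg Gf.
have sc : stab Gam p (h \o f').
  split; first exact: (kg_comp kg).
  by rewrite /= -{1}fs f'f ?hv // (conf_le1 (kg_conf kg Gv)).
have cf0 : (h \o f') (f 0) = h 0 by rewrite /= f'f ?enorm0.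
have fp := neq_in_out (kg_lt1 kg Gf) p1.
have Th : T p (h 0) <= A.
  by rewrite -cf0 (stab_T kg p1 sc) ?(kg_le1 kg Gf) // (stab_jac kg p1 ncp sc) divr1.
have hA := ler_norm A.
split; last by move=> h' Gh' /(mh _ Gh'); lra.
exists (h \o f') => //.
have gp1 : enorm (g p) <= 1 by rewrite (conf_le1 (kg_conf kg Gg)).
have hp := neq_in_out (kg_lt1 kg Gh) p1.
apply: (le_trans (E_tri (y := h 0) _ hp gp)).
  exact: (neq_in_out (kg_lt1 kg sc.1) p1).
rewrite -{1}cf0 (stab_E kg p1 sc) ?(kg_le1 kg Gf) ?enorm0 //; last exact: neq_in_out p1.
rewrite (stab_jac kg p1 ncp sc) divr1 (E_kap hp gp (kg_lt1 kg Gh)).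
have : kap (h 0) p (g p) * T p (h 0) <= r * `|A|.
  apply: ler_pM => //; last by lra.
    by rewrite /kap divr_ge0 ?mulr_ge0 ?enorm_ge0 // W_ge0 (kg_le1 kg Gh).
  by rewrite T_ge0 ?(kg_le1 kg Gh).
lra.
Qed.

End OneCusp.
End Cusp.

(** * Bounded rays are badly approximable *)

Section CuspBounded.
Context {R : realType} {m : nat}.
Notation V := 'rV[R]_m.
Implicit Types (x y z p a b q s : V) (f g h c : V -> V).
Variables (Gam : set (V -> V)) (Par : set V).
Variables (kg : kgroup Gam) (cu : cusped Gam Par).

(** The two facts known about cusps of geometrically finite groups: the orbit misses a
    horoball at [p], and the stabilizer acts cocompactly on the limit set minus [p], in the
    sense that each of its points is at bounded Euclidean distance, in the half space at
    [p], from a translate of [0]. Every orbit point [f 0] is near the geodesic from [p] to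
    one of [f p] and [f (g1 p)], so [stab_above] applies; limit points are reached by
    density. *)
Lemma cusp_bounded p : Par p -> exists A, [/\ 0 < A,
  forall f, Gam f -> T p (f 0) <= A &
  forall a, (exists2 f, Gam f & a = f 0) \/ (limpt Gam a /\ a != p) ->
    exists2 c, stab Gam p c & E p (c 0) a <= A].
Proof.
move=> Pp; have [p1 _] := cu_lim cu Pp; have ncp := cu_ncon cu Pp.
have [rp Xp] := cusp_geodesics kg cu Pp.
have [g1 Gg1 g1p] := Par_moved kg cu Pp.
have d0 : 0 < enorm (p - g1 p) / 2 by rewrite divr_gt0 // enorm_sub_gt0 eq_sym.
(* any point is at distance at least [c0] from one of [p] and [g1 p] *)
have [c0 c0E] : exists c0 : R, c0 = enorm (p - g1 p) / 2 by eexists.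
rewrite -c0E in d0.
have i0 : 0 < c0^-1 by rewrite invr_gt0.
have n0 := normr_ge0 rp.
have [||g Gg gp|A HA] := @stab_above _ _ _ _ kg cu p Pp (`|rp| + 1) (4 * (`|rp| + 1) + c0^-1).
- by lra.
- by lra.
- have [h Gh kh] := Xp g Gg gp; exists h => //; apply: (lt_le_trans kh).
  by have := ler_norm rp; lra.
have rge : c0^-1 <= 4 * (`|rp| + 1) + c0^-1 by lra.
move: HA rge; move: (4 * (`|rp| + 1) + c0^-1) => r HA rge.
have p1' : enorm p <= 1 by rewrite p1.
have above f : Gam f -> T p (f 0) <= A /\
    exists2 c, stab Gam p c & E p (c 0) (f 0) <= A + r * `|A|.
  move=> Gf; have [v [Gv vf fv _ _]] := kg_invP kg Gf.
  have fp0 := neq_in_out (kg_lt1 kg Gf) p1.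
  have b1 : enorm (v p) = 1 by rewrite (conf_eq1 (kg_conf kg Gv)).
  have [g' Gg' far] : exists2 g', Gam g' & c0 <= enorm (v p - g' p).
    have [h|h] := leP c0 (enorm (v p - p)).
      by exists id => //; exact: (kg_id kg).
    exists g1 => //; have := enorm_tri p (v p) (g1 p).
    by rewrite (enormC p (v p)); lra.
  have g'1 : enorm (g' p) = 1 by rewrite (conf_eq1 (kg_conf kg Gg')).
  have vg' : v p != g' p by rewrite -enorm_sub_gt0; exact: lt_le_trans far.
  have fg'p : f (g' p) != p.
    by apply: contra vg' => /eqP e; rewrite -{1}e vf // g'1.
  have [[c sc Ec] low] := HA _ (kg_comp kg Gf Gg') fg'p.
  have kf : kap (f 0) p (f (g' p)) <= c0^-1.
    rewrite -{1}(fv p p1') (conf_kap (kg_conf kg Gf)) ?b1 ?g'1 ?enorm0 //.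
    rewrite /kap !sub0r !enormN W0 b1 g'1 !mul1r lef_pV2 ?posrE //.
    exact: lt_le_trans far.
  have kfr := le_trans kf rge.
  have Tf := low f Gf kfr.
  split => //; exists c => //.
  apply: (le_trans (E_tri (y := f (g' p)) _ fg'p fp0)).
    exact: (neq_in_out (kg_lt1 kg sc.1) p1).
  rewrite lerD // EC (E_kap fp0 fg'p (kg_lt1 kg Gf)).
  apply: ler_pM => //; last by apply: (le_trans Tf); exact: ler_norm.
    by rewrite /kap divr_ge0 ?mulr_ge0 ?enorm_ge0 // W_ge0 (kg_le1 kg Gf).
  by rewrite T_ge0 ?(kg_le1 kg Gf).
have r0 : 0 <= r by lra.
have rA : 0 <= r * `|A| by rewrite mulr_ge0.
exists (`|A| + r * `|A| + 1); have nA := ler_norm A; have nA0 := normr_ge0 A; split.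
- lra.
- by move=> f /above[]; lra.
move=> a [[f Gf ->]|[La ap]].
  by have [_ [c sc Ec]] := above f Gf; exists c => //; lra.
have := ap; rewrite -enorm_sub_gt0; set d := enorm (a - p) => dp.
have [a1 /(_ (Num.min (d / 2) (d ^+ 2 / 2)))] := La.
case=> [|f Gf]; first by rewrite lt_min !divr_gt0 ?exprn_gt0.
rewrite lt_min => /andP[fa1 fa2].
have [_ [c sc Ec]] := above f Gf; exists c => //.
have fp0 := neq_in_out (kg_lt1 kg Gf) p1.
apply: (le_trans (E_tri (y := f 0) _ fp0 ap)).
  exact: (neq_in_out (kg_lt1 kg sc.1) p1).
have : E p (f 0) a <= 1.
  rewrite /E -/d ler_pdivrMr ?mul1r ?mulr_gt0 ?enorm_sub_gt0 //.
  have : d / 2 <= enorm (f 0 - p).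
    by have := enorm_tri a (f 0) p; rewrite -/d (enormC a (f 0)); lra.
  move=> h; apply: (le_trans (ltW fa2)).
  have -> : d ^+ 2 / 2 = d / 2 * d by field.
  by rewrite ler_pM2r.
lra.
Qed.

(** It suffices to follow the Euclidean radius ending at [x]; [1 - |.|] equals [t] on
    it. *)
Definition bounded_ray x := exists C, forall t, 0 < t <= 1 ->
  exists2 f, Gam f & qd ((1 - t) *: x) (f 0) <= C.

Definition bad_at p x := exists2 k, 0 < k &
  forall g, Gam g -> k * W (g 0) < enorm (x - g p).

Lemma W_harnack C y z : enorm y < 1 -> enorm z < 1 -> 0 <= C -> qd y z <= C ->
  W z <= (2 + 16 * C) * W y.
Proof.
move=> y1 z1 C0; have := y1; have := z1; rewrite -!W_gt0 => Wz Wy.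
rewrite /qd ler_pdivrMr ?mulr_gt0 // => h.
have h1 : W z <= W y + 2 * enorm (y - z).
  have := enorm_subl y z; rewrite /W.
  have := enorm_ge0 y; have := enorm_ge0 z; have := enorm_ge0 (y - z); nra.
have d0 := enorm_ge0 (y - z).
move: Wz Wy h h1 d0; move: (W z) (W y) (enorm (y - z)) => a b d a0 b0 h h1 d0.
have [ab|ab] := leP a (2 * b).
  by apply: (le_trans ab); rewrite ler_pM2r //; lra.
have ad : a / 2 <= 2 * d by lra.
have : (a / 2) ^+ 2 <= (2 * d) ^+ 2 by rewrite ler_pXn2r ?nnegrE //; lra.
move=> h2; have : a * a <= (16 * C * b) * a by nra.
by rewrite ler_pM2r // => h3; nra.
Qed.

Lemma ray_W t x : enorm x = 1 -> 0 < t <= 1 ->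
  [/\ enorm ((1 - t) *: x) < 1, t <= W ((1 - t) *: x) <= 2 * t &
      enorm ((1 - t) *: x - x) = t].
Proof.
move=> x1 /andP[t0 t1].
have e : enorm ((1 - t) *: x) = 1 - t.
  by rewrite enormZ x1 mulr1 ger0_norm //; lra.
split; first by rewrite e; lra.
  by rewrite /W e; apply/andP; split; nra.
by rewrite scalerBl scale1r addrAC subrr add0r enormN enormZ x1 mulr1 gtr0_norm.
Qed.

Lemma jac_ge_W g x : Gam g -> enorm x <= 1 -> W (g 0) / 4 <= jac g x.
Proof.
move=> Gg x1; have [v [Gv _ _ gv0 <-]] := kg_invP kg Gg.
exact: (jac_ge (kg_conf kg Gg) (kg_lt1 kg Gv) gv0 x1).
Qed.

(** If [g p] is at distance less than [e * W (g 0)] from [x], the point of the ray at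
    Euclidean distance [e * W (g 0)] from [x] is deep in the horoball at [g p]. So is any
    orbit point at bounded distance from it, which contradicts [cusp_bounded] once [e] is
    small. *)
Lemma bounded_bad p x : Par p -> enorm x = 1 -> bounded_ray x -> bad_at p x.
Proof.
move=> Pp x1 [C0 HC]; have [p1 _] := cu_lim cu Pp.
have [A [A0 hA _]] := cusp_bounded Pp.
have p1' : enorm p <= 1 by rewrite p1.
have [C [Cp C0C]] : exists C, 0 <= C /\ C0 <= C.
  by exists `|C0|; rewrite normr_ge0 ler_norm.
pose K := 2 + 16 * C.
have K2 : 2 <= K by rewrite /K; lra.
have [L LE] : exists L, L = 4 * K * (8 * C * K + 8) by eexists.
have CK : 0 <= C * K by rewrite mulr_ge0 //; lra.
have L1 : 1 <= L by rewrite LE; nra.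
have LA : 0 < L * (A + 1) by rewrite mulr_gt0 //; lra.
have [e eE] : exists e, e = (L * (A + 1))^-1 by eexists.
have e0 : 0 < e by rewrite eE invr_gt0.
have e1 : e <= 1.
  have h1 : 1 * (A + 1) <= L * (A + 1) by rewrite ler_pM2r //; lra.
  by rewrite eE invf_le1 //; lra.
exists e => // g Gg; rewrite ltNge; apply/negP => near.
have Wg := kg_Wgt0 kg Gg; have Wg1 := W_le1 (g 0).
have [v [Gv vg gv _ _]] := kg_invP kg Gg.
have [t tE] : exists t, t = e * W (g 0) by eexists.
have t01 : 0 < t <= 1 by rewrite tE mulr_gt0 //=; nra.
have t0 : 0 < t by case/andP: t01.
have [z1 /andP[Wz1 Wz2] zx] := ray_W x1 t01.
have [f Gf /le_trans/(_ C0C) qf] := HC t t01.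
have y1 := kg_lt1 kg Gf; have Wy := kg_Wgt0 kg Gf.
set z := (1 - t) *: x in z1 Wz1 Wz2 zx qf.
have zy := W_harnack y1 z1 Cp; rewrite qdC in zy; have {}zy := zy qf.
have yz := W_harnack z1 y1 Cp qf.
have q1 : enorm (g p) = 1 by rewrite (conf_eq1 (kg_conf kg Gg)).
have zq : enorm (z - g p) <= 2 * t.
  by have := enorm_tri z x (g p); rewrite zx; rewrite -tE in near; lra.
have yzC : enorm (f 0 - z) ^+ 2 <= C * (W z * W (f 0)).
  move: qf; rewrite /qd ler_pdivrMr ?mulr_gt0 //; last exact: lt_le_trans Wz1.
  by rewrite enormC.
(* [f 0] is the orbit point near the ray, [z] the point of the ray *)
have yq : enorm (f 0 - g p) ^+ 2 <= (8 * C * K + 8) * t ^+ 2.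
  have h1 := enorm_tri (f 0) z (g p).
  have h2 : enorm (f 0 - g p) ^+ 2 <= 2 * enorm (f 0 - z) ^+ 2 + 2 * enorm (z - g p) ^+ 2.
    have := enorm_ge0 (f 0 - z); have := enorm_ge0 (z - g p).
    have := enorm_ge0 (f 0 - g p).
    move: (enorm (f 0 - z)) (enorm (z - g p)) (enorm (f 0 - g p)) h1 => a b c h1 c0 b0 a0.
    have : c ^+ 2 <= (a + b) ^+ 2 by rewrite ler_pXn2r ?nnegrE ?addr_ge0.
    have := sqr_ge0 (a - b); nra.
  have h3 : enorm (z - g p) ^+ 2 <= (2 * t) ^+ 2.
    by rewrite ler_pXn2r ?nnegrE ?enorm_ge0 // mulr_ge0 // ltW.
  have h4 : W z * W (f 0) <= (2 * t) * (K * (2 * t)).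
    apply: ler_pM; rewrite ?Wz2 ?(ltW Wy) //; first by rewrite (le_trans _ Wz1) // ltW.
    by apply: (le_trans yz); rewrite /K ler_pM2l //; lra.
  have h5 : C * (W z * W (f 0)) <= C * ((2 * t) * (K * (2 * t))) by rewrite ler_wpM2l.
  nra.
have fq : f 0 != g p by exact: neq_in_out q1.
have jg := jac_ge_W Gg p1'.
have := hA _ (kg_comp kg Gv Gf).
have -> : T p ((v \o f) 0) = T (g p) (f 0) * jac g p.
  rewrite -[f 0 in RHS]gv ?(kg_le1 kg Gf) // (conf_T (kg_conf kg Gg)) //.
  - by rewrite divfK // gt_eqF // (jac_gt0 (kg_conf kg Gg)).
  - exact: (kg_le1 kg (kg_comp kg Gv Gf)).
  exact: (neq_in_out (kg_lt1 kg (kg_comp kg Gv Gf)) p1).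
apply/negP; rewrite -ltNge.
have D0 : 0 < enorm (f 0 - g p) ^+ 2 by rewrite exprn_gt0 // enorm_sub_gt0.
rewrite /T mulrAC ltr_pdivlMr //.
apply: (le_lt_trans (y := A * ((8 * C * K + 8) * t ^+ 2))); first by rewrite ler_pM2l.
apply: (@lt_le_trans _ _ ((t / K) * (W (g 0) / 4))); last first.
  apply: ler_pM => //; first by rewrite divr_ge0 //; lra.
    by rewrite divr_ge0 // ltW.
  rewrite ler_pdivrMr; last by lra.
  by apply: (le_trans Wz1); rewrite mulrC.
have K0 : 0 < K by lra.
have -> : t / K * (W (g 0) / 4) = t * W (g 0) / (4 * K) by field; rewrite gt_eqF.
rewrite ltr_pdivlMr; last by lra.
have -> : A * ((8 * C * K + 8) * t ^+ 2) * (4 * K) = t * (A * L * t) by rewrite LE; ring.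
rewrite ltr_pM2l // tE mulrA -[X in _ < X]mul1r ltr_pM2r //.
rewrite eE ltr_pdivrMr // mul1r mulrC ltr_pM2l; lra.
Qed.

End CuspBounded.

(** * Badly approximable points have bounded rays *)

Section BadBounded.
Context {R : realType} {m : nat}.
Notation V := 'rV[R]_m.
Implicit Types (x y z p a b q s : V) (f g h c : V -> V).
Variables (Gam : set (V -> V)) (Par : set V).
Variables (kg : kgroup Gam) (cu : cusped Gam Par).

(** A point [z] between [a] and [b] on a geodesic lies, seen from [p], above one of
    the two end points. *)
Lemma geodesic_foot p z a b : z != p -> a != p -> b != p -> enorm z < 1 -> a != b ->
  kap z a b <= 1 -> E p z a <= 2 * T p z \/ E p z b <= 2 * T p z.
Proof.
move=> zp ap bp z1 ab k1.
have Tz := T_ge0 p (ltW z1).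
have key : E p z a * E p z b <= T p z * (E p z a + E p z b).
  apply: (@le_trans _ _ (T p z * E p a b)); last first.
    by apply: ler_wpM2l => //; rewrite (EC p z a) E_tri.
  have Eab : 0 <= T p z * E p a b by rewrite mulr_ge0 ?E_ge0.
  suff -> : E p z a * E p z b = kap z a b * (T p z * E p a b).
    by rewrite -[X in _ <= X]mul1r ler_wpM2r.
  rewrite /E /T /kap; rewrite -enorm_sub_gt0 in zp; rewrite -enorm_sub_gt0 in ap.
  rewrite -enorm_sub_gt0 in bp; rewrite -enorm_sub_gt0 in ab.
  by rewrite -W_gt0 in z1; field; rewrite !gt_eqF.
have [h|h] := leP (E p z a) (2 * T p z); first by left.
have [h'|h'] := leP (E p z b) (2 * T p z); first by right.
have : (E p z a - T p z) * (E p z b - T p z) > T p z ^+ 2.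
  rewrite expr2; have [T0'|T0'] := eqVneq (T p z) 0.
    by rewrite T0' mul0r mulr_gt0 //; lra.
  have Tp : 0 < T p z by rewrite lt_def T0'.
  by apply: ltr_pM => //; lra.
by nra.
Qed.

Lemma ray_kap x t : enorm x = 1 -> 0 < t <= 1 -> kap ((1 - t) *: x) 0 x <= 1.
Proof.
move=> x1 t01; have [z1 /andP[w1 w2] zx] := ray_W x1 t01; have /andP[t0 t1] := t01.
rewrite /kap sub0r enormN x1 mulr1 subr0 zx ler_pdivrMr; last exact: lt_le_trans w1.
rewrite mul1r; apply: le_trans w1; rewrite -[X in _ <= X]mul1r.
by apply: ler_wpM2r; [exact: ltW|exact: ltW].
Qed.

(** Bringing the nearest orbit point to [0]: this is the Dirichlet domain argument. *)
Lemma near_nearest z : enorm z < 1 -> (exists2 e, 0 < e & forall f, Gam f -> e <= qd z (f 0)) ->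
  exists2 g, Gam g & forall f, Gam f -> qd z (g 0) <= 2 * qd z (f 0).
Proof.
move=> z1 [e e0 he].
pose S := [set t | exists2 f, Gam f & t = qd z (f 0)].
have hi : has_inf S.
  split; first by exists (qd z 0), id => //; exact: (kg_id kg).
  by exists e => _ [f Gf ->]; exact: he.
have inf_le t : S t -> inf S <= t by move=> St; apply: (inf_lbound hi.2).
have ei : e <= inf S by apply: lb_le_inf; [exact: hi.1|move=> _ [f Gf ->]; exact: he].
have [|_ [g Gg ->] hg] := @inf_adherent _ S (inf S) _ hi; first exact: lt_le_trans ei.
exists g => // f Gf; have := inf_le (qd z (f 0)) (ex_intro2 _ _ f Gf erefl).
by move: hg; move: (inf S) (qd z (g 0)) (qd z (f 0)) => *; lra.
Qed.

(** The condition says that [0] is, up to a bounded amount, the orbit point nearest to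
    [xi], whereas a conical point has orbit points nearer and nearer. *)
Lemma dirichlet_nonconic xi : enorm xi = 1 ->
  (forall h, Gam h -> W (h 0) <= 2 * enorm (xi - h 0) ^+ 2) -> ~ conic Gam xi.
Proof.
move=> x1 dir [_ [k Hk]].
have k0 : 0 < 2 * `|k| + 1 by have := normr_ge0 k; lra.
have [f [Gf fx fk]] := Hk (2 * `|k| + 1)^-1 ltac:(by rewrite invr_gt0).
have := dir f Gf; rewrite (enormC xi); have Wf := kg_Wgt0 kg Gf.
have d0 : 0 < enorm (f 0 - xi).
  by rewrite enorm_sub_gt0; exact: (neq_in_out (kg_lt1 kg Gf) x1).
move: fx fk d0; move: (enorm (f 0 - xi)) => d fx fk d0 h.
have h1 : d * (2 * `|k| + 1) < 1 by rewrite -ltr_pdivlMr // mul1r.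
have h2 : d <= `|k| * W (f 0).
  by apply: (le_trans fk); rewrite ler_wpM2r ?ler_norm // ltW.
have h3 : d * d <= d * (`|k| * W (f 0)) by rewrite ler_pM2l.
have h4 : d * `|k| * W (f 0) < 1 / 2 * W (f 0) by rewrite ltr_pM2r //; nra.
nra.
Qed.

Variables (P : set V) (x : V).
Hypothesis PPar : P `<=` Par.
Hypothesis Prep : forall q, Par q -> exists g p, [/\ Gam g, P p & q = g p].
Hypothesis Lx : limpt Gam x.
Hypothesis bad : forall p, P p -> bad_at Gam p x.

Let x1 : enorm x = 1. Proof. by case: Lx. Qed.

(** Otherwise the distance from [x] to some [g p] would be 0. *)
Lemma bad_not_par g q : Gam g -> Par q -> x != g q.
Proof.
move=> Gg /Prep[h [p [Gh Pp ->]]]; have [k k0 bk] := bad Pp.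
have := bk _ (kg_comp kg Gg Gh); rewrite -enorm_sub_gt0.
by apply: le_lt_trans; rewrite mulr_ge0 ?(ltW k0) // ltW ?(kg_Wgt0 kg) //; exact: kg_comp.
Qed.

(** The heart of the matter: a cusp entered to depth [M] by the ray ending at [x]
    approximates [x] with constant of order [1 / M]. *)
Lemma deep_approx xi : Par xi -> exists p K, [/\ P p, 0 < K &
  forall M t g v, 0 < M -> 0 < t <= 1 -> Gam g -> Gam v ->
    (forall y, enorm y <= 1 -> v (g y) = y) -> (forall y, enorm y <= 1 -> g (v y) = y) ->
    M <= T xi (v ((1 - t) *: x)) ->
    exists2 f, Gam f & enorm (x - f p) <= K / M * W (f 0)].
Proof.
move=> Pxi; have [xi1 _] := cu_lim cu Pxi.
have [A [A0 hA bp]] := cusp_bounded kg cu Pxi.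
have [g0 [p [Gg0 Pp xiE]]] := Prep Pxi.
have w0 := kg_Wgt0 kg Gg0.
have K00 : 0 < 4 * (4 * A ^+ 2 + 8) by have := sqr_ge0 A; nra.
exists p, (4 * (4 * A ^+ 2 + 8) / (W (g0 0) / 4)); split => //.
  by rewrite divr_gt0 // divr_gt0.
move=> M t g v M0 t01 Gg Gv vg gv MT.
have xi1' : enorm xi <= 1 by rewrite xi1.
have [z1 /andP[w1 w2] zx] := ray_W x1 t01; have /andP[t0 t1] := t01.
set z := (1 - t) *: x in MT z1 w1 w2 zx.
have [|c sc Ec] := bp (v 0); first by left; exists v.
have q1 : enorm (g xi) = 1 by rewrite (conf_eq1 (kg_conf kg Gg)).
have J0 := jac_gt0 (kg_conf kg Gg) xi1'.
set J := jac g xi in J0.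
have Gy := kg_comp kg Gg sc.1; set y := (g \o c) 0.
have y1 : enorm y < 1 := kg_lt1 kg Gy.
have Wy : 0 < W y := kg_Wgt0 kg Gy.
have c0xi := neq_in_out (kg_lt1 kg sc.1) xi1.
have v0xi := neq_in_out (kg_lt1 kg Gv) xi1.
have zero_in := @enorm0_le1 R m.
have Ty : T (g xi) y = 1 / J.
  rewrite (conf_T (kg_conf kg Gg)) ?(kg_le1 kg sc.1) // -/J.
  rewrite (stab_T kg xi1 sc) ?T0 ?(stab_jac kg xi1 (cu_ncon cu Pxi) sc) ?divr1 //.
  exact: (neq_in_out enorm0_lt1).
have Ey : E (g xi) y 0 <= A / J.
  rewrite -[0 in X in X <= _](gv 0) // (conf_E (kg_conf kg Gg)) ?(kg_le1 kg sc.1) //.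
    by rewrite -/J ler_pM2r ?invr_gt0.
  exact: (kg_le1 kg Gv).
have Tz : M / J <= T (g xi) z.
  rewrite -[z](gv z) ?(ltW z1) // (conf_T (kg_conf kg Gg)) //.
  - by rewrite -/J ler_pM2r ?invr_gt0.
  - exact: (conf_le1 (kg_conf kg Gv) (ltW z1)).
  exact: (neq_in_out (conf_lt1 (kg_conf kg Gv) z1) xi1).
have yq := neq_in_out y1 q1; have zq := neq_in_out z1 q1.
rewrite -enorm_sub_gt0 in yq; rewrite -enorm_sub_gt0 in zq.
have zqt : t <= enorm (z - g xi).
  have := enorm_subl (g xi) z; rewrite q1 (enormC (g xi)).
  have -> : enorm z = 1 - t by rewrite /z enormZ x1 mulr1 ger0_norm //; lra.
  lra.
have xq : enorm (x - g xi) <= 2 * enorm (z - g xi).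
  by have := enorm_tri x z (g xi); rewrite (enormC x z) zx; lra.
have xJ : enorm (x - g xi) <= 4 * J / M.
  rewrite ler_pdivlMr //.
  move: Tz; rewrite /T ler_pdivlMr ?exprn_gt0 // => h.
  have h2 : M / J * enorm (z - g xi) <= 2.
    rewrite -(ler_pM2r zq).
    have -> : M / J * enorm (z - g xi) * enorm (z - g xi) =
      M / J * enorm (z - g xi) ^+ 2 by rewrite expr2 mulrA.
    apply: (le_trans h).
    by apply: (le_trans w2); rewrite ler_pM2l.
  have h3 : M * enorm (z - g xi) <= 2 * J.
    by move: h2; rewrite mulrAC ler_pdivrMr.
  have : enorm (x - g xi) * M <= 2 * enorm (z - g xi) * M by rewrite ler_pM2r.
  lra.
(* [J] is the size of the horoball at [g xi]; by [cusp_bounded] the stabilizer of [xi]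
   provides an orbit point [y] on it which is as close to [0] as possible *)
have JW : J <= (4 * A ^+ 2 + 8) * W y.
  have h1 : enorm (y - g xi) ^+ 2 = J * W y.
    move: Ty => /(congr1 (fun u => u * enorm (y - g xi) ^+ 2 * J)).
    rewrite /T divfK ?expf_neq0 ?(lt0r_neq0 yq) // mulrAC divfK ?(lt0r_neq0 J0) //.
    by rewrite mul1r mulrC => ->.
  have h2 : J * enorm y <= A * enorm (y - g xi).
    move: Ey; rewrite /E subr0 sub0r enormN q1 mulr1 ler_pdivrMr // => h.
    rewrite mulrC -ler_pdivlMr //; apply: (le_trans h).
    by rewrite mulrAC.
  have [yl|yl] := leP (enorm y) (1 / 2).
    have h3 : 3 / 4 <= W y by rewrite /W; have := enorm_ge0 y; nra.
    have h4 : enorm (y - g xi) <= 2.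
      by have := enormD y (- g xi); rewrite enormN q1; lra.
    have h5 : J * W y <= 4.
      rewrite -h1; have -> : (4 : R) = 2 ^+ 2 by ring.
      by rewrite ler_pXn2r ?nnegrE ?enorm_ge0.
    have := sqr_ge0 A; nra.
  have h3 : J / 2 <= A * enorm (y - g xi) by nra.
  have h4 : (J / 2) ^+ 2 <= (A * enorm (y - g xi)) ^+ 2.
    rewrite ler_pXn2r ?nnegrE //; first by lra.
    by rewrite mulr_ge0 ?enorm_ge0 // ltW.
  rewrite [(A * _) ^+ 2]exprMn h1 in h4.
  have h5 : J * J <= J * (4 * A ^+ 2 * W y) by nra.
  rewrite ler_pM2l // in h5; lra.
have Gf := kg_comp kg Gy Gg0.
exists ((g \o c) \o g0) => //=.
have -> : g (c (g0 p)) = g xi by rewrite -xiE sc.2.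
apply: (le_trans xJ).
have Wf : W (g0 0) / 4 * W y <= W (g (c (g0 0))).
  have := conf_W (kg_conf kg Gy) (kg_le1 kg Gg0); rewrite /= => ->.
  have := jac_ge_W kg Gy (kg_le1 kg Gg0); rewrite -/y => h.
  have -> : W (g0 0) / 4 * W y = W y / 4 * W (g0 0) by ring.
  by rewrite ler_pM2r.
have w40 : 0 < W (g0 0) / 4 by rewrite divr_gt0.
have -> : 4 * (4 * A ^+ 2 + 8) / (W (g0 0) / 4) / M * W (g (c (g0 0))) =
  4 * ((4 * A ^+ 2 + 8) * W (g (c (g0 0))) / (W (g0 0) / 4)) / M.
  by field; rewrite !gt_eqF.
rewrite ler_pM2r ?invr_gt0 // ler_pM2l //; apply: (le_trans JW).
have A8 : 0 < 4 * A ^+ 2 + 8 by lra.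
by rewrite -mulrA ler_pM2l // ler_pdivlMr // mulrC.
Qed.

End BadBounded.

Section BadBounded.
Context {R : realType} {m : nat}.
Notation V := 'rV[R]_m.
Implicit Types (x y z p a b q s : V) (f g h c : V -> V).
Variables (Gam : set (V -> V)) (Par : set V).
Variables (kg : kgroup Gam) (cu : cusped Gam Par).

(** Suppose that the ray ending at [x] has points farther and farther from the orbit.
    Bring the orbit point nearest to each of them to [0]; the transported points [z i] go
    to the sphere and cluster at some [xi]. As [0] is nearest, [xi] is not conical; it is a
    limit point because the transported rays have both ends in the closure of the orbit. So
    [xi] is parabolic. As [0] is still nearest among the translates by the stabilizer of
    [xi], [cusp_bounded] forces [z i] to be high above [xi]: the ray makes arbitrarily
    deep excursions into cusps, and [deep_approx] contradicts bad approximability. *)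
Lemma bad_bounded (P : set V) x : P `<=` Par ->
  (forall q, Par q -> exists g p, [/\ Gam g, P p & q = g p]) ->
  limpt Gam x -> (forall p, P p -> bad_at Gam p x) -> bounded_ray Gam x.
Proof.
move=> PPar Prep Lx bad; apply: contrapT => /forallNP nb.
have x1 : enorm x = 1 by case: Lx.
have x1' : enorm x <= 1 by rewrite x1.
(* the parameter of the ray, the element bringing [0] to the nearest orbit point, and
   its inverse *)
have sel (i : nat) : exists s : R * (V -> V) * (V -> V),
    [/\ [/\ 0 < s.1.1 <= 1, Gam s.1.2, Gam s.2,
      forall y, enorm y <= 1 -> s.2 (s.1.2 y) = y &
      forall y, enorm y <= 1 -> s.1.2 (s.2 y) = y],
     i%:R <= qd (s.2 ((1 - s.1.1) *: x)) 0 &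
     forall f, Gam f -> qd (s.2 ((1 - s.1.1) *: x)) 0 <= 2 * qd (s.2 ((1 - s.1.1) *: x)) (f 0)].
  have /existsNP[t /not_implyP[t01 far]] := nb i.+1%:R.
  have far' f : Gam f -> i.+1%:R <= qd ((1 - t) *: x) (f 0).
    move=> Gf; rewrite leNgt; apply/negP => hf; apply: far; exists f => //.
    exact: ltW.
  have [z1 _ _] := ray_W x1 t01.
  have [|g Gg near] := near_nearest kg z1; first by exists i.+1%:R.
  have [v [Gv vg gv _ _]] := kg_invP kg Gg.
  have vz1 := conf_lt1 (kg_conf kg Gv) z1.
  have zero_in := @enorm0_le1 R m.
  have qE f : Gam f -> qd (v ((1 - t) *: x)) (f 0) = qd ((1 - t) *: x) (g (f 0)).
    move=> Gf; rewrite -(conf_qd (kg_conf kg Gg)) ?gv ?(ltW z1) //.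
    exact: (kg_lt1 kg Gf).
  exists (t, g, v); split => //=.
  - rewrite (qE id (kg_id kg)); apply: (le_trans _ (far' _ Gg)).
    by rewrite ler_nat.
  - move=> f Gf; rewrite (qE id (kg_id kg)) qE //=.
    exact: near (kg_comp kg Gg Gf).
have [F FP] := choice sel.
pose t i := (F i).1.1; pose g i := (F i).1.2; pose v i := (F i).2.
pose z i := v i ((1 - t i) *: x).
have t01 i : 0 < t i <= 1 by have [[]] := FP i.
have Gg i : Gam (g i) by have [[]] := FP i.
have Gv i : Gam (v i) by have [[]] := FP i.
have vg i : forall y, enorm y <= 1 -> v i (g i y) = y by have [[]] := FP i.
have gv i : forall y, enorm y <= 1 -> g i (v i y) = y by have [[]] := FP i.
have qi i : i%:R <= qd (z i) 0 by have [] := FP i.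
have dir i : forall f, Gam f -> qd (z i) 0 <= 2 * qd (z i) (f 0) by have [] := FP i.
have z1 i : enorm (z i) < 1.
  by have [h _ _] := ray_W x1 (t01 i); exact: (conf_lt1 (kg_conf kg (Gv i)) h).
have Wz0 i : 0 < W (z i) by rewrite W_gt0.
have Wz i : W (z i) <= i.+1%:R^-1.
  rewrite -[W _]invrK lef_pV2 ?posrE ?invr_gt0 ?ltr0n // -qd0 // -natr1.
  by have := qi i; lra.
have vx i : enorm (v i x) = 1 by rewrite (conf_eq1 (kg_conf kg (Gv i))).
have v0 i := kg_lt1 kg (Gv i).
have avx i : v i 0 != v i x by apply: neq_in_out.
have kz i : kap (z i) (v i 0) (v i x) <= 1.
  have [h _ _] := ray_W x1 (t01 i).
  rewrite (conf_kap (kg_conf kg (Gv i))) ?enorm0 //; first exact: ray_kap.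
  by rewrite eq_sym -enorm_gt0 x1.
have [xi xi1' cxi] : exists2 x, enorm x <= 1 & forall e N, 0 < e ->
    exists2 i, (N <= i)%N & enorm (z i - x) < e.
  by apply: cluster_point => i; exact: ltW.
have small e : 0 < e -> exists N, forall i, (N <= i)%N -> W (z i) < e.
  move=> e0; exists (Num.truncn e^-1) => i Ni; apply: (le_lt_trans (Wz i)).
  rewrite -[e]invrK ltf_pV2 ?posrE ?invr_gt0 ?ltr0n //.
  apply: (lt_le_trans (truncnS_gt _)); by rewrite ler_nat.
have pick e : 0 < e -> exists i, W (z i) < e /\ enorm (z i - xi) < e.
  move=> e0; have [N hN] := small e e0; have [i Ni hi] := cxi e N e0.
  by exists i; split => //; exact: hN.
have big i e : W (z i) < e -> 0 < e -> 1 - e < enorm (z i).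
  by rewrite /W => h e0; have := enorm_ge0 (z i); have := z1 i; nra.
have xi1 : enorm xi = 1.
  apply/eqP; rewrite eq_le xi1' /=; apply/ler_addgt0Pr => e e0.
  have [i [hi1 hi2]] := pick (e / 2) (divr_gt0 e0 (ltr0Sn _ 1)).
  have := big _ _ hi1 (divr_gt0 e0 (ltr0Sn _ 1)); have := enorm_subl (z i) xi; lra.
(* [z i] lies on the geodesic from [v i 0] to [v i x] and is close to the sphere, so it is
   close to one of them *)
have Lxi : limpt Gam xi.
  split => // e e0.
  have [|i [hi1 hi2]] := pick (Num.min (e / 4) ((e / 4) ^+ 2 / 2)).
    by rewrite lt_min !divr_gt0 ?exprn_gt0 ?divr_gt0.
  move: hi1 hi2; rewrite !lt_min => /andP[_ hi1] /andP[hi2 _].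
  have := kz i; rewrite /kap ler_pdivrMr ?mulr_gt0 ?enorm_sub_gt0 // mul1r => h.
  have : enorm (z i - v i 0) * enorm (z i - v i x) < (e / 4) ^+ 2.
    apply: (le_lt_trans h); apply: (@le_lt_trans _ _ (W (z i) * 2)); last by lra.
    rewrite ler_pM2l //; have := enormD (v i 0) (- v i x); rewrite enormN vx.
    by have := v0 i; lra.
  have [h1 _|h1 h2] := ltP (enorm (z i - v i 0)) (e / 4).
    exists (v i) => //; have := enorm_tri (v i 0) (z i) xi.
    by rewrite (enormC (v i 0) (z i)); lra.
  have h3 : enorm (z i - v i x) < e / 4.
    have e40 : 0 < e / 4 by rewrite divr_gt0.
    rewrite ltNge; apply/negP => h3.
    by have := ler_pM (ltW e40) (ltW e40) h1 h3; rewrite -expr2; lra.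
  have [_ /(_ (e / 4))] := lim_inv kg (Gv i) Lx.
  case=> [|f Gf hf]; first by rewrite divr_gt0.
  exists f => //; have := enorm_tri (f 0) (v i x) xi.
  by have := enorm_tri (v i x) (z i) xi; rewrite (enormC (v i x) (z i)); lra.
have Pxi : Par xi.
  have [cx|//] := cu_dich cu Lxi; case: (dirichlet_nonconic kg xi1 _ cx) => h Gh.
  apply/ler_addgt0Pr => e' e'0.
  have [e [e0 e1 ee']] : exists e : R, [/\ 0 < e, e <= 1 & 12 * e <= e'].
    exists (Num.min 1 (e' / 12)); split; rewrite ?ge_min ?lexx //.
      by rewrite lt_min ltr01 divr_gt0.
    have : Num.min 1 (e' / 12) <= e' / 12 by rewrite ge_min lexx orbT.
    lra.
  have [i [hi1 hi2]] := pick e e0.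
  have zb := big _ _ hi1 e0.
  have Wh := kg_Wgt0 kg Gh; have Wh1 := W_le1 (h 0).
  have := dir i h Gh; rewrite /qd subr0 W0 mulr1 mulrA ler_pdivlMr ?mulr_gt0 //.
  have -> : enorm (z i) ^+ 2 / W (z i) * (W (z i) * W (h 0)) =
    enorm (z i) ^+ 2 * W (h 0) by field; rewrite gt_eqF.
  move=> hd.
  have := enorm_tri (z i) xi (h 0).
  have := enormD xi (- h 0); rewrite enormN xi1.
  have := kg_le1 kg Gh; have := enorm_ge0 (xi - h 0); have := enorm_ge0 (z i - h 0).
  move: hd zb Wh Wh1 hi2 (z1 i) ee' e0 e1.
  move: (enorm (z i)) (W (h 0)) (enorm (z i - h 0)) (enorm (xi - h 0)) (enorm (z i - xi))
    (enorm (h 0)) => a w d D r b hd zb w0 w1 hr a1 ee e0 e1 d0 D0 b1 Db dD.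
  have dD' : d <= D + e by lra.
  have h1 : d ^+ 2 <= (D + e) ^+ 2 by rewrite ler_pXn2r ?nnegrE //; lra.
  have h2 : (1 - e) ^+ 2 <= a ^+ 2 by rewrite ler_pXn2r ?nnegrE //; lra.
  have h3 : (1 - e) ^+ 2 * w <= a ^+ 2 * w by rewrite ler_pM2r.
  have h4 : (1 - 2 * e) * w <= (1 - e) ^+ 2 * w by rewrite ler_pM2r //; nra.
  have h5 : e * w <= e by nra.
  have h6 : e * D <= e * 2 by rewrite ler_pM2l //; lra.
  have h7 : e * e <= e by nra.
  nra.
have [A [A0 _ bp]] := cusp_bounded kg cu Pxi.
have zxi i := neq_in_out (z1 i) xi1.
(* in the half space at [xi], [z i] is far from [0] but above one end of the transported
   ray, and some stabilizer translate [c 0] is near that end *)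
have deep M : 0 < M -> exists i, M <= T xi (z i).
  move=> M0; pose e := (2 * (4 * M + 2 * A + 1))^-1.
  have MA : 0 < 4 * M + 2 * A + 1 by lra.
  have e0 : 0 < e by rewrite invr_gt0; lra.
  have eMA : e * (4 * M + 2 * A + 1) = 1 / 2 by rewrite /e; field; rewrite gt_eqF.
  have e2 : e < 1 / 2.
    by rewrite -eMA -[X in X < _]mulr1 ltr_pM2l //; lra.
  clearbody e.
  have [i [hi1 hi2]] := pick e e0; exists i.
  have zb := big _ _ hi1 e0.
  have E0 : 4 * M + 2 * A <= E xi (z i) 0.
    rewrite /E subr0 sub0r enormN xi1 mulr1 ler_pdivlMr ?enorm_sub_gt0 //.
    apply: (@le_trans _ _ ((4 * M + 2 * A + 1) * e)); last by rewrite mulrC eMA; lra.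
    apply: ler_pM; rewrite ?enorm_ge0 //; last exact: ltW.
      by lra.
    by rewrite lerDl.
  have a0 := neq_in_out (v0 i) xi1.
  have b0 : v i x != xi.
    apply/eqP => e'; have := bad_not_par kg Prep bad (Gg i) Pxi.
    by rewrite -e' gv // eqxx.
  have [c sc Ec] : exists2 c, stab Gam xi c & E xi (z i) (c 0) <= 2 * T xi (z i) + A.
    have [h|h] := geodesic_foot (zxi i) a0 b0 (z1 i) (avx i) (kz i).
      have [|c sc Ec] := bp (v i 0); first by left; exists (v i).
      exists c => //; have cxi0 := neq_in_out (kg_lt1 kg sc.1) xi1.
      by apply: (le_trans (E_tri (zxi i) a0 cxi0)); rewrite lerD // EC.
    have [|c sc Ec] := bp (v i x); first by right; split => //; exact: lim_inv.
    exists c => //; have cxi0 := neq_in_out (kg_lt1 kg sc.1) xi1.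
    by apply: (le_trans (E_tri (zxi i) b0 cxi0)); rewrite lerD // EC.
  have cxi0 := neq_in_out (kg_lt1 kg sc.1) xi1.
  have zero_xi : (0 : V) != xi by apply: neq_in_out xi1; rewrite enorm0.
  have zero_in := @enorm0_lt1 R m.
  have q1 := qd_E (zxi i) zero_xi (z1 i) zero_in.
  have q2 := qd_E (zxi i) cxi0 (z1 i) (kg_lt1 kg sc.1).
  have Tc : T xi (c 0) = 1.
    rewrite (stab_T kg xi1 sc) ?enorm0 // T0 //.
    by rewrite (stab_jac kg xi1 (cu_ncon cu Pxi) sc) divr1.
  rewrite T0 // mulr1 in q1; rewrite Tc mulr1 in q2.
  have Tz : 0 <= T xi (z i) := T_ge0 _ (ltW (z1 i)).
  have : E xi (z i) 0 ^+ 2 <= 2 * E xi (z i) (c 0) ^+ 2.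
    by rewrite q1 q2 mulrA ler_wpM2r //; exact: dir sc.1.
  have := E_ge0 xi (z i) 0; have := E_ge0 xi (z i) (c 0).
  move: E0 Ec Tz; move: (E xi (z i) 0) (E xi (z i) (c 0)) (T xi (z i)) => u w s E0 Ec s0 w0 u0 uw.
  have h1 : u <= 2 * w.
    rewrite leNgt; apply/negP => wu.
    have : (2 * w) ^+ 2 < u ^+ 2 by rewrite ltr_pXn2r ?nnegrE // mulr_ge0.
    by have := sqr_ge0 w; nra.
  lra.
have [p [K [Pp K0 approx]]] := deep_approx kg cu Prep Lx Pxi.
have [k k0 bk] := bad p Pp.
have M0 : 0 < K / k by rewrite divr_gt0.
have [i Mi] := deep _ M0.
have [f Gf hf] := approx _ _ _ _ M0 (t01 i) (Gg i) (Gv i) (vg i) (gv i) Mi.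
have := bk f Gf; rewrite ltNge; apply/negP; rewrite negbK.
apply: (le_trans hf).
by have -> : K / (K / k) = k by field; rewrite !gt_eqF.
Qed.

End BadBounded.

(** * Concentration of the Poincare series *)

(* This import rebinds [inE], used above in its original sense. *)
From mathcomp Require Import finmap.

Section Light.
Context {R : realType} {T : choiceType}.
Variable w : T -> R.
Hypothesis w0 : forall x, 0 <= w x.
Implicit Types (A B : set T) (F : {fset T}).

(** Summability free of any enumeration; the Poincare series at exponent [s] converges
    exactly when the group is light for the weights [W (f 0) ^ s]. *)
Definition light A := exists M, forall F, [set` F] `<=` A -> \sum_(x <- F) w x <= M.

Lemma light_sub A B : A `<=` B -> light B -> light A.
Proof. by move=> AB [M HM]; exists M => F FA; apply: HM; exact: subset_trans AB. Qed.

Lemma sum_fsetID F (P : pred T) : \sum_(x <- F) w x =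
  \sum_(x <- [fset x in F | P x]%fset) w x + \sum_(x <- [fset x in F | ~~ P x]%fset) w x.
Proof. by rewrite (big_fsetID _ P). Qed.

Lemma light_setU A B : light A -> light B -> light (A `|` B).
Proof.
move=> [M HM] [M' HM']; exists (M + M') => F FAB.
rewrite (sum_fsetID F (fun x => x \in A)); apply: lerD.
  by apply: HM => x /=; rewrite !inE /= => /andP[_ /set_mem].
apply: HM' => x /=; rewrite !inE /= => /andP[xF /negP nA].
by case: (FAB x) => // Ax; case: nA; exact: mem_set.
Qed.

Lemma sum_fset_le F F' : (F `<=` F')%fset -> \sum_(x <- F) w x <= \sum_(x <- F') w x.
Proof.
move=> /fsubsetP FF'; rewrite (sum_fsetID F' (fun x => x \in F)) -[X in X <= _]addr0.
apply: lerD; last by apply: sumr_ge0.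
have -> // : [fset x in F' | x \in F]%fset = F.
by apply/fsetP => x; rewrite !inE /= andb_idl //; exact: FF'.
Qed.

Lemma light_finite A : finite_set A -> light A.
Proof.
move=> /finite_fsetP[F' ->]; exists (\sum_(x <- F') w x) => F FF'.
by apply: sum_fset_le; apply/fsubsetP => x xF; exact: FF'.
Qed.

(** To be used with [kp f] the scale of the orbit point [f 0]: the total is bounded by a
    geometric series. *)
Lemma light_cells A (kp : T -> nat) (b q : R) : 0 <= b -> 0 <= q < 1 ->
  (forall k F, [set` F] `<=` [set x | A x /\ kp x = k] -> \sum_(x <- F) w x <= b * q ^+ k) ->
  light A.
Proof.
move=> b0 /andP[q0 q1] H; exists (b / (1 - q)) => F FA.
have q10 : 0 < 1 - q by lra.
pose N := (\max_(x <- F) kp x).+1.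
have kN x : x \in F -> (kp x < N)%N.
  by move=> xF; rewrite ltnS; exact: (leq_bigmax_seq (P := xpredT) _ xF).
have -> : \sum_(x <- F) w x =
    \sum_(k < N) \sum_(x <- [fset x in F | kp x == k]%fset) w x.
  transitivity (\sum_(x <- F) \sum_(k < N) (if kp x == k then w x else 0)).
    rewrite big_seq [RHS]big_seq; apply: eq_bigr => x xF.
    rewrite (bigD1 (Ordinal (kN x xF))) //= eqxx big1 ?addr0 // => k.
    by rewrite -val_eqE /= eq_sym => /negbTE ->.
  rewrite exchange_big /=; apply: eq_bigr => k _.
  by rewrite -big_mkcond /= big_fset.
apply: (@le_trans _ _ (\sum_(k < N) b * q ^+ k)).
  apply: ler_sum => k _; apply: H => x /=; rewrite !inE /= => /andP[xF /eqP ->].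
  by split => //; exact: FA.
rewrite -mulr_sumr; apply: ler_wpM2l => //.
rewrite -[X in _ <= X]mul1r ler_pdivlMr //.
have -> : (\sum_(i < N) q ^+ i) * (1 - q) = 1 - q ^+ N.
  by rewrite -[1 in RHS](expr1n _ N) subrXX mulrC; congr (_ * _);
     apply: eq_bigr => i _; rewrite expr1n mul1r.
by rewrite gerBl exprn_ge0.
Qed.

End Light.

Section Net.
Context {R : realType} {m : nat}.
Notation V := 'rV[R]_m.

Lemma ball_net e : 0 < e -> exists s : seq V,
  forall x, enorm x <= 1 -> exists2 c, c \in s & enorm (x - c) < e.
Proof.
move=> e0; apply: contrapT => /forallNP H.
have next (s : seq V) : {x | enorm x <= 1 /\ forall c, c \in s -> e <= enorm (x - c)}.
  apply: cid; have /existsNP[x /not_implyP[x1 far]] := H s.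
  exists x; split => // c cs; rewrite leNgt; apply/negP => xc; apply: far; by exists c.
pose S := fix S n := if n is n'.+1 then rcons (S n') (sval (next (S n'))) else [::].
pose u n := sval (next (S n)).
have uS i j : (i < j)%N -> u i \in S j.
  elim: j => // j IH; rewrite ltnS leq_eqVlt /= mem_rcons inE => /orP[/eqP ->|/IH ->].
    by rewrite eqxx.
  by rewrite orbT.
have [|x _ cx] := @cluster_point _ _ u; first by move=> i; case: (svalP (next (S i))).
have [i _ ie] := cx (e / 2) 0%N (divr_gt0 e0 (ltr0Sn _ 1)).
have [j ij je] := cx (e / 2) i.+1 (divr_gt0 e0 (ltr0Sn _ 1)).
have [_ /(_ (u i) (uS i j ij))] := svalP (next (S j)).
have := enorm_tri (u j) x (u i); rewrite (enormC x) -/(u j); lra.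
Qed.

Variables (T : choiceType) (w : T -> R).
Hypothesis w0 : forall x, 0 <= w x.

Lemma light_net A (s : seq V) (D : V -> set T) :
  (forall c, c \in s -> light w (A `&` D c)) ->
  A `<=` [set f | exists2 c, c \in s & D c f] -> light w A.
Proof.
elim: s A => [|c s IH] A sl AD.
  by apply: (light_sub (B := set0)); [move=> f /AD[]|exact: (light_finite w0 (finite_set0 _))].
apply: (light_sub (B := (A `&` D c) `|` (A `&` ~` D c))).
  by move=> f Af; have [?|?] := pselect (D c f); [left|right].
apply: (light_setU) => //; first by apply: sl; rewrite mem_head.
apply: IH => [c' c's|f [Af nD]].
  apply: light_sub (sl c' _); last by rewrite inE c's orbT.
  by move=> f [[]].
have [c'] := AD f Af; rewrite inE => /orP[/eqP -> //|c's Df]; by exists c'.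
Qed.

(** By compactness: finitely many small balls cover the closed ball, and one of them
    must carry a heavy part. *)
Lemma heavy_point A (phi : T -> V) : ~ light w A -> (forall f, A f -> enorm (phi f) <= 1) ->
  exists2 x, enorm x <= 1 & forall r, 0 < r ->
    ~ light w (A `&` [set f | enorm (phi f - x) < r]).
Proof.
move=> hA phi1.
have piece n : {c | enorm c <= 2 /\ ~ light w (A `&` [set f | enorm (phi f - c) < n.+1%:R^-1])}.
  apply: cid; have n0 : 0 < (n.+1%:R : R)^-1 by rewrite invr_gt0.
  have [s hs] := ball_net n0; apply: contrapT => H; apply: hA.
  apply: (@light_net A [seq c <- s | enorm c <= 2]
    (fun c => [set f | enorm (phi f - c) < n.+1%:R^-1])).
    move=> c; rewrite mem_filter => /andP[c2 _].
    by apply: contrapT => nl; apply: H; exists c.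
  move=> f Af /=; have [c cs fc] := hs _ (phi1 f Af); exists c => //.
  rewrite mem_filter cs andbT.
  have := enorm_subl c (phi f); rewrite enormC; have := phi1 f Af.
  have : (n.+1%:R : R)^-1 <= 1 by rewrite invf_le1 ?ltr0n // ler1n.
  by move: fc; move: (n.+1%:R^-1) => *; lra.
(* the centres lie in the ball of radius 2 *)
pose u n := 2^-1 *: sval (piece n).
have [|x x1 cx] := @cluster_point _ _ u.
  move=> n; rewrite /u enormZ ger0_norm //; have [h _] := svalP (piece n); lra.
have acc r : 0 < r -> ~ light w (A `&` [set f | enorm (phi f - 2 *: x) < r]).
  move=> r0; have r4 : 0 < r / 4 by rewrite divr_gt0.
  have [n Nn hn] := cx _ (Num.truncn (2 / r)) r4.
  have [_ nl] := svalP (piece n); move=> l; apply: nl; apply: light_sub l.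
  move=> f [Af /= fc]; split => //=.
  have := enorm_tri (phi f) (sval (piece n)) (2 *: x).
  have -> : sval (piece n) - 2 *: x = 2 *: (u n - x).
    by rewrite /u scalerBr scalerA mulfV // scale1r.
  rewrite enormZ ger0_norm //.
  have nr : (n.+1%:R : R)^-1 < r / 2.
    rewrite -[r / 2]invrK ltf_pV2 ?posrE ?invr_gt0 ?divr_gt0 // invf_div.
    by apply: (lt_le_trans (truncnS_gt _)); rewrite ler_nat.
  have := lt_trans fc nr; lra.
exists (2 *: x) => //.
apply: contrapT => /negP; rewrite -ltNge => x2.
have r0 : 0 < enorm (2 *: x) - 1 by lra.
apply: (acc _ r0); apply: (light_sub (B := set0)); last exact: (light_finite w0 (finite_set0 _)).
move=> f [Af /= fc]; have := enorm_subl (2 *: x) (phi f); rewrite enormC.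
by have := phi1 f Af; lra.
Qed.

End Net.

Section Heavy.
Context {R : realType} {m : nat}.
Notation V := 'rV[R]_m.
Implicit Types (x y z p a b q : V) (f g h c d u v : V -> V).
Variables (Gam : set (V -> V)) (kg : kgroup Gam).

Definition wt (s : R) f : R := W (f 0) `^ s.

Lemma wt_ge0 s f : 0 <= wt s f. Proof. exact: powR_ge0. Qed.

Lemma inverse_exists : exists iv : (V -> V) -> V -> V, forall f, Gam f ->
  [/\ Gam (iv f), forall x, enorm x <= 1 -> iv f (f x) = x,
    forall x, enorm x <= 1 -> f (iv f x) = x & W (iv f 0) = W (f 0)].
Proof.
have : forall f, exists h, Gam f ->
  [/\ Gam h, forall x, enorm x <= 1 -> h (f x) = x,
    forall x, enorm x <= 1 -> f (h x) = x & W (h 0) = W (f 0)].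
  move=> f; have [Gf|nGf] := pselect (Gam f); last by exists id.
  by have [h [? ? ? _ ?]] := kg_invP kg Gf; exists h.
by move=> /choice[iv H]; exists iv.
Qed.

Variable iv : (V -> V) -> V -> V.
Hypothesis ivP : forall f, Gam f ->
  [/\ Gam (iv f), forall x, enorm x <= 1 -> iv f (f x) = x,
    forall x, enorm x <= 1 -> f (iv f x) = x & W (iv f 0) = W (f 0)].

Lemma iv_comp0 f h : Gam f -> Gam h -> iv (h \o f) 0 = iv f (iv h 0).
Proof.
move=> Gf Gh; have Ghf := kg_comp kg Gh Gf.
have [Gi _ hi _] := ivP Ghf; have [Gif _ fi _] := ivP Gf; have [Gih _ hih _] := ivP Gh.
have c1 := kg_le1 kg (kg_comp kg Gif Gih).
apply: (conf_inj (kg_conf kg Ghf) (kg_le1 kg Gi) c1).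
by rewrite (hi 0 enorm0_le1) /= fi ?hih ?enorm0_le1 // (kg_le1 kg Gih).
Qed.

Lemma comp_injl h f g : Gam h -> Gam f -> Gam g -> h \o f = h \o g -> f = g.
Proof.
move=> Gh Gf Gg hfg; apply: (kg_ext kg Gf Gg) => x x1.
apply: (conf_inj (kg_conf kg Gh)).
- exact: (conf_le1 (kg_conf kg Gf)).
- exact: (conf_le1 (kg_conf kg Gg)).
by have /(congr1 (fun k : V -> V => k x)) := hfg.
Qed.

Lemma wt_comp s h f : 0 < s -> Gam h -> Gam f ->
  (W (h 0) / 4) `^ s * wt s f <= wt s (h \o f).
Proof.
move=> s0 Gh Gf; have Wf := ltW (kg_Wgt0 kg Gf); have Wh := ltW (kg_Wgt0 kg Gh).
have Wh4 : 0 <= W (h 0) / 4 by rewrite divr_ge0.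
rewrite /wt -powRM //; apply: ge0_ler_powR; rewrite ?nnegrE ?mulr_ge0 //.
- exact: ltW.
- exact: ltW (kg_Wgt0 kg (kg_comp kg Gh Gf)).
rewrite /= (conf_W (kg_conf kg Gh) (kg_le1 kg Gf)).
apply: ler_wpM2r => //; have [Gih _ hih Wih] := ivP Gh.
rewrite -Wih; apply: (jac_ge (kg_conf kg Gh) (kg_lt1 kg Gih)).
  by rewrite hih ?enorm0_le1.
exact: (kg_le1 kg Gf).
Qed.

(** Left translation by [h] multiplies weights by at least a constant, hence preserves
    heaviness. *)
Lemma light_comp s h A B : 0 < s -> Gam h -> A `<=` Gam ->
  (forall f, A f -> B (h \o f)) -> light (wt s) B -> light (wt s) A.
Proof.
move=> s0 Gh AG AB [M HM].
have c0 : 0 < (W (h 0) / 4) `^ s by rewrite powR_gt0 // divr_gt0 // (kg_Wgt0 kg).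
exists (M / (W (h 0) / 4) `^ s) => F FA; rewrite ler_pdivlMr //.
apply: (@le_trans _ _ (\sum_(f <- [fset h \o f | f in F]%fset) wt s f)); last first.
  apply: HM => f /= /imfsetP[g /= gF ->]; apply: AB; exact: FA.
rewrite big_imfset /=; last first.
  move=> f g fF gF; apply: comp_injl => //; apply: AG; exact: FA.
rewrite mulr_suml big_seq [X in _ <= X]big_seq; apply: ler_sum => f fF.
by rewrite mulrC wt_comp //; apply: AG; exact: FA.
Qed.

(** Heavy orbits concentrate, together with their inverses, near two points that can
    be taken distinct: this replaces the choice of a hyperbolic element. *)
Lemma heavy_pair s : 0 < s -> infinite_set (limpt Gam) -> ~ light (wt s) Gam ->
  exists X Y, [/\ enorm X <= 1, enorm Y <= 1, X != Y & forall r, 0 < r ->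
    ~ light (wt s) (Gam `&` [set f | enorm (f 0 - X) < r /\ enorm (iv f 0 - Y) < r])].
Proof.
move=> s0 inf hG.
have [x x1 hx] := heavy_point (wt_ge0 s) hG (phi := fun f => f 0) (fun f Gf => kg_le1 kg Gf).
have finW r : 0 < r -> light (wt s) (Gam `&` [set f | r <= W (f 0)]).
  by move=> r0; apply: (light_finite (wt_ge0 s)); exact: (kg_fin kg r0).
(* only finitely many orbit points lie away from the sphere *)
have {}x1 : enorm x = 1.
  apply/eqP; rewrite eq_le x1 /= leNgt; apply/negP => lt1.
  have r0 : 0 < (1 - enorm x) / 2 by lra.
  apply: (hx _ r0); apply: light_sub (finW _ r0) => f [Gf /= fx]; split => //=.
  have := enorm_subl (f 0) x; have := enorm_ge0 x; have := enorm_ge0 (f 0).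
  by rewrite /W; nra.
have [y y1 hy] : exists2 y, enorm y <= 1 & forall r, 0 < r ->
    ~ light (wt s) (Gam `&` [set f | enorm (f 0 - x) < r /\ enorm (iv f 0 - y) < r]).
  have ex n : {y | enorm y <= 1 /\ forall r, 0 < r -> ~ light (wt s)
      ((Gam `&` [set f | enorm (f 0 - x) < n.+1%:R^-1]) `&` [set f | enorm (iv f 0 - y) < r])}.
    apply: cid; have n0 : 0 < (n.+1%:R : R)^-1 by rewrite invr_gt0.
    have [|y y1 hy] := heavy_point (wt_ge0 s) (hx _ n0) (phi := fun f => iv f 0).
      by move=> f [Gf _]; have [Gi _ _ _] := ivP Gf; exact: (kg_le1 kg).
    by exists y.
  have [|y y1 cy] := @cluster_point _ _ (fun n => sval (ex n)).
    by move=> n; case: (svalP (ex n)).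
  exists y => // r r0; have r2 : 0 < r / 2 by rewrite divr_gt0.
  have [n Nn hn] := cy _ (Num.truncn r^-1) r2.
  have [_ /(_ _ r2)] := svalP (ex n); apply: contra_not; apply: light_sub.
  move=> f [[Gf /= fx] /= fy]; split => //=; split.
    apply: (lt_trans fx); rewrite -[r]invrK ltf_pV2 ?posrE ?invr_gt0 ?ltr0n //.
    by apply: (lt_le_trans (truncnS_gt _)); rewrite ler_nat.
  have := enorm_tri (iv f 0) (sval (ex n)) y; lra.
have x1' : enorm x <= 1 by rewrite x1.
(* when the two points coincide, some element moves [x], and left translation by it moves
   the orbit points but hardly changes the inverses *)
have [h Gh hxy] : exists2 h, Gam h & h x != y.
  have [xy|xy] := eqVneq x y; last by exists id => //; exact: (kg_id kg).
  by rewrite -xy; exact: (no_global_fix kg inf x1).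
exists (h x), y; split => //; first exact: (conf_le1 (kg_conf kg Gh)).
move=> r r0 l.
have [K K0 lK] := kg_lip kg Gh.
have [Gih _ hih Wih] := ivP Gh.
have ih1 := kg_lt1 kg Gih; have Wi := kg_Wgt0 kg Gih.
have e0 : 0 < Num.min (r / K) (r / 2) by rewrite lt_min !divr_gt0.
apply: (hy _ e0).
have t0 : 0 < W (iv h 0) * (r / 2) ^+ 2 by rewrite mulr_gt0 // exprn_gt0 // divr_gt0.
apply: (light_sub (B := (Gam `&` [set f | W (iv h 0) * (r / 2) ^+ 2 <= W (f 0)]) `|`
  (Gam `&` [set f | [/\ enorm (f 0 - x) < Num.min (r / K) (r / 2),
    enorm (iv f 0 - y) < Num.min (r / K) (r / 2) & W (f 0) < W (iv h 0) * (r / 2) ^+ 2]]))).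
  move=> f [Gf /= [fx fy]].
  by have [hW|hW] := leP (W (iv h 0) * (r / 2) ^+ 2) (W (f 0)); [left|right].
apply: light_setU; first exact: finW.
apply: (light_comp s0 Gh _ _ l); first by move=> f [].
move=> f [Gf /=]; rewrite !lt_min => -[/andP[fx _] /andP[_ fy] fW].
split; first exact: (kg_comp kg).
split => /=.
  apply: le_lt_trans (lK _ _ (kg_le1 kg Gf) x1') _.
  by rewrite mulrC -ltr_pdivlMr.
rewrite iv_comp0 //; have [Gif _ _ Wif] := ivP Gf.
have cif := kg_conf kg Gif.
have h1 : enorm (iv f (iv h 0) - iv f 0) < r / 2.
  rewrite -(@ltr_pXn2r _ 2) ?nnegrE ?enorm_ge0 //; last by rewrite divr_ge0 // ltW.
  rewrite (conf_sqr cif) ?(ltW ih1) ?enorm0_le1 // jac0 Wif subr0.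
  have hb : enorm (iv h 0) ^+ 2 <= 1 by rewrite expr_le1 ?enorm_ge0 // ltW.
  have jb : jac (iv f) (iv h 0) * W (iv h 0) <= 1 by rewrite -(conf_W cif) ?(ltW ih1) // W_le1.
  have j0 := jac_gt0 cif (ltW ih1); have Wf := kg_Wgt0 kg Gf.
  apply: (@le_lt_trans _ _ (jac (iv f) (iv h 0) * W (f 0))).
    by rewrite -[X in _ <= X]mulr1 ler_wpM2l // mulr_ge0 // ltW.
  apply: (@lt_le_trans _ _ (jac (iv f) (iv h 0) * (W (iv h 0) * (r / 2) ^+ 2))).
    by rewrite ltr_pM2l.
  by rewrite mulrA -[X in _ <= X]mul1r ler_wpM2r // sqr_ge0.
have := enorm_tri (iv f (iv h 0)) (iv f 0) y; lra.
Qed.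

End Heavy.

(** * Separated orbit points at one scale *)

(** Keep one element, discard the at most [N0] close to it, and start again. *)
Lemma greedy {T : choiceType} (cl : rel T) (N0 : nat) (F : {fset T}) :
  reflexive cl -> symmetric cl ->
  (forall x, x \in F -> #|` [fset y in F | cl x y]%fset| <= N0)%N ->
  exists S : {fset T}, [/\ (S `<=` F)%fset,
    forall x y, x \in S -> y \in S -> x != y -> ~~ cl x y & (#|` F| <= N0 * #|` S|)%N].
Proof.
move=> rfl sym; have [k Fk] := ubnP #|` F|; elim: k F Fk => // k IH F Fk hF.
have [->|[x xF]] := fset_0Vmem F.
  by exists fset0%fset; split => //; rewrite ?cardfs0.
pose F' := [fset y in F | ~~ cl x y]%fset.
have F'F : (F' `<=` F)%fset by apply/fsubsetP => y; rewrite !inE /= => /andP[].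
have cF : #|` F| = (#|` [fset y in F | cl x y]%fset| + #|` F'|)%N.
  have <- := cardfsID [fset y in F | cl x y]%fset F.
  have -> : (F `&` [fset y in F | cl x y] = [fset y in F | cl x y])%fset.
    by apply/fsetP => y; rewrite !inE /=; case: (y \in F).
  have -> // : (F `\` [fset y in F | cl x y] = F')%fset.
  by apply/fsetP => y; rewrite !inE /=; case: (y \in F); case: (cl x y).
have [||S [SF sep card]] := IH F'.
- rewrite ltnS in Fk; apply: leq_trans Fk; rewrite cF -[X in (X < _)%N]add0n ltn_add2r cardfs_gt0.
  by apply/fset0Pn; exists x; rewrite !inE /= xF rfl.
- move=> y yF'; apply: leq_trans (hF y (fsubsetP F'F y yF')).
  apply: fsubset_leq_card; apply/fsubsetP => z; rewrite !inE /=.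
  by move=> /andP[/andP[-> _] ->].
have xS y : y \in S -> ~~ cl x y.
  by move=> /(fsubsetP SF); rewrite !inE /= => /andP[].
exists (x |` S)%fset; split.
- apply/fsubsetP => y; rewrite !inE => /orP[/eqP -> //|yS].
  exact: (fsubsetP F'F _ (fsubsetP SF _ yS)).
- move=> y z; rewrite !inE => /orP[/eqP ->|yS] /orP[/eqP ->|zS]; rewrite ?eqxx //.
  + by move=> _; exact: xS.
  + by move=> _; rewrite sym; exact: xS.
  exact: sep.
rewrite cF cardfsU1; have -> : x \notin S.
  by apply/negP => /xS; rewrite rfl.
by rewrite mulnDr muln1 leq_add // hF.
Qed.

Section Select.
Context {R : realType} {m : nat}.
Notation V := 'rV[R]_m.
Implicit Types (x y z p a b q : V) (f g h c d u v : V -> V).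

Variables (Gam : set (V -> V)) (kg : kgroup Gam).
Variable iv : (V -> V) -> V -> V.
Hypothesis ivP : forall f, Gam f ->
  [/\ Gam (iv f), forall x, enorm x <= 1 -> iv f (f x) = x,
    forall x, enorm x <= 1 -> f (iv f x) = x & W (iv f 0) = W (f 0)].

(** Few orbit points of comparable height lie close to a given one, because the
    group moves them all to a fixed compact set. *)
Lemma close_count D : 0 <= D -> exists N0, forall l f (F : {fset V -> V}), 0 < l -> Gam f ->
  l <= W (f 0) ->
  [set` F] `<=` [set g | [/\ Gam g, l <= W (g 0) & enorm (f 0 - g 0) <= D * l]] ->
  (#|` F| <= N0)%N.
Proof.
move=> D0; have D1 : 0 < (1 + D ^+ 2)^-1 by rewrite invr_gt0; have := sqr_ge0 D; lra.
have [Phi PhiE] := (finite_fsetP).1 (kg_fin kg D1).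
exists #|` Phi| => l f F l0 Gf fl FA; have [Gi _ fi _] := ivP Gf.
pose k g := iv f \o g.
have <- : #|` [fset k g | g in F]%fset| = #|` F|.
  rewrite card_in_imfset //= => g g' gF g'F; apply: (comp_injl kg Gi).
    by have [] := FA g gF.
  by have [] := FA g' g'F.
apply: fsubset_leq_card; apply/fsubsetP => _ /imfsetP[g /= gF ->].
have [Gg lg fg] := FA g gF.
have : [set` Phi] (k g); last by [].
rewrite -PhiE; split; first exact: (kg_comp kg).
have Gk := kg_comp kg Gi Gg.
rewrite -[W _]invrK lef_pV2 ?posrE ?invr_gt0 ?(kg_Wgt0 kg Gk) //; last first.
  by have := sqr_ge0 D; lra.
rewrite -qd0 ?(kg_lt1 kg Gk) // lerD2l.
rewrite -(conf_qd (kg_conf kg Gf)) ?enorm0_lt1 ?(kg_lt1 kg Gk) //.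
rewrite /k /= fi ?(kg_le1 kg Gg) // /qd ler_pdivrMr ?mulr_gt0 ?(kg_Wgt0 kg) //.
apply: (@le_trans _ _ ((D * l) ^+ 2)).
  by rewrite enormC ler_pXn2r ?nnegrE ?enorm_ge0 // mulr_ge0 // ltW.
rewrite exprMn ler_wpM2l ?sqr_ge0 // expr2; apply: ler_pM => //; exact: ltW.
Qed.

(** Sort a heavy family by scales [l = 2^-k]. If every separated subfamily of the scale
    [l] had fewer than [K l^-t] elements, the scale [l] would contribute at most a constant
    times [l^(s - t)], and the total would be finite. *)
Lemma select s t (A : set (V -> V)) D K l0 : 0 < t -> t < s -> A `<=` Gam ->
  ~ light (wt s) A -> 0 <= D -> 0 < l0 ->
  exists l (F : {fset V -> V}), [/\ 0 < l < l0, [set` F] `<=` A,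
    forall f, f \in F -> l <= W (f 0) < 2 * l,
    forall f g, f \in F -> g \in F -> f != g -> D * l < enorm (f 0 - g 0) &
    K <= #|` F|%:R * l `^ t].
Proof.
move=> t0 ts AG hA D0 l00; apply: contrapT => H; apply: hA.
have s0 : 0 < s by exact: lt_trans ts.
have h0 : 0 < 1 / 2 :> R by lra.
have [n0 hn0] : exists n0, (1 / 2) ^+ n0 < l0 by apply: exp_small => //; lra.
have [N0 hN0] := close_count D0.
have [kp kpP] : exists kp : (V -> V) -> nat, forall f, Gam f ->
    (1 / 2) ^+ kp f <= W (f 0) < 2 * (1 / 2) ^+ kp f.
  have : forall f, exists k, Gam f -> (1 / 2) ^+ k <= W (f 0) < 2 * (1 / 2) ^+ k.
    move=> f; have [Gf|nGf] := pselect (Gam f); last by exists 0%N.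
    have ex : exists k, (1 / 2) ^+ k <= W (f 0).
      have [|k hk] := @exp_small R (1 / 2) (W (f 0)) _ (kg_Wgt0 kg Gf); first by lra.
      by exists k; exact: ltW.
    case: (ex_minnP ex) => k hk mk; exists k => _; rewrite hk /=.
    case: k hk mk => [|k] hk mk.
      by rewrite expr0; have := W_le1 (f 0); lra.
    have -> : 2 * (1 / 2) ^+ k.+1 = (1 / 2) ^+ k :> R by rewrite exprS; field.
    by rewrite ltNge; apply/negP => /mk; rewrite ltnn.
  by move=> /choice[kp ?]; exists kp.
apply: (light_sub (B := (Gam `&` [set f | (1 / 2) ^+ n0 <= W (f 0)]) `|`
  (A `&` [set f | W (f 0) < (1 / 2) ^+ n0]))).
  move=> f Af; have [h|h] := leP ((1 / 2) ^+ n0) (W (f 0)); last by right.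
  by left; split => //; exact: AG.
apply: light_setU.
  apply: (light_finite (@wt_ge0 _ _ s)); apply: (kg_fin kg); exact: exprn_gt0.
pose q := (1 / 2 : R) `^ (s - t).
have q0 : 0 <= q by exact: powR_ge0.
have q1 : q < 1.
  have <- : 1 `^ (s - t) = 1 :> R by rewrite powR1.
  by apply: gt0_ltr_powR; rewrite ?nnegrE; lra.
have b0 : 0 <= N0%:R * `|K| * 2 `^ s by rewrite !mulr_ge0 ?powR_ge0.
apply: (light_cells (kp := kp) b0 (q := q)); first by rewrite q0 q1.
move=> k F FA.
have [->|[f1 f1F]] := fset_0Vmem F.
  by rewrite big_seq_fset0 mulr_ge0 // exprn_ge0.
pose l := (1 / 2 : R) ^+ k; have lp : 0 < l by exact: exprn_gt0.
have Fl f : f \in F -> l <= W (f 0) < 2 * l.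
  by move=> /FA[[Af _] fk]; rewrite /l -fk; exact: kpP (AG _ Af).
have FG f : f \in F -> Gam f by move=> /FA[[Af _] _]; exact: AG.
have ll0 : l < l0.
  have [[_ /= h] _] := FA f1 f1F; have /andP[h1 _] := Fl _ f1F.
  exact: le_lt_trans h1 (lt_trans h hn0).
pose cl f g := enorm (f 0 - g 0) <= D * l.
have [|||S [SF sep card]] := @greedy _ cl N0 F.
- by move=> f; rewrite /cl subrr enorm0 mulr_ge0 // ltW.
- by move=> f g; rewrite /cl enormC.
- move=> f fF; apply: (hN0 l f _ lp (FG f fF)); first by case/andP: (Fl f fF).
  move=> g /=; rewrite !inE /= => /andP[gF fg]; split => //; first exact: FG.
  by case/andP: (Fl g gF).
have SK : #|` S|%:R * l `^ t < K.
  rewrite ltNge; apply/negP => SK; apply: H; exists l, S; split => //.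
  - by rewrite lp.
  - by move=> f /(fsubsetP SF) /FA[[]].
  - by move=> f /(fsubsetP SF) /Fl.
  by move=> f g fS gS fg; rewrite ltNge; exact: sep.
apply: (@le_trans _ _ (\sum_(f <- F) (2 * l) `^ s)).
  rewrite big_seq [X in _ <= X]big_seq; apply: ler_sum => f fF.
  have /andP[h1 h2] := Fl f fF.
  apply: ge0_ler_powR; rewrite ?nnegrE ?(ltW s0) ?(ltW (kg_Wgt0 kg (FG f fF))) //.
    by rewrite mulr_ge0 // ltW.
  exact: ltW.
rewrite big_const_seq count_predT iter_addr_0 -[_ *+ size _]mulr_natl.
rewrite powRM ?(ltW lp) //.
have -> : l `^ s = l `^ t * l `^ (s - t).
  by rewrite -powRD ?(gt_eqF lp) ?implybT // addrC subrK.
have -> : l `^ (s - t) = q ^+ k.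
  by rewrite /l -(powR_mulrn k (ltW h0)) -(powR_mulrn k q0) /q powRAC.
have lt0 : 0 <= l `^ t by exact: powR_ge0.
have qk : 0 <= q ^+ k by exact: exprn_ge0.
have h3 : #|` F|%:R * l `^ t <= N0%:R * `|K|.
  apply: (@le_trans _ _ (N0%:R * (#|` S|%:R * l `^ t))).
    by rewrite mulrA ler_wpM2r // -natrM ler_nat.
  apply: ler_wpM2l => //; apply: (le_trans (ltW SK)); exact: ler_norm.
have -> : #|` F|%:R * (2 `^ s * (l `^ t * q ^+ k)) =
  #|` F|%:R * l `^ t * (2 `^ s * q ^+ k) by ring.
have -> : N0%:R * `|K| * 2 `^ s * q ^+ k = N0%:R * `|K| * (2 `^ s * q ^+ k) by ring.
by apply: ler_wpM2r => //; rewrite mulr_ge0 // powR_ge0.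
Qed.

End Select.

(** * Hausdorff measure of a coded set *)

Section Kraft.
Context {R : realType}.
Variables (N : nat) (len : nat -> nat) (tau : nat -> nat -> 'I_N).
Implicit Types (s : nat -> 'I_N).

Definition upd s l (a : 'I_N) : nat -> 'I_N := fun j => if j == l then a else s j.

(** The mass, relative to the cylinder of the first [l] letters of [s], of the
    cylinder of the first [len i] letters of [tau i]. *)
Definition cylm i s l : R :=
  if [forall j : 'I_(minn (len i) l), tau i j == s j] then N%:R ^- (len i - l) else 0.

Lemma cylm_ge0 i s l : 0 <= cylm i s l.
Proof. by rewrite /cylm; case: ifP => // _; rewrite invr_ge0 exprn_ge0. Qed.

Lemma N_gt0 : (0 < N)%N. Proof. by case: N (tau 0 0) => // -[]. Qed.

Lemma agreeP i s l : reflect (forall j, (j < minn (len i) l)%N -> tau i j = s j)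
  [forall j : 'I_(minn (len i) l), tau i j == s j].
Proof.
apply: (iffP forallP) => [H j jl|H j]; last by apply/eqP; exact: H.
by have /eqP := H (Ordinal jl).
Qed.

Lemma cylm_split i s l : \sum_(a < N) cylm i (upd s l a) l.+1 = N%:R * cylm i s l.
Proof.
have N0 := N_gt0; have NR : (N%:R : R) != 0 by rewrite pnatr_eq0 -lt0n.
have [le|lt] := leqP (len i) l.
  have -> : cylm i s l = if [forall j : 'I_(minn (len i) l), tau i j == s j] then 1 else 0.
    by rewrite /cylm (eqP le) expr0 invr1.
  rewrite (eq_bigr (fun=> if [forall j : 'I_(minn (len i) l), tau i j == s j] then 1 else 0)).
    by rewrite sumr_const card_ord -[LHS]mulr_natl.
  move=> a _; rewrite /cylm.
  have -> : (len i - l.+1)%N = 0%N by apply/eqP; exact: leqW.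
  rewrite expr0 invr1; congr (if _ then _ else _).
  have jl j : (j < len i)%N -> (j == l) = false.
    by move=> h; apply: ltn_eqF; exact: leq_trans h le.
  apply/agreeP/agreeP => H j; rewrite leq_min => /andP[j1 j2].
    have := H j; rewrite /upd (jl j j1) leq_min j1 (ltnW _) //; exact.
  by rewrite /upd (jl j j1) H // leq_min j1 (leq_trans j1 le).
rewrite (bigD1 (tau i l)) //= big1 ?addr0 => [|a al].
  rewrite /cylm; have -> : (len i - l)%N = (len i - l.+1).+1 by rewrite -subSn // subSS.
  have -> : [forall j : 'I_(minn (len i) l.+1), tau i j == upd s l (tau i l) j] =
            [forall j : 'I_(minn (len i) l), tau i j == s j].
    apply/agreeP/agreeP => H j; rewrite leq_min => /andP[j1 j2].
      have := H j; rewrite /upd (ltn_eqF j2) leq_min j1 (ltnW _) //; exact.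
    rewrite /upd; case: eqP => [->//|/eqP jl]; apply: H.
    by rewrite leq_min j1 /= ltn_neqAle jl -ltnS.
  case: ifP => _; last by rewrite mulr0.
  by rewrite exprS invfM mulrA divff // mul1r.
rewrite /cylm; case: ifPn => // /agreeP /(_ l).
by rewrite leq_min lt ltnSn /upd eqxx => /(_ isT) ta; rewrite ta eqxx in al.
Qed.

(** Choose the letters one by one, keeping the relative mass of the given cylinders below
    1: the mean over the [N] possible letters of the relative masses at level [l + 1] is the
    relative mass at level [l]. A sequence in the [i]-th cylinder would have relative mass
    at least 1 at level [len i]. *)
Lemma kraft (c : R) : c < 1 -> (forall n, \sum_(i < n) N%:R ^- len i <= c) ->
  exists s, forall i, exists2 j, (j < len i)%N & s j != tau i j.
Proof.
move=> c1 Hc; have N0 := N_gt0.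
have NR : 0 < (N%:R : R) by rewrite ltr0n.
pose good s l := forall n, \sum_(i < n) cylm i s l <= c.
have step s l : good s l -> exists a, good (upd s l a) l.+1.
  move=> gs; apply: contrapT => /forallNP H.
  have : forall a, exists n, c < \sum_(i < n) cylm i (upd s l a) l.+1.
    move=> a; have /existsNP[n /negP] := H a; rewrite -ltNge => h; by exists n.
  move=> /choice[n nP]; pose M := \max_a n a.
  have mono a : c < \sum_(i < M) cylm i (upd s l a) l.+1.
    apply: (lt_le_trans (nP a)); have nM : (n a <= M)%N by exact: (leq_bigmax a).
    rewrite (big_ord_widen M (fun i => cylm i (upd s l a) l.+1) nM) big_mkcond /=.
    by apply: ler_sum => i _; case: ifP => // _; exact: cylm_ge0.
  have : \sum_(a < N) c < \sum_(a < N) \sum_(i < M) cylm i (upd s l a) l.+1.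
    apply: ltr_sum => [|a _]; last exact: mono.
    by apply/hasP; exists (Ordinal N0); rewrite ?mem_index_enum.
  rewrite exchange_big /=; under [X in _ < X]eq_bigr do rewrite cylm_split; rewrite -mulr_sumr.
  rewrite sumr_const card_ord -[c *+ N]mulr_natl ltr_pM2l // ltNge.
  by rewrite (gs M).
have good0 : good (tau 0%N) 0%N.
  move=> n; apply: le_trans (Hc n); apply: ler_sum => i _; rewrite /cylm.
  by case: ifP => _; rewrite ?subn0 // invr_ge0 exprn_ge0 // ltW.
pose st := {p : (nat -> 'I_N) * nat | good p.1 p.2}.
have next (p : st) : {q : st | exists a, sval q = (upd (sval p).1 (sval p).2 a, (sval p).2.+1)}.
  apply: cid; case: p => -[s l] /= gs; have [a ga] := step s l gs.
  by exists (exist _ (upd s l a, l.+1) ga), a.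
have [f [f0 fS]] := dependent_choice next (exist _ (tau 0%N, 0%N) good0 : st).
have f2 l : (sval (f l)).2 = l.
  elim: l => [|l IH]; first by rewrite f0.
  by have [a ->] := fS l; rewrite /= IH.
pose S l := (sval (f l)).1.
have SS l : exists a, S l.+1 = upd (S l) l a.
  by have [a e] := fS l; exists a; rewrite /S e f2.
have gS l : good (S l) l by have := svalP (f l); rewrite f2.
have stable j k : S (j.+1 + k)%N j = S j.+1 j.
  elim: k => [|k IH]; first by rewrite addn0.
  rewrite addnS; have [a ->] := SS (j.+1 + k)%N.
  by rewrite /upd ltn_eqF ?IH // addSn ltnS leq_addr.
exists (fun j => S j.+1 j) => i; apply: contrapT => H.
have all_eq j : (j < len i)%N -> S (len i) j = tau i j.
  move=> jl; have := stable j (len i - j.+1)%N; rewrite subnKC // => ->.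
  by apply: contrapT => /eqP h; apply: H; exists j.
have := gS (len i) i.+1; rewrite big_ord_recr /=.
have -> : cylm i (S (len i)) (len i) = 1.
  rewrite /cylm subnn expr0 invr1; case: ifPn => // /agreeP[] j; rewrite minnn => jl.
  by rewrite all_eq.
have : 0 <= \sum_(i0 < i) cylm i0 (S (len i)) (len i).
  by apply: sumr_ge0 => k _; exact: cylm_ge0.
lra.
Qed.

End Kraft.

Section Coding.
Context {R : realType} {m : nat}.
Notation V := 'rV[R]_m.
Implicit Types (x y z : V).
Variables (Gam : set (V -> V)) (kg : kgroup Gam).
Variables (N : nat) (F : 'I_N -> V -> V) (X : V) (rho l del : R).
Let B := [set z : V | enorm z <= 1 /\ enorm (z - X) <= rho].
Hypotheses (GF : forall i, Gam (F i)) (X1 : enorm X <= 1) (rho0 : 0 <= rho).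
Hypothesis FB : forall i z, B z -> B (F i z).
Hypothesis Fhalf : forall i z z', B z -> B z' ->
  enorm (F i z - F i z') <= 1 / 2 * enorm (z - z').
Hypothesis Flow : forall i z z', B z -> B z' -> l * enorm (z - z') <= enorm (F i z - F i z').
Hypothesis l0 : 0 < l.
Hypothesis Fsep : forall i j z z', i != j -> B z -> B z' -> del <= enorm (F i z - F j z').
Implicit Types (s t : nat -> 'I_N).

Fixpoint word s k : V -> V := if k is k'.+1 then word s k' \o F (s k') else id.

Lemma word_Gam s k : Gam (word s k).
Proof. by elim: k => [|k IH]; [exact: (kg_id kg)|exact: (kg_comp kg)]. Qed.

Lemma BX : B X. Proof. by split => //; rewrite subrr enorm0. Qed.

Lemma word_add s k j z : B z -> exists2 y, B y & word s (k + j)%N z = word s k y.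
Proof.
elim: j z => [|j IH] z Bz; first by exists z; rewrite ?addn0.
by rewrite addnS /=; exact: IH (FB _ Bz).
Qed.

Lemma word_eq s t k z : (forall j, (j < k)%N -> s j = t j) -> word s k z = word t k z.
Proof.
elim: k z => //= k IH z st; rewrite IH ?st // => j jk; apply: st; exact: ltnW.
Qed.

Lemma word_low s k z z' : B z -> B z' ->
  l ^+ k * enorm (z - z') <= enorm (word s k z - word s k z').
Proof.
elim: k z z' => [|k IH] z z' Bz Bz'; first by rewrite expr0 mul1r.
apply: le_trans (IH _ _ (FB _ Bz) (FB _ Bz')); rewrite exprSr -mulrA.
by apply: ler_wpM2l; [rewrite exprn_ge0 // ltW|exact: Flow].
Qed.

Lemma B_closed x : (forall e, 0 < e -> exists2 z, B z & enorm (z - x) < e) -> B x.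
Proof.
move=> H; split; apply/ler_addgt0Pr => e e0; have [z [z1 zX] zx] := H e e0.
  by have := enorm_subl x z; rewrite enormC; lra.
by have := enorm_tri x z X; rewrite (enormC x z); lra.
Qed.

(** The images of [B] under the words form a decreasing sequence of closed sets whose
    diameters tend to 0. *)
Lemma code_point s : exists x, forall k, exists2 z, B z & x = word s k z.
Proof.
have [|x x1 cx] := @cluster_point _ _ (fun k => word s k X).
  by move=> k; exact: (conf_le1 (kg_conf kg (word_Gam s k)) X1).
exists x => k; have [v [Gv vw wv _ _]] := kg_invP kg (word_Gam s k).
exists (v x); last by rewrite wv.
have [K K0 lK] := kg_lip kg Gv.
apply: B_closed => e e0; have [i ki hi] := cx (e / K) k (divr_gt0 e0 K0).
have [y By wy] := word_add s k (i - k) BX; exists y => //.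
rewrite subnKC // in wy; have y1 : enorm y <= 1 by case: By.
rewrite -(vw y y1) -wy; apply: le_lt_trans (lK _ _ _ x1) _.
  exact: (conf_le1 (kg_conf kg (word_Gam s i)) X1).
by rewrite mulrC -ltr_pdivlMr.
Qed.

Lemma code_sep s t k x y : (forall k, exists2 z, B z & x = word s k z) ->
  (forall k, exists2 z, B z & y = word t k z) ->
  (forall j, (j < k)%N -> s j = t j) -> s k != t k -> l ^+ k * del <= enorm (x - y).
Proof.
move=> sx ty st stk.
have [z Bz ->] := sx k.+1; have [z' Bz' ->] := ty k.+1.
rewrite /= -(word_eq _ st); apply: le_trans (word_low _ _ (FB _ Bz) (FB _ Bz')).
by apply: ler_wpM2l; [rewrite exprn_ge0 // ltW|exact: Fsep].
Qed.

Lemma ediam_ge (U : set V) x y : U x -> U y -> ((enorm (x - y))%:E <= ediam U)%E.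
Proof.
by move=> Ux Uy; apply: ereal_sup_ubound; right; exists (x, y).
Qed.

Lemma ediam_fin (U : set V) (e : R) : (ediam U <= e%:E)%E ->
  exists2 d : R, 0 <= d & ediam U = d%:E.
Proof.
move=> Ue; have U0 : (0 <= ediam U)%E by apply: ereal_sup_ubound; left.
exists (fine (ediam U)); first exact: fine_ge0.
by rewrite fineK // ge0_fin_numE // (le_lt_trans Ue) // ltry.
Qed.

(** A covering [U] by sets of small total mass is turned into a family of cylinders: the
    codes of the points of [U i] share a prefix of length [j] such that
    [N^-j <= C * diam (U i) ^ t]. By [kraft] some code avoids all these cylinders, and the
    coded point is not covered. *)
Lemma coding_hausdorff (t : R) (A : set V) : 0 < t -> 0 < del -> l < 1 ->
  1 <= N%:R * l `^ t ->
  (forall s x, (forall k, exists2 z, B z & x = word s k z) -> A x) ->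
  hausdorff_measure t A <> 0%E.
Proof.
move=> t0 del0 l1 Nl AS H0.
have lt1 : l `^ t < 1.
  have <- : 1 `^ t = 1 :> R by rewrite powR1.
  by apply: gt0_ltr_powR; rewrite ?nnegrE ?(ltW l0).
have ltp : 0 < l `^ t by rewrite powR_gt0.
have N1 : 1 < N%:R :> R.
  rewrite ltNge; apply/negP => N1.
  have : N%:R * l `^ t <= 1 * l `^ t by rewrite ler_pM2r.
  lra.
have N0 : 0 < N%:R :> R by lra.
have [C C0] : exists2 C, 0 < C & C = del `^ (- t) by exists (del `^ (- t)); rewrite ?powR_gt0.
move=> CE.
have : (hausdorff_premeasure t 1 A < (1 / (4 * C))%:E)%E.
  apply: (@le_lt_trans _ _ 0%E); last by rewrite lte_fin divr_gt0 // mulr_gt0.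
  by rewrite -H0; apply: ereal_sup_ubound; exists 1 => //=.
move=> /ereal_inf_lt[_ [U [AU Ue] <-] sumU].
have dex : forall i, exists d : R, 0 <= d /\ ediam (U i) = d%:E.
  by move=> i; have [d ? ?] := ediam_fin (Ue i); exists d.
have [d dP] := choice dex.
have d0 i : 0 <= d i by case: (dP i).
have sumd n : \sum_(i < n) d i `^ t <= 1 / (4 * C).
  rewrite -lee_fin; apply: le_trans (ltW sumU).
  apply: le_trans (nneseries_lim_ge n _); last by move=> i _ _; exact: poweR_ge0.
  rewrite big_mkord -sumEFin; apply: lee_sum => i _.
  by rewrite (dP i).2 poweR_EFin.
have [p pP] := choice code_point.
have small i : exists k, N%:R ^- k <= (1 / 2) ^+ i.+2 :> R.
  have [||k hk] := @exp_small R N%:R^-1 ((1 / 2) ^+ i.+2).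
  - by rewrite invr_ge0 (ltW N0) invf_lt1.
  - by rewrite exprn_gt0.
  by exists k; rewrite -exprVn ltW.
(* the first letter where two codes with points in [U i] differ ends the common prefix;
   when the codes agree for [k] letters, or there are none, the summable error
   [2^-(i + 2)] pays for the cylinder *)
have sel i : exists w : nat * (nat -> 'I_N),
    (forall s, U i (p s) -> forall j, (j < w.1)%N -> s j = w.2 j) /\
    N%:R ^- w.1 <= C * d i `^ t + (1 / 2) ^+ i.+2.
  have [k hk] := small i.
  have Cd : 0 <= C * d i `^ t by rewrite mulr_ge0 ?powR_ge0 // ltW.
  have [[s0 Us0]|none] := pselect (exists s, U i (p s)); last first.
    have i0 : 'I_N by exists 0%N; rewrite -(ltr0n R).
    exists (k, fun=> i0); split => /= [s Us|]; last by lra.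
    by case: none; exists s.
  have [all|nall] := pselect (forall s, U i (p s) -> forall j, (j < k)%N -> s j = s0 j).
    by exists (k, s0); split => //=; lra.
  have ex : exists j, `[< exists2 s, U i (p s) & s j != s0 j >].
    move: nall => /existsNP[s /not_implyP[Us /existsNP[j /not_implyP[_ /eqP sj]]]].
    by exists j; apply/asboolP; exists s.
  case: (ex_minnP ex) => j /asboolP[s Us sj] minj.
  have agree s' j' : U i (p s') -> (j' < j)%N -> s' j' = s0 j'.
    move=> Us' jj; apply: contrapT => /eqP h; move: jj; rewrite ltnNge minj //.
    by apply/asboolP; exists s'.
  exists (j, s0); split => /= [s' Us' j'|]; first exact: agree.
  have dj : l ^+ j * del <= d i.
    rewrite -lee_fin -(dP i).2; apply: le_trans (ediam_ge Us Us0).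
    rewrite lee_fin; apply: (code_sep (pP s) (pP s0)) => // j' jj.
    exact: agree.
  apply: (@le_trans _ _ (C * d i `^ t)); last by rewrite lerDl exprn_ge0.
  apply: (@le_trans _ _ ((l `^ t) ^+ j)).
    rewrite -exprVn lerXn2r ?nnegrE ?invr_ge0 ?(ltW N0) ?(ltW ltp) //.
    by rewrite -[X in X <= _]mul1r ler_pdivrMr // mulrC.
  have -> : (l `^ t) ^+ j = C * (l ^+ j * del) `^ t.
    rewrite powRM ?exprn_ge0 ?(ltW l0) ?(ltW del0) // CE mulrC -mulrA -powRD.
      rewrite subrr powRr0 mulr1 -powR_mulrn ?(ltW ltp) // -powR_mulrn ?(ltW l0) //.
      exact: powRAC.
    by rewrite (gt_eqF del0) implybT.
  rewrite ler_pM2l //; apply: ge0_ler_powR => //; rewrite ?nnegrE ?(ltW t0) //.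
  by rewrite mulr_ge0 ?exprn_ge0 // ltW.
have [w wP] := choice sel.
have geo n : \sum_(i < n) (1 / 2) ^+ i.+2 <= 1 / 2 :> R.
  suff -> : \sum_(i < n) (1 / 2) ^+ i.+2 = 1 / 2 - (1 / 2) ^+ n.+1 :> R.
    by rewrite gerBl exprn_ge0.
  elim: n => [|n IH]; first by rewrite big_ord0 expr1 subrr.
  by rewrite big_ord_recr /= IH !exprS; field.
have [||s hs] := @kraft R N (fun i => (w i).1) (fun i => (w i).2) (3 / 4).
- by lra.
- move=> n; apply: (@le_trans _ _ (\sum_(i < n) (C * d i `^ t + (1 / 2) ^+ i.+2))).
    by apply: ler_sum => i _; exact: (wP i).2.
  rewrite big_split /= -mulr_sumr; have := geo n.
  have : C * \sum_(i < n) d i `^ t <= C * (1 / (4 * C)) by rewrite ler_pM2l.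
  have -> : C * (1 / (4 * C)) = 1 / 4 by field; rewrite gt_eqF.
  lra.
have [i _ Ui] := AU _ (AS s (p s) (pP s)).
have [j jl] := hs i; rewrite ((wP i).1 s Ui j jl) eqxx //.
Qed.

End Coding.

(** * Lower bound by a Schottky semigroup *)

Section Schottky.
Context {R : realType} {m : nat}.
Notation V := 'rV[R]_m.
Implicit Types (x y z p a b q : V) (f g h c d u v : V -> V).
Variables (Gam : set (V -> V)) (kg : kgroup Gam).

(** An element moving [a] to [0] contracts, by a factor comparable to [W (f 0)], the
    points at a definite distance from [a]. *)
Section Contract.
Variables (f : V -> V) (a : V) (r : R).
Hypotheses (Gf : Gam f) (a1 : enorm a < 1) (fa : f a = 0) (r0 : 0 < r).
Let D := [set z : V | enorm z <= 1 /\ 2 * r <= enorm (z - a)].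

Lemma contract_jac z : D z -> W (f 0) / 4 <= jac f z <= W (f 0) / (4 * r ^+ 2).
Proof.
move=> [z1 za]; have cf := kg_conf kg Gf; rewrite (W_f0 cf a1 fa).
rewrite (jac_ge cf a1 fa z1) /=; have r20 : 0 < 2 * r by rewrite mulr_gt0.
by have := jac_le cf a1 fa z1 r20 za; rewrite exprMn; have -> : (2 : R) ^+ 2 = 4 by ring.
Qed.

Lemma contract_dist z z' : D z -> D z' ->
  W (f 0) / 4 * enorm (z - z') <= enorm (f z - f z') <= W (f 0) / (4 * r ^+ 2) * enorm (z - z').
Proof.
move=> Dz Dz'; have /andP[l u] := contract_jac Dz; have /andP[l' u'] := contract_jac Dz'.
have cf := kg_conf kg Gf; have e0 := enorm_ge0 (z - z').
have W0' : 0 <= W (f 0) by rewrite ltW ?(kg_Wgt0 kg).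
have A0 : 0 <= W (f 0) / 4 by rewrite divr_ge0.
have B0 : 0 <= W (f 0) / (4 * r ^+ 2) by rewrite divr_ge0 // mulr_ge0 ?sqr_ge0.
have sq : enorm (f z - f z') ^+ 2 = jac f z * jac f z' * enorm (z - z') ^+ 2.
  by rewrite (conf_sqr cf) //; [case: Dz|case: Dz'].
have Ae := mulr_ge0 A0 e0; have Be := mulr_ge0 B0 e0.
have f0 := enorm_ge0 (f z - f z'); have j0 := le_trans A0 l; have j0' := le_trans A0 l'.
apply/andP; split; rewrite -(@ler_pXn2r _ 2) // sq exprMn ler_wpM2r ?sqr_ge0 // expr2.
  by rewrite ler_pM.
by rewrite ler_pM.
Qed.

Lemma contract_0 z : D z -> enorm (f z - f 0) <= W (f 0) / (2 * r).
Proof.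
move=> Dz; have /andP[l u] := contract_jac Dz; have [z1 _] := Dz.
have cf := kg_conf kg Gf; have W0' : 0 <= W (f 0) by rewrite ltW ?(kg_Wgt0 kg).
have r20 : 0 <= 2 * r by rewrite mulr_ge0 // ltW.
rewrite -(@ler_pXn2r _ 2) ?nnegrE ?enorm_ge0 ?divr_ge0 //.
rewrite (conf_sqr cf) ?enorm0_le1 // jac0 subr0.
have z2 : enorm z ^+ 2 <= 1 by rewrite expr_le1 ?enorm_ge0.
have A0 : 0 <= W (f 0) / 4 by rewrite divr_ge0.
apply: (@le_trans _ _ (W (f 0) / (4 * r ^+ 2) * W (f 0))).
  rewrite -[X in _ <= X]mulr1; apply: ler_pM; rewrite ?sqr_ge0 //.
    by rewrite mulr_ge0 // (le_trans A0 l).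
  by rewrite ler_wpM2r.
by rewrite le_eqVlt; apply/orP; left; apply/eqP; field; rewrite gt_eqF.
Qed.

End Contract.

Variables (N : nat) (F G : 'I_N -> V -> V) (X Y : V) (rho lam : R).
Hypotheses (X1 : enorm X <= 1) (Y1 : enorm Y <= 1) (rho0 : 0 < rho) (lam0 : 0 < lam).
Hypotheses (XY : 4 * rho <= enorm (X - Y)) (lrho : 2 * lam <= rho ^+ 2).
Hypotheses (GF : forall i, Gam (F i)) (GG : forall i, Gam (G i)).
Hypothesis FG : forall i z, enorm z <= 1 -> F i (G i z) = z.
Hypothesis GFK : forall i z, enorm z <= 1 -> G i (F i z) = z.
Hypothesis FX : forall i, enorm (F i 0 - X) <= rho / 2.
Hypothesis GY : forall i, enorm (G i 0 - Y) <= rho / 2.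
Hypothesis WF : forall i, lam <= W (F i 0) < 2 * lam.
Hypothesis sepF : forall i j, i != j -> 3 / rho * lam < enorm (F i 0 - F j 0).
Let B := [set z : V | enorm z <= 1 /\ enorm (z - X) <= rho].

Lemma B_far i z : B z -> 2 * rho <= enorm (z - G i 0).
Proof.
move=> [z1 zX]; have := XY; have := GY i; have r0 := rho0.
have := enorm_tri X z Y; have := enorm_tri z (G i 0) Y; rewrite (enormC X z); lra.
Qed.

Lemma FG0 i : F i (G i 0) = 0. Proof. by apply: FG; rewrite enorm0. Qed.

Lemma W2 i : W (F i 0) / (2 * rho) <= lam / rho.
Proof.
have /andP[_ h] := WF i; have r0 := rho0; rewrite ler_pdivrMr; last by lra.
have -> : lam / rho * (2 * rho) = 2 * lam by field; rewrite gt_eqF.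
exact: ltW.
Qed.

Lemma lam_rho : lam / rho <= rho / 2.
Proof. by have := lrho; have := rho0 => r0 h; rewrite ler_pdivrMr //; nra. Qed.

Lemma sch_B i z : B z -> B (F i z).
Proof.
move=> Bz; have [z1 _] := Bz; split; first exact: (conf_le1 (kg_conf kg (GF i))).
have := contract_0 (GF i) (kg_lt1 kg (GG i)) (FG0 i) rho0 (conj z1 (B_far i Bz)).
have := enorm_tri (F i z) (F i 0) X; have := FX i; have := W2 i; have := lam_rho; lra.
Qed.

Lemma sch_dist i z z' : B z -> B z' ->
  lam / 4 * enorm (z - z') <= enorm (F i z - F i z') <= 1 / 2 * enorm (z - z').
Proof.
move=> Bz Bz'; have [z1 _] := Bz; have [z1' _] := Bz'.
have /andP[l u] := contract_dist (GF i) (kg_lt1 kg (GG i)) (FG0 i) rho0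
  (conj z1 (B_far i Bz)) (conj z1' (B_far i Bz')).
have /andP[w1 w2] := WF i; have e0 := enorm_ge0 (z - z').
apply/andP; split; [apply: le_trans l|apply: (le_trans u)]; apply: ler_wpM2r => //.
  by rewrite ler_pM2r.
have r2 : 0 < rho ^+ 2 by rewrite exprn_gt0.
rewrite ler_pdivrMr ?mulr_gt0 //; have := lrho; lra.
Qed.

Lemma sch_sep i j z z' : i != j -> B z -> B z' -> lam / rho <= enorm (F i z - F j z').
Proof.
move=> ij Bz Bz'; have [z1 _] := Bz; have [z1' _] := Bz'.
have := contract_0 (GF i) (kg_lt1 kg (GG i)) (FG0 i) rho0 (conj z1 (B_far i Bz)).
have := contract_0 (GF j) (kg_lt1 kg (GG j)) (FG0 j) rho0 (conj z1' (B_far j Bz')).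
have := sepF ij; have := W2 i; have := W2 j.
have -> : 3 / rho * lam = 3 * (lam / rho) by ring.
have := enorm_tri (F i 0) (F i z) (F j 0); have := enorm_tri (F i z) (F j z') (F j 0).
rewrite (enormC (F i 0) (F i z)); lra.
Qed.

(** Every word sends to [0] a point near [Y], far from [B]; so words contract [B]. *)
Lemma sch_Y i y : enorm y <= 1 -> enorm (y - Y) <= rho -> enorm (G i y - Y) <= rho.
Proof.
move=> y1 yY.
have far : 2 * rho <= enorm (y - F i 0).
  have := XY; have := FX i; have r0 := rho0.
  have := enorm_tri X (F i 0) Y; have := enorm_tri (F i 0) y Y.
  rewrite (enormC X (F i 0)) (enormC (F i 0) y); lra.
have G0 : G i (F i 0) = 0 by apply: GFK; rewrite enorm0.
have := contract_0 (GG i) (kg_lt1 kg (GF i)) G0 rho0 (conj y1 far).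
rewrite (W_f0 (kg_conf kg (GG i)) (kg_lt1 kg (GF i)) G0).
have := enorm_tri (G i y) (G i 0) Y; have := GY i; have := W2 i; have := lam_rho; lra.
Qed.

Section Word.
Variable s : nat -> 'I_N.
Let h k := word F s k.

Let Gh k : Gam (h k). Proof. exact: (word_Gam kg GF). Qed.

Lemma word_center k : exists c : V, [/\ enorm c < 1, h k c = 0 & (0 < k)%N -> enorm (c - Y) <= rho].
Proof.
elim: k => [|k [c [c1 hc cY]]]; first by exists 0; rewrite enorm0.
exists (G (s k) c); split.
- exact: (conf_lt1 (kg_conf kg (GG _))).
- by rewrite /h /= FG ?(ltW c1).
move=> _; case: k c1 hc cY => [|k] c1 hc cY.
  have -> : c = 0 by [].
  by have := GY (s 0%N); have := rho0; lra.
by apply: sch_Y; [exact: ltW|exact: cY].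
Qed.

Lemma word_far k (c : V) z : (0 < k)%N -> enorm (c - Y) <= rho -> B z -> 2 * rho <= enorm (z - c).
Proof.
move=> _ cY [z1 zX]; have := XY; have := enorm_tri X z Y; have := enorm_tri z c Y.
by rewrite (enormC X z); lra.
Qed.

Lemma word_near k z : B z -> enorm (h k z - h k 0) <= (1 + (2 * rho)^-1) * W (h k 0).
Proof.
move=> Bz; have [z1 zX] := Bz; have Wk := kg_Wgt0 kg (Gh k).
have r2 : 0 < (2 * rho)^-1 by rewrite invr_gt0 mulr_gt0.
case: k Wk => [|k] Wk; first by rewrite /h /= subr0 W0 mulr1; lra.
have [c [c1 hc /(_ isT) cY]] := word_center k.+1.
have := contract_0 (Gh k.+1) c1 hc rho0 (conj z1 (word_far (ltn0Sn k) cY Bz)).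
move=> /le_trans; apply; rewrite mulrC ler_wpM2r ?(ltW Wk) //; lra.
Qed.

Lemma word_Wge k : lam / 4 * W (h k 0) <= W (h k.+1 0).
Proof.
rewrite {2}/h /= (conf_W (kg_conf kg (Gh k)) (kg_le1 kg (GF _))).
have := jac_ge_W kg (Gh k) (kg_le1 kg (GF (s k))); have /andP[w1 _] := WF (s k).
have Wk := kg_Wgt0 kg (Gh k).
move=> h1; have -> : lam / 4 * W (h k 0) = W (h k 0) / 4 * lam by ring.
by apply: ler_pM => //; [rewrite divr_ge0 // ltW|exact: ltW].
Qed.

Lemma word_Wle k : W (h k.+1 0) <= (1 / 2) ^+ k.
Proof.
elim: k => [|k IH]; first by rewrite expr0 W_le1.
rewrite {1}/h [word _ _ _]/= [in X in X <= _]/comp.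
rewrite (conf_W (kg_conf kg (Gh k.+1)) (kg_le1 kg (GF _))).
have [c [c1 hc /(_ isT) cY]] := word_center k.+1.
have B0 : B (F (s k.+1) 0).
  split; first exact: (kg_le1 kg (GF _)).
  by have := FX (s k.+1); have := rho0; lra.
have /andP[_ u] := contract_jac (Gh k.+1) c1 hc rho0 (conj B0.1 (word_far (ltn0Sn k) cY B0)).
have /andP[w1 w2] := WF (s k.+1).
have Wk := kg_Wgt0 kg (Gh k.+1); have r2 : 0 < rho ^+ 2 by rewrite exprn_gt0.
have j0 := jac_gt0 (kg_conf kg (Gh k.+1)) B0.1.
apply: (@le_trans _ _ (W (h k.+1 0) / (4 * rho ^+ 2) * (2 * lam))).
  by apply: ler_pM => //; [exact: ltW|exact: ltW (kg_Wgt0 kg (GF _))|exact: ltW].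
have -> : W (h k.+1 0) / (4 * rho ^+ 2) * (2 * lam) =
  W (h k.+1 0) * (2 * lam) / (4 * rho ^+ 2) by rewrite mulrAC.
rewrite ler_pdivrMr ?mulr_gt0 // exprS.
have -> : 1 / 2 * (1 / 2) ^+ k * (4 * rho ^+ 2) = 2 * ((1 / 2) ^+ k * rho ^+ 2) by field.
have h1 : W (h k.+1 0) * (2 * lam) <= (1 / 2) ^+ k * rho ^+ 2.
  by apply: ler_pM => //; [exact: ltW|rewrite mulr_ge0 // ltW].
have : 0 <= (1 / 2 : R) ^+ k * rho ^+ 2 by rewrite mulr_ge0 ?exprn_ge0 // ltW.
lra.
Qed.

Lemma word_Wsmall e : 0 < e -> exists k, W (h k.+1 0) < e.
Proof.
move=> e0; have [||k hk] := @exp_small R (1 / 2) e => //; first by lra.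
by exists k; apply: le_lt_trans hk; exact: word_Wle.
Qed.

(** The orbit points [h k 0] of the prefixes accompany the ray ending at the coded point. *)
Lemma code_limpt x : (forall k, exists2 z, B z & x = h k z) ->
  limpt Gam x /\ bounded_ray Gam x.
Proof.
move=> cx; pose C := 1 + (2 * rho)^-1.
have C1 : 1 < C by rewrite ltrDl invr_gt0 mulr_gt0.
have near k : enorm (x - h k 0) <= C * W (h k 0).
  by have [z Bz ->] := cx k; exact: word_near.
have x1 : enorm x = 1.
  apply/eqP; rewrite eq_le; apply/andP; split.
    by have [z [z1 _] ->] := cx 0%N.
  apply/ler_addgt0Pr => e e0; have e1 : 0 < e / (1 + C) by rewrite divr_gt0 //; lra.
  have [k] := word_Wsmall e1; rewrite ltr_pdivlMr; last by lra.
  move=> hk; have := near k.+1; have := kg_lt1 kg (Gh k.+1); have := enorm_ge0 (h k.+1 0).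
  have := enorm_subl (h k.+1 0) x; rewrite enormC.
  have : 1 - W (h k.+1 0) <= enorm (h k.+1 0).
    by rewrite /W; have := kg_lt1 kg (Gh k.+1); have := enorm_ge0 (h k.+1 0); nra.
  lra.
split.
  split => // e e0; have C0 : 0 < C by lra.
  have [k] := word_Wsmall (divr_gt0 e0 C0); rewrite ltr_pdivlMr // => hk.
  exists (h k.+1) => //; rewrite enormC; apply: le_lt_trans (near _) _; lra.
exists (4 * (1 + C) ^+ 2 / lam) => t t01; have /andP[t0 t1] := t01.
(* choose the orbit point [h k 0] at the height of the point of the ray; two successive
   heights differ by a bounded factor *)
have ex : exists k, W (h k.+1 0) < t by exact: word_Wsmall.
case: (ex_minnP ex) => k hk mink.
have tk : t <= W (h k 0).
  case: k hk mink => [|k] hk mink; first by rewrite /h /= W0.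
  by rewrite leNgt; apply/negP => /mink; rewrite ltnn.
exists (h k) => //; have [z1 /andP[w1 w2] zx] := ray_W x1 t01.
set z := (1 - t) *: x in z1 w1 w2 zx *.
have Wk := kg_Wgt0 kg (Gh k).
have d1 : enorm (z - h k 0) <= (1 + C) * W (h k 0).
  have := enorm_tri z x (h k 0); rewrite zx; have := near k; lra.
have wz : lam / 4 * W (h k 0) <= W z.
  by apply: le_trans w1; apply: le_trans (ltW hk); exact: word_Wge.
have wz0 : 0 < W z by exact: lt_le_trans w1.
rewrite /qd ler_pdivrMr ?mulr_gt0 //.
apply: (@le_trans _ _ (((1 + C) * W (h k 0)) ^+ 2)).
  rewrite ler_pXn2r ?nnegrE ?enorm_ge0 // mulr_ge0 ?(ltW Wk) //; lra.
have C2 : 0 <= (1 + C) ^+ 2 by exact: sqr_ge0.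
have -> : ((1 + C) * W (h k 0)) ^+ 2 =
  4 * (1 + C) ^+ 2 / lam * (lam / 4 * W (h k 0) * W (h k 0)).
  by field; rewrite gt_eqF.
apply: ler_wpM2l; first by apply: divr_ge0; [exact: mulr_ge0|exact: ltW].
by rewrite ler_pM2r.
Qed.

End Word.
End Schottky.

Section HeavyHausdorff.
Context {R : realType} {m : nat}.
Notation V := 'rV[R]_m.
Variables (Gam : set (V -> V)) (kg : kgroup Gam).

(** Divergence at [s] makes it possible to select, at one scale [lam], more than
    [(4 / lam) ^ t] separated elements mapping the complement of a neighbourhood of [Y] into
    a neighbourhood of [X]. They generate a free semigroup of contractions of ratio at least
    [lam / 4]; its limit set consists of points with bounded rays and has positive [t]-dimensional
    measure by [coding_hausdorff]. *)
Lemma heavy_hausdorff (s t : R) (A : set V) : 0 < t -> t < s ->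
  infinite_set (limpt Gam) -> ~ light (wt s) Gam ->
  (forall x, limpt Gam x -> bounded_ray Gam x -> A x) ->
  hausdorff_measure t A <> 0%E.
Proof.
move=> t0 ts inf hG sub; have s0 : 0 < s by exact: lt_trans ts.
have [iv ivP] := inverse_exists kg.
have [X [Y [X1 Y1 XY hXY]]] := heavy_pair kg ivP s0 inf hG.
have [rho [rho0 rE]] : exists rho : R, 0 < rho /\ 4 * rho = enorm (X - Y).
  exists (enorm (X - Y) / 4); split; first by rewrite divr_gt0 // enorm_sub_gt0.
  by field.
have r20 : 0 < rho / 2 by rewrite divr_gt0.
have D0 : 0 <= 3 / rho by rewrite divr_ge0 // ltW.
have l00 : 0 < Num.min 1 (rho ^+ 2 / 2) by rewrite lt_min ltr01 divr_gt0 ?exprn_gt0.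
(* a heavy family of elements with orbit points near [X] and inverses near [Y] *)
set A0 := Gam `&` [set f | enorm (f 0 - X) < rho / 2 /\ enorm (iv f 0 - Y) < rho / 2].
have A0G : A0 `<=` Gam by move=> f [].
have [lam [FF [/andP[lam0]]]] := select kg ivP (4 `^ t) t0 ts A0G (hXY _ r20) D0 l00.
rewrite lt_min => /andP[lam1 lamr] FA FW Fsep FN.
pose N := #|` FF|; pose F (i : 'I_N) := nth id FF i; pose G i := iv (F i).
have Fin i : F i \in FF by rewrite mem_nth.
have FAi i : A0 (F i) by exact: FA (Fin i).
have GF i : Gam (F i) := A0G _ (FAi i).
have GG i : Gam (G i) by have [] := ivP _ (GF i).
have FG i z : enorm z <= 1 -> F i (G i z) = z by have [_ _ h _] := ivP _ (GF i); exact: h.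
have GFK i z : enorm z <= 1 -> G i (F i z) = z by have [_ h _ _] := ivP _ (GF i); exact: h.
have FX i : enorm (F i 0 - X) <= rho / 2 by have [_ [/ltW]] := FAi i.
have GY i : enorm (G i 0 - Y) <= rho / 2 by have [_ [_ /ltW]] := FAi i.
have WF i : lam <= W (F i 0) < 2 * lam := FW _ (Fin i).
have sepF i j : i != j -> 3 / rho * lam < enorm (F i 0 - F j 0).
  move=> ij; apply: Fsep => //; rewrite /F nth_uniq ?fset_uniq //.
have XY4 : 4 * rho <= enorm (X - Y) by rewrite rE.
have lr : 2 * lam <= rho ^+ 2 by lra.
have FB i z := sch_B kg rho0 XY4 lr GF GG FG FX GY WF i (z := z).
have dist i z z' := sch_dist kg rho0 XY4 lr GF GG FG GY WF i (z := z) (z' := z').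
have sep i j z z' := sch_sep kg rho0 XY4 GF GG FG GY WF sepF (i := i) (j := j) (z := z) (z' := z').
apply: (@coding_hausdorff _ _ Gam kg N F X rho (lam / 4) (lam / rho)) => //.
- exact: ltW.
- by move=> i z z' Bz Bz'; have /andP[] := dist i z z' Bz Bz'.
- exact: (divr_gt0 lam0).
- exact: (divr_gt0 lam0 rho0).
- by lra.
- rewrite powRM ?(ltW lam0) ?invr_ge0 //.
  have e4 : (4 : R) `^ t * (4^-1) `^ t = 1 by rewrite -powRM // divff // powR1.
  have p4 : 0 < (4^-1 : R) `^ t by rewrite powR_gt0 // invr_gt0.
  have : (4 : R) `^ t * (4^-1) `^ t <= N%:R * lam `^ t * (4^-1) `^ t by rewrite ler_pM2r.
  by rewrite e4 mulrA.
move=> u x cx; have [Lx bx] := code_limpt kg rho0 lam0 XY4 lr GF GG FG GFK FX GY WF cx.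
exact: sub.
Qed.

End HeavyHausdorff.

(** * Upper bound on conical points *)

Section Upper.
Context {R : realType} {m : nat}.
Notation V := 'rV[R]_m.
Variables (Gam : set (V -> V)) (kg : kgroup Gam).

Lemma kg_countable : countable Gam.
Proof.
have -> : Gam = \bigcup_k (Gam `&` [set f | k.+1%:R^-1 <= W (f 0)]).
  apply/seteqP; split => [f Gf|f [k _ []] //].
  exists (Num.truncn (W (f 0))^-1) => //; split => //=.
  have Wf := kg_Wgt0 kg Gf; rewrite -[X in _ <= X]invrK lef_pV2 ?posrE ?invr_gt0 ?ltr0n //.
  by apply: ltW; exact: truncnS_gt.
apply: bigcup_countable => // k _; apply: finite_set_countable.
by apply: (kg_fin kg); rewrite invr_gt0.
Qed.

(** [F0] nearly realizes the supremum of the finite sums. *)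
Lemma light_tail {T : choiceType} (w : T -> R) (A : set T) e : (forall x, 0 <= w x) ->
  light w A -> 0 < e -> exists F0 : {fset T}, [set` F0] `<=` A /\
    forall F : {fset T}, [set` F] `<=` A -> (forall x, x \in F -> x \notin F0) ->
      \sum_(x <- F) w x <= e.
Proof.
move=> w0 [M HM] e0.
pose S := [set t | exists2 F : {fset T}, [set` F] `<=` A & t = \sum_(x <- F) w x].
have hs : has_sup S.
  split; first by exists 0, fset0 => //; rewrite big_seq_fset0.
  by exists M => _ [F FA ->]; exact: HM.
have [_ [F0 F0A ->] hF0] := sup_adherent e0 hs.
exists F0; split => // F FA dis.
have := sup_ubound hs.2 (x := \sum_(x <- (F0 `|` F)%fset) w x); rewrite /=.
have -> : \sum_(x <- (F0 `|` F)%fset) w x = \sum_(x <- F0) w x + \sum_(x <- F) w x.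
  rewrite (sum_fsetID w (F0 `|` F)%fset (fun x => x \in F0)); congr (_ + _).
    congr (\sum_(x <- enum_fset _) w x); apply/fsetP => x; rewrite !inE /=.
    by case: (x \in F0); rewrite ?andbF.
  congr (\sum_(x <- enum_fset _) w x); apply/fsetP => x; rewrite !inE /=.
  case xF : (x \in F); first by rewrite (negbTE (dis x xF)).
  by rewrite orbF andbN.
have inS : S (\sum_(x <- F0) w x + \sum_(x <- F) w x).
  exists (F0 `|` F)%fset.
    by move=> x /=; rewrite !inE => /orP[/F0A|/FA].
  rewrite (sum_fsetID w (F0 `|` F)%fset (fun x => x \in F0)); congr (_ + _).
    congr (\sum_(x <- enum_fset _) w x); apply/fsetP => x; rewrite !inE /=.
    by case: (x \in F0); rewrite ?andbF.
  congr (\sum_(x <- enum_fset _) w x); apply/fsetP => x; rewrite !inE /=.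
  case xF : (x \in F); first by rewrite (negbTE (dis x xF)).
  by rewrite orbF andbN.
move=> /(_ inS); move: hF0; move: (sup S) => *; lra.
Qed.

Lemma premeasure_ge0 (t e : R) (A : set V) : (0 <= hausdorff_premeasure t e A)%E.
Proof.
apply: le_ereal_inf_tmp => _ [U _ <-]; apply: nneseries_ge0 => i _ _; exact: poweR_ge0.
Qed.

(** Conical points lie in infinitely many of the balls of radius [W (f 0) ^ (s / t)],
    whose [t]-th powers have a convergent sum. *)
Lemma conic_hausdorff (s t : R) (A : set V) : 0 < s -> s < t -> light (wt s) Gam ->
  (forall x, A x -> conic Gam x) -> hausdorff_measure t A = 0%E.
Proof.
move=> s0 st lG AC; have t0 : 0 < t by exact: lt_trans st.
suff pre e : 0 < e -> (hausdorff_premeasure t e A <= 0)%E.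
  apply/eqP; rewrite eq_le; apply/andP; split.
    by apply: ge_ereal_sup => _ [e e0 <-]; exact: pre.
  apply: le_trans (premeasure_ge0 t 1 A) _.
  by apply: ereal_sup_ubound; exists 1 => //=.
move=> e0; apply/lee_addgt0Pr => eta eta0; rewrite add0e.
have t20 : 0 < 2 `^ t :> R by rewrite powR_gt0.
have [F0 [F0G tail]] := light_tail (wt_ge0 s) lG (divr_gt0 eta0 t20).
have [code codeI] := countable_injP _ kg_countable.
pose q := s / t; have q0 : 0 < q by rewrite divr_gt0.
pose rad (f : V -> V) := W (f 0) `^ q.
pose ok k f := [/\ Gam f, code f = k, f \notin F0 & 2 * rad f <= e].
(* at most one element has the code [k]; elements of [F0] and those with large balls get the
   empty set *)
pose U k := [set y | exists2 f, ok k f & enorm (y - f 0) <= rad f].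
have ok_uniq k f g : ok k f -> ok k g -> f = g.
  by move=> [Gf fk _ _] [Gg gk _ _]; exact: codeI (mem_set Gf) (mem_set Gg) (etrans fk (esym gk)).
have radE f : Gam f -> (2 * rad f) `^ t = 2 `^ t * wt s f.
  move=> Gf; rewrite powRM ?powR_ge0 // /rad /wt -powRrM /q divfK // gt_eqF //.
have dU k f : ok k f -> (ediam (U k) <= (2 * rad f)%:E)%E.
  move=> okf; apply: ge_ereal_sup => _ [->|[[y z] [/= [f1 ok1 y1] [f2 ok2 z2]] <-]].
    by rewrite lee_fin mulr_ge0 ?powR_ge0.
  rewrite (ok_uniq _ _ _ ok1 okf) in y1; rewrite (ok_uniq _ _ _ ok2 okf) in z2.
  by rewrite lee_fin /=; have := enorm_tri y (f 0) z; rewrite (enormC (f 0) z); lra.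
have nU k : ~ (exists f, ok k f) -> (ediam (U k) <= 0)%E.
  move=> nok; apply: ge_ereal_sup => ? [->//|[[y z] [/= [f1 ok1 y1] _] _]].
  by case: nok; exists f1.
have sumU n : exists F : {fset V -> V}, [/\ [set` F] `<=` Gam,
    forall f, f \in F -> f \notin F0, forall f, f \in F -> (code f < n)%N &
    (\sum_(k < n) poweR (ediam (U k)) t <= (2 `^ t * \sum_(f <- F) wt s f)%:E)%E].
  elim: n => [|n [F [FG FF0 Fn IH]]].
    by exists fset0; split => //; rewrite big_ord0 big_seq_fset0 mulr0.
  have [[f okf]|nok] := pselect (exists f, ok n f); last first.
    exists F; split => //; first by move=> f /Fn; exact: ltnW.
    rewrite big_ord_recr /= -[X in (_ <= X)%E]adde0; apply: leeD => //.
    have -> : ediam (U n) = 0%E.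
      by apply/eqP; rewrite eq_le nU //=; apply: ereal_sup_ubound; left.
    by rewrite poweR0r // gt_eqF.
  have [Gf fn fF0 _] := okf.
  have fF : f \notin F by apply/negP => /Fn; rewrite fn ltnn.
  exists (f |` F)%fset; split.
  - by move=> g /=; rewrite !inE => /orP[/eqP ->|/FG].
  - by move=> g; rewrite !inE => /orP[/eqP ->|/FF0].
  - by move=> g; rewrite !inE => /orP[/eqP ->|/Fn /ltnW//]; rewrite fn.
  rewrite big_ord_recr /= big_fsetU1 //= mulrDr EFinD addeC; apply: leeD => //.
  rewrite -radE // -poweR_EFin; apply: gt0_ler_poweR; rewrite ?(ltW t0) //.
  - by rewrite in_itv /= leey andbT; apply: ereal_sup_ubound; left.
  - by rewrite in_itv /= leey andbT lee_fin mulr_ge0 // powR_ge0.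
  exact: dU.
apply: (@le_trans _ _ (\sum_(0 <= k <oo) poweR (ediam (U k)) t)%E).
  apply: ereal_inf_lbound; exists U => //; split => [x Ax|k]; last first.
    have [[f okf]|nok] := pselect (exists f, ok k f).
      by apply: le_trans (dU k f okf) _; rewrite lee_fin; case: okf.
    by apply: le_trans (nU k nok) _; rewrite lee_fin ltW.
  have [x1 [kk Hk]] := AC x Ax.
  have [r1 r10 hr1] : exists2 r1 : R, 0 < r1 & forall f, f \in F0 -> r1 <= W (f 0).
    have [|f a b|f fF|a Ha] := @finite_bound R _ [set` F0] (fun f a => - a <= ln (W (f 0))).
    - exact: finite_fset.
    - by move=> h ab; apply: le_trans h; lra.
    - by exists (- ln (W (f 0))); rewrite opprK.
    exists (expR (- a)); first exact: expR_gt0.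
    move=> f fF; have Wf := kg_Wgt0 kg (F0G _ fF).
    by rewrite -[W _]lnK ?posrE // ler_expR; exact: Ha.
  pose be := 1 - q; have be0 : 0 < be by rewrite /be /q subr_gt0 ltr_pdivrMr // mul1r.
  have K0 : 0 < `|kk| + 1 by have := normr_ge0 kk; lra.
  pose r2 := (`|kk| + 1)^-1 `^ be^-1; have r20 : 0 < r2 by rewrite powR_gt0 // invr_gt0.
  pose r3 := (e / 2) `^ q^-1; have r30 : 0 < r3 by rewrite powR_gt0 // divr_gt0.
  have [|f [Gf fx fk]] := Hk (Num.min (Num.min r1 r2) r3 / 2).
    by rewrite divr_gt0 // !lt_min r10 r20.
  have : W (f 0) < Num.min (Num.min r1 r2) r3.
    by have := W_le_dist x1 (kg_le1 kg Gf); lra.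
  rewrite !lt_min => /andP[/andP[W1 W2] W3]; have Wf := kg_Wgt0 kg Gf.
  exists (code f) => //; exists f.
    split => //; first by apply/negP => /hr1; lra.
    have : rad f <= e / 2.
      have -> : e / 2 = r3 `^ q by rewrite /r3 -powRrM mulVf ?gt_eqF // powRr1 // divr_ge0 // ltW.
      by apply: ge0_ler_powR; rewrite ?nnegrE ?ltW.
    lra.
  rewrite enormC; apply: (le_trans fk); apply: (@le_trans _ _ (`|kk| * W (f 0))).
    by rewrite ler_wpM2r ?ler_norm // ltW.
  have {1}-> : W (f 0) = W (f 0) `^ be * W (f 0) `^ q.
    by rewrite -powRD ?(gt_eqF Wf) ?implybT // /be subrK powRr1 // ltW.
  rewrite mulrA -[X in _ <= X]mul1r; apply: ler_wpM2r; first exact: powR_ge0.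
  have Wb : W (f 0) `^ be <= (`|kk| + 1)^-1.
    have -> : (`|kk| + 1)^-1 = r2 `^ be.
      by rewrite /r2 -powRrM mulVf ?gt_eqF // powRr1 // invr_ge0 ltW.
    by apply: ge0_ler_powR; rewrite ?nnegrE ?ltW.
  apply: (@le_trans _ _ ((`|kk| + 1) * (`|kk| + 1)^-1)); last by rewrite divff // gt_eqF.
  by apply: ler_pM => //; [exact: powR_ge0|rewrite lerDl].
apply: lime_le.
  by apply: is_cvg_nneseries => i _ _; exact: poweR_ge0.
apply: nearW => n; rewrite big_mkord; have [F [FG FF0 _ H]] := sumU n.
apply: (le_trans H); rewrite lee_fin mulrC -ler_pdivlMr //; exact: tail.
Qed.

End Upper.

(** * The hyperbolic distance *)

Section Calculus.
Context {R : realType}.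

(** The integral function of [f] minus [phi] has a nonnegative derivative. *)
Lemma integral_bound (phi dphi f : R -> R) :
  (forall t : R, 0 <= t <= 1 -> is_derive t 1 phi (dphi t)) ->
  (forall t : R, 0 <= t <= 1 -> {for t, continuous f}) ->
  (forall t : R, 0 <= t <= 1 -> dphi t <= f t) ->
  phi 1 - phi 0 <= Rintegral lebesgue_measure `[0, 1] f.
Proof.
move=> dp cf le.
have cf01 : {within `[0, 1], continuous f}.
  by apply: continuous_in_subspaceT => t /set_mem /=; rewrite in_itv /=; exact: cf.
have fi : lebesgue_measure.-integrable `[0, 1] (EFin \o f).
  by apply: continuous_compact_integrable => //; exact: segment_compact.
pose Psi x := parameterized_integral lebesgue_measure 0 x f.
have cPsi : {within `[0, 1], continuous Psi}.
  exact: parameterized_integral_continuous.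
have dPsi (t : R) : t \in `]0, 1[ -> derivable Psi t 1 /\ derive1 Psi t = f t.
  rewrite in_itv /= => /andP[t0 t1].
  have ct : {for t, continuous f} by apply: cf; apply/andP; split; exact: ltW.
  exact: (continuous_FTC1_closed t1 fi t0 ct).
have in01 (t : R) : t \in `]0, 1[ -> 0 <= t <= 1.
  by rewrite in_itv /= => /andP[t0 t1]; apply/andP; split; exact: ltW.
have dphi' (t : R) : 0 <= t <= 1 -> derivable phi t 1 /\ derive1 phi t = dphi t.
  by move=> t01; have [h1 h2] := dp t t01; rewrite derive1E.
have := @ger0_derive1_le_cc R (Psi \- phi) 0 1 _ _ _ 0 1.
have -> : (Psi \- phi) 1 = Rintegral lebesgue_measure `[0, 1] f - phi 1 by [].
have -> : (Psi \- phi) 0 = - phi 0.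
  by rewrite /= /Psi /parameterized_integral set_itv1 Rintegral_set1 sub0r.
move=> H; suff : - phi 0 <= Rintegral lebesgue_measure `[0, 1] f - phi 1 by lra.
apply: H => //; rewrite ?in_itv /= ?lexx ?ler01 //.
- move=> t t01; apply: derivableB; first by have [] := dPsi t t01.
  by have [] := dphi' t (in01 t t01).
- move=> t t01; rewrite derive1E deriveB.
  + rewrite -!derive1E (dPsi t t01).2 (dphi' t (in01 t t01)).2 subr_ge0.
    exact: le (in01 t t01).
  + by have [] := dPsi t t01.
  by have [] := dphi' t (in01 t t01).
move=> x; apply: continuousB; first exact: cPsi.
apply: continuous_in_subspaceT => t /set_mem /=; rewrite in_itv /= => t01.
by have [h _] := dphi' t t01; apply: differentiable_continuous; exact/derivable1_diffP.
Qed.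

(** The inverse of the hyperbolic cosine. *)
Definition ell (u : R) := ln (u + Num.sqrt (u ^+ 2 - 1)).

Lemma expR_ell u : 1 <= u -> expR (ell u) = u + Num.sqrt (u ^+ 2 - 1).
Proof.
move=> u1; rewrite lnK // posrE; have := sqrtr_ge0 (u ^+ 2 - 1); lra.
Qed.

Lemma ell_cosh u : 1 <= u -> expR (ell u) + (expR (ell u))^-1 = 2 * u.
Proof.
move=> u1; rewrite expR_ell //.
have s2 : Num.sqrt (u ^+ 2 - 1) ^+ 2 = u ^+ 2 - 1 by rewrite sqr_sqrtr //; nra.
have := sqrtr_ge0 (u ^+ 2 - 1); move: s2; set s := Num.sqrt _ => s2 s0.
have p0 : 0 < u + s by lra.
have -> : (u + s)^-1 = u - s.
  by apply: (mulIf (lt0r_neq0 p0)); rewrite mulVf ?gt_eqF //; lra.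
lra.
Qed.

Lemma ell_inj u v : 1 <= u -> 1 <= v -> ell u = ell v -> u = v.
Proof.
move=> u1 v1 e; have := ell_cosh u1; rewrite e ell_cosh // => h.
by lra.
Qed.

Lemma ell_ge0 u : 1 <= u -> 0 <= ell u.
Proof. by move=> u1; apply: ln_ge0; have := sqrtr_ge0 (u ^+ 2 - 1); lra. Qed.

Lemma ell_bounds u : 1 <= u -> u <= expR (ell u) <= 2 * u.
Proof.
move=> u1; rewrite expR_ell //; have s0 := sqrtr_ge0 (u ^+ 2 - 1).
apply/andP; split; first lra.
have : Num.sqrt (u ^+ 2 - 1) <= u.
  rewrite -(@ler_pXn2r _ 2) ?nnegrE //; last by lra.
  by rewrite sqr_sqrtr; nra.
lra.
Qed.

(** Regularised version, differentiable at [u = 1]. *)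
Lemma ell_reg u e : 1 <= u -> 0 < e ->
  ell u <= ln (u + Num.sqrt (u ^+ 2 - 1 + e ^+ 2)) <= ell u + e.
Proof.
move=> u1 e0; have s0 := sqrtr_ge0 (u ^+ 2 - 1).
have u2 : 0 <= u ^+ 2 - 1 by nra.
have e2 : 0 < e ^+ 2 by rewrite exprn_gt0.
have h1 : Num.sqrt (u ^+ 2 - 1) <= Num.sqrt (u ^+ 2 - 1 + e ^+ 2).
  by rewrite ler_sqrt; lra.
have h2 : Num.sqrt (u ^+ 2 - 1 + e ^+ 2) <= Num.sqrt (u ^+ 2 - 1) + e.
  rewrite -(@ler_pXn2r _ 2) ?nnegrE ?sqrtr_ge0 //; last by lra.
  rewrite [X in X <= _]sqr_sqrtr; last by lra.
  by rewrite sqrrD sqr_sqrtr //; have := mulr_ge0 s0 (ltW e0); lra.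
apply/andP; split; first by rewrite ler_ln ?posrE; lra.
have p0 : 0 < u + Num.sqrt (u ^+ 2 - 1) by lra.
apply: (@le_trans _ _ (ln ((u + Num.sqrt (u ^+ 2 - 1)) * expR e))).
  rewrite ler_ln ?posrE; [|by lra|by rewrite mulr_gt0 // expR_gt0].
  have := expR_ge1Dx e => h.
  apply: (@le_trans _ _ ((u + Num.sqrt (u ^+ 2 - 1)) * (1 + e))); last by rewrite ler_pM2l.
  nra.
by rewrite lnM ?posrE ?expR_gt0 // expRK.
Qed.

End Calculus.

Section PointwiseRules.
Context {R : realType}.
Implicit Types (f g : R -> R) (t a b : R).

Lemma is_der_add f g t a b : is_derive t 1 f a -> is_derive t 1 g b ->
  is_derive t 1 (fun s => f s + g s) (a + b).
Proof. exact: is_deriveD. Qed.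

Lemma is_der_sub f g t a b : is_derive t 1 f a -> is_derive t 1 g b ->
  is_derive t 1 (fun s => f s - g s) (a - b).
Proof. exact: is_deriveB. Qed.

Lemma is_der_mul f g t a b : is_derive t 1 f a -> is_derive t 1 g b ->
  is_derive t 1 (fun s => f s * g s) (a * g t + f t * b).
Proof.
move=> hf hg; rewrite (_ : (fun s => f s * g s) = f * g) //.
apply: (@is_derive_eq _ _ _ _ _ _ _ _ (is_deriveM hf hg)).
by rewrite /GRing.scale /=; ring.
Qed.

Lemma is_der_cst t b : is_derive t (1 : R) (fun=> b) 0.
Proof. exact: is_derive_cst. Qed.

Lemma is_der_inv f t a : f t != 0 -> is_derive t 1 f a ->
  is_derive t 1 (fun s => (f s)^-1) (- a / f t ^+ 2).
Proof.
move=> h hf; apply: (@is_derive_eq _ _ _ _ _ _ _ _ (is_deriveV h hf)).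
by rewrite /GRing.scale /= -exprVn; ring.
Qed.

Lemma is_der_comp f g t a b : is_derive (g t) 1 f a -> is_derive t 1 g b ->
  is_derive t 1 (fun s => f (g s)) (a * b).
Proof. exact: is_derive1_comp. Qed.

Lemma is_der_continuous f t a : is_derive t 1 f a -> {for t, continuous f}.
Proof.
by case=> h _; apply: differentiable_continuous; exact/derivable1_diffP.
Qed.

End PointwiseRules.

Section Curve.
Context {R : realType} {n : nat}.
Notation V := 'rV[R]_n.+1.
Implicit Types (x y : V) (c : R -> V) (t : R).

Lemma qd_ge0 x y : enorm x < 1 -> enorm y < 1 -> 0 <= qd x y.
Proof.
by rewrite -!W_gt0 => hx hy; rewrite /qd divr_ge0 ?sqr_ge0 // mulr_ge0 // ltW.
Qed.

Lemma is_derive_coord c t i : derivable c t 1 ->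
  is_derive t 1 (fun t => c t 0 i) (derive1 c t 0 i).
Proof.
move=> dc; have := dc; rewrite derivable_mxP => /(_ 0 i) di.
by rewrite derive1E derive_mx // mxE; exact: derivableP.
Qed.

Lemma is_derive_dot (c e : R -> V) (c' e' : V) (t : R) :
  (forall i, is_derive t 1 (fun t => c t 0 i) (c' 0 i)) ->
  (forall i, is_derive t 1 (fun t => e t 0 i) (e' 0 i)) ->
  is_derive t 1 (fun t => dot (c t) (e t)) (dot c' (e t) + dot (c t) e').
Proof.
move=> dc de.
have -> : (fun t => dot (c t) (e t)) =
    \sum_(i < n.+1) ((fun t => c t 0 i) * (fun t => e t 0 i)).
  by apply/funext => s; rewrite fct_sumE.
have -> : dot c' (e t) + dot (c t) e' =
    \sum_(i < n.+1) (c t 0 i *: e' 0 i + e t 0 i *: c' 0 i).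
  rewrite /dot -big_split /=; apply: eq_bigr => i _.
  by rewrite addrC [e t 0 i *: _]mulrC.
apply: is_derive_sum => i; exact: is_deriveM.
Qed.

Lemma enorm_continuous : continuous (@enorm R n.+1).
Proof.
move=> x; apply/(@cvgrPdist_lt _ _ _ (nbhs x) (nbhs_filter x)) => e e0.
apply/nbhs_enormP; exists e => // y h /=.
apply: le_lt_trans h; rewrite ler_norml enorm_subl andbT.
by have := enorm_subl y x; rewrite (enormC y x); lra.
Qed.

(** The derivative [q'] of the distance function along a curve satisfies
    [|q'| <= 2 sqrt (q (q + 1)) |c'| / W c]: the gradient has unit length. *)
Lemma is_derive_qd x c t : enorm x < 1 -> enorm (c t) < 1 -> derivable c t 1 ->
  exists2 d, is_derive t 1 (fun s => qd x (c s)) d &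
    d ^+ 2 <= qd x (c t) * (1 + qd x (c t)) *
      (2 * (enorm (derive1 c t) / (1 - enorm (c t) ^+ 2))) ^+ 2.
Proof.
rewrite -!W_gt0 => Wx Wc dc.
have dci i := is_derive_coord i dc.
have dcx i : is_derive t 1 (fun s => (x - c s) 0 i) ((- derive1 c t) 0 i).
  have -> : (fun s => (x - c s) 0 i) = (fun s => x 0 i - c s 0 i).
    by apply/funext => s; rewrite !mxE.
  rewrite mxE -sub0r; exact: is_der_sub (is_der_cst _ _) (dci i).
set c' := derive1 c t in dci dcx *.
have hN : is_derive t 1 (fun s => dot (x - c s) (x - c s)) (- 2 * dot (x - c t) c').
  apply: (is_derive_eq (is_derive_dot dcx dcx)).
  by rewrite !dotE (dotC c' x) (dotC c' (c t)); ring.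
have hW : is_derive t 1 (fun s => W x * (1 - dot (c s) (c s))) (W x * (- 2 * dot (c t) c')).
  apply: (is_derive_eq (is_der_mul (is_der_cst t (W x))
    (is_der_sub (is_der_cst t 1) (is_derive_dot dci dci)))).
  by rewrite (dotC c' (c t)); ring.
have Wct : W (c t) = 1 - dot (c t) (c t) by rewrite /W sqr_enorm.
have nz : W x * (1 - dot (c t) (c t)) != 0 by rewrite -Wct mulf_neq0 ?gt_eqF.
have := is_der_mul hN (@is_der_inv _ (fun s => W x * (1 - dot (c s) (c s))) _ _ nz hW).
rewrite (_ : (fun s => qd x (c s)) = (fun s => dot (x - c s) (x - c s) *
    (W x * (1 - dot (c s) (c s)))^-1)); last first.
  by apply/funext => s; rewrite /qd [W (c s)]/W !sqr_enorm.
set d := (X in is_derive t 1 _ X) => hd; exists d => //.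
pose v := W (c t) *: (x - c t) - dot (x - c t) (x - c t) *: c t.
have -> : d = - 2 * dot v c' / (W x * W (c t) ^+ 2).
  by rewrite /d /v /= -!Wct !(dotBl (W (c t) *: _)) !dotZl; field; rewrite !gt_eqF.
have vv : dot v v = dot (x - c t) (x - c t) *
    (W x * W (c t) + dot (x - c t) (x - c t)).
  rewrite /v Wct /W sqr_enorm !dotE (dotC (c t) x); ring.
have Q : qd x (c t) = dot (x - c t) (x - c t) / (W x * W (c t)).
  by rewrite /qd sqr_enorm.
have -> : 1 - enorm (c t) ^+ 2 = W (c t) by [].
rewrite Q [X in _ <= X](_ : _ = 4 * (dot v v * dot c' c') / (W x * W (c t) ^+ 2) ^+ 2).
  have -> : (- 2 * dot v c' / (W x * W (c t) ^+ 2)) ^+ 2 =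
      4 * dot v c' ^+ 2 / (W x * W (c t) ^+ 2) ^+ 2.
    by field; rewrite !gt_eqF.
  rewrite ler_pM2r; last by rewrite invr_gt0 exprn_gt0 // mulr_gt0 // exprn_gt0.
  by rewrite ler_pM2l // sqr_dot_le.
rewrite vv -(sqr_enorm c'); field; by rewrite !gt_eqF.
Qed.

(** A path cannot move away from [x] faster than its hyperbolic speed. *)
Lemma path_bound x c : enorm x < 1 -> (forall t, derivable c t 1) ->
  continuous (derive1 c) -> (forall t, 0 <= t <= 1 -> enorm (c t) < 1) ->
  ell (1 + 2 * qd x (c 1)) - ell (1 + 2 * qd x (c 0)) <= 2 * path_length c.
Proof.
move=> x1 dc cc' c1.
have Wx : 0 < W x by rewrite W_gt0.
have q0 t : 0 <= t <= 1 -> 0 <= qd x (c t) by move=> t01; rewrite qd_ge0 // c1.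
have qc t : 0 <= t <= 1 -> 1 <= 1 + 2 * qd x (c t).
  by move=> t01; rewrite lerDl mulr_ge0 // q0.
have aux (F q e : R) : q * (1 + q) * (2 * F) ^+ 2 <= F ^+ 2 * ((1 + 2 * q) ^+ 2 - 1 + e ^+ 2).
  by have := mulr_ge0 (sqr_ge0 F) (sqr_ge0 e); lra.
have t0 : 0 <= (0 : R) <= 1 by rewrite lexx ler01.
have t1 : 0 <= (1 : R) <= 1 by rewrite lexx ler01.
suff main (e : R) : 0 < e -> ell (1 + 2 * qd x (c 1)) <=
    ell (1 + 2 * qd x (c 0)) + 2 * path_length c + e.
  suff : ell (1 + 2 * qd x (c 1)) <= ell (1 + 2 * qd x (c 0)) + 2 * path_length c by lra.
  by apply/ler_addgt0Pr => e e0; exact: main.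
move=> e0.
pose u t := 1 + 2 * qd x (c t).
pose r t := Num.sqrt (u t ^+ 2 - 1 + e ^+ 2).
pose phi t := 2^-1 * ln (u t + r t).
pose f t := enorm (derive1 c t) / (1 - enorm (c t) ^+ 2).
suff : phi 1 - phi 0 <= path_length c.
  have /andP[h1 _] := ell_reg (qc 1 t1) e0; have /andP[_ h2] := ell_reg (qc 0 t0) e0.
  by move: h1 h2; rewrite /phi /r /u => h1 h2 h3; lra.
have dq t : 0 <= t <= 1 -> exists d, is_derive t 1 phi d /\ d <= f t.
  move=> t01; have [d hd dle] := is_derive_qd x1 (c1 t t01) (dc t).
  have u1 := qc t t01; have Q0 := q0 t t01; have f0 : 0 <= f t.
    by rewrite divr_ge0 ?enorm_ge0 // -/(W (c t)) W_ge0 ltW ?c1.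
  have e2 : 0 < e ^+ 2 by rewrite exprn_gt0.
  have S0 : 0 < u t ^+ 2 - 1 + e ^+ 2.
    by rewrite ltr_wpDl // subr_ge0 expr_ge1 // (le_trans ler01).
  have hu : is_derive t 1 u (2 * d).
    apply: (is_derive_eq (is_der_add (is_der_cst t 1) (is_der_mul (is_der_cst t 2) hd))).
    by ring.
  have hr : is_derive t 1 (fun s => u s ^+ 2 - 1 + e ^+ 2) (4 * u t * d).
    apply: (is_derive_eq (is_der_add (is_der_sub (is_der_mul hu hu) (is_der_cst t 1))
      (is_der_cst t (e ^+ 2)))).
    by ring.
  have hs : is_derive t 1 r ((2 * r t)^-1 * (4 * u t * d)).
    exact: (@is_der_comp _ Num.sqrt _ t _ _ (is_derive1_sqrt S0) hr).
  have s0 : 0 < r t by rewrite sqrtr_gt0.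
  have L0 : 0 < u t + r t by rewrite ltr_wpDl // (le_trans ler01).
  have hl := @is_der_comp _ (@ln R) (fun s => u s + r s) t _ _
    (is_derive1_ln L0) (is_der_add hu hs).
  exists (d / r t); split.
    apply: (is_derive_eq (is_der_mul (is_der_cst t 2^-1) hl)).
    by field; rewrite !gt_eqF.
  rewrite ler_pdivrMr // (le_trans (ler_norm _)) //.
  rewrite -(@ler_pXn2r _ 2) ?nnegrE ?normr_ge0 // ?(mulr_ge0 f0 (ltW s0)) //.
  have r2 : r t ^+ 2 = u t ^+ 2 - 1 + e ^+ 2 by rewrite sqr_sqrtr // ltW.
  rewrite real_normK ?num_real //; apply: le_trans dle _.
  rewrite -/(f t) [in leRHS]exprMn r2 /u; exact: aux.
pose dphi t := derive1 phi t.
apply: (@integral_bound R phi dphi f).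
- move=> t t01; have [d [hd _]] := dq t t01.
  by rewrite /dphi derive1E (@derive_val _ _ _ _ _ _ _ hd).
- move=> t t01; have := c1 t t01; rewrite -W_gt0 => Wc.
  have ccx : enorm (c s) @[s --> t] --> enorm (c t).
    have cct : {for t, continuous c}.
      by apply: differentiable_continuous; apply/derivable1_diffP; exact: dc.
    exact: (@cvg_comp _ _ _ c enorm _ (nbhs (c t)) _ cct (@enorm_continuous (c t))).
  apply: cvgM.
    exact: (@cvg_comp _ _ _ (derive1 c) enorm _ (nbhs (derive1 c t)) _ (cc' t)
      (@enorm_continuous _)).
  apply: cvgV; first by rewrite gt_eqF.
  by apply: cvgB; [exact: cvg_cst|exact: (cvgM ccx ccx)].
- move=> t t01; have [d [hd dle]] := dq t t01.
  by rewrite /dphi derive1E (@derive_val _ _ _ _ _ _ _ hd).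
Qed.

(** On the hyperboloid [T^2 - |S|^2 = 1] the geodesics are the curves
    [p (a, P) + p^-1 (b, Q)], [p = e^(D t)], with [(a, P)] and [(b, Q)] on the
    light cone; here is their image in the ball, [c = S / (1 + T)]. *)
Definition geo (a b : V) (P Q D : R) t : V :=
  (expR (D * t) / (1 + (P * expR (D * t) + Q * expR (- (D * t))))) *: a +
  (expR (- (D * t)) / (1 + (P * expR (D * t) + Q * expR (- (D * t))))) *: b.

Lemma geo_path (a b : V) (P Q D : R) : 0 < P -> 0 < Q -> 0 <= D ->
  dot a a = P ^+ 2 -> dot b b = Q ^+ 2 -> dot a b = P * Q - 2^-1 ->
  [/\ forall t, derivable (geo a b P Q D) t 1,
      continuous (derive1 (geo a b P Q D)),
      forall t, enorm (geo a b P Q D t) < 1 &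
      forall t, enorm (derive1 (geo a b P Q D) t) /
        (1 - enorm (geo a b P Q D t) ^+ 2) = D / 2].
Proof.
move=> P0 Q0 D0 aa bb ab; set c := geo a b P Q D.
pose p t := expR (D * t); pose r t := expR (- (D * t)).
pose T t := P * p t + Q * r t.
have p0 t : 0 < p t by exact: expR_gt0.
have rE t : r t = (p t)^-1 by rewrite /r expRN.
have pr t : p t * r t = 1 by rewrite rE divff // gt_eqF.
have r0 t : 0 < r t by exact: expR_gt0.
have T0 t : 0 < 1 + T t by rewrite /T addr_gt0 // addr_gt0 // mulr_gt0.
pose al t := p t / (1 + T t); pose be t := r t / (1 + T t).
have cE t : c t = al t *: a + be t *: b by [].
have dlin t : is_derive t 1 (fun s => D * s) D.
  apply: (is_derive_eq (is_der_mul (is_der_cst t D) (is_derive_id t 1))); ring.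
have dp t : is_derive t 1 p (D * p t).
  apply: (is_derive_eq (@is_der_comp _ (@expR R) (fun s => D * s) t _ _
    (is_derive_expR _) (dlin t))).
  by rewrite mulrC.
have dr t : is_derive t 1 r (- D * r t).
  rewrite (_ : r = fun s => (p s)^-1); last by apply/funext.
  apply: (is_derive_eq (is_der_inv (lt0r_neq0 (p0 t)) (dp t))).
  by field; rewrite gt_eqF.
have dT t : is_derive t 1 (fun s => 1 + T s) (D * (P * p t - Q * r t)).
  apply: (is_derive_eq (is_der_add (is_der_cst t 1) (is_der_add
   (is_der_mul (is_der_cst t P) (dp t)) (is_der_mul (is_der_cst t Q) (dr t))))).
  by ring.
pose al' t := D * (p t + 2 * Q) / (1 + T t) ^+ 2.
pose be' t := - D * (r t + 2 * P) / (1 + T t) ^+ 2.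
have dal t : is_derive t 1 al (al' t).
  apply: (is_derive_eq (is_der_mul (dp t)
    (@is_der_inv _ (fun s => 1 + T s) t _ (lt0r_neq0 (T0 t)) (dT t)))).
  rewrite /al' (_ : p t + 2 * Q = p t + 2 * Q * (p t * r t)); last by rewrite pr mulr1.
  have := lt0r_neq0 (T0 t); rewrite /T => h.
  by field.
have dbe t : is_derive t 1 be (be' t).
  apply: (is_derive_eq (is_der_mul (dr t)
    (@is_der_inv _ (fun s => 1 + T s) t _ (lt0r_neq0 (T0 t)) (dT t)))).
  rewrite /be' (_ : r t + 2 * P = r t + 2 * P * (p t * r t)); last by rewrite pr mulr1.
  have := lt0r_neq0 (T0 t); rewrite /T => h.
  by field.
have abE (x y : R) : enorm (x *: a + y *: b) ^+ 2 = (x * P + y * Q) ^+ 2 - x * y.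
  by rewrite sqr_enorm !dotE (dotC b a) aa bb ab; field.
have Wc t : 1 - enorm (c t) ^+ 2 = 2 / (1 + T t).
  rewrite cE abE.
  have -> : (al t * P + be t * Q) ^+ 2 - al t * be t = (T t ^+ 2 - p t * r t) / (1 + T t) ^+ 2.
    by have := lt0r_neq0 (T0 t); rewrite /al /be /T => h; field.
  by rewrite pr; field; exact: lt0r_neq0 (T0 t).
have dc t i j : is_derive t 1 (fun s => c s i j) (al' t * a i j + be' t * b i j).
  have -> : (fun s => c s i j) = (fun s => al s * a i j + be s * b i j).
    by apply/funext => s; rewrite cE !mxE.
  apply: (is_derive_eq (is_der_add (is_der_mul (dal t) (is_der_cst t _))
   (is_der_mul (dbe t) (is_der_cst t _)))).
  by ring.
have dv t : derivable c t 1.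
  by apply/derivable_mxP => i j; case: (dc t i j).
have c'E t : derive1 c t = al' t *: a + be' t *: b.
  rewrite derive1E derive_mx //; apply/matrixP => i j; rewrite !mxE.
  by case: (dc t i j).
split.
- exact: dv.
- have -> : derive1 c = (fun t => al' t *: a + be' t *: b) by apply/funext.
  have cT t : (1 + T s) ^-2 @[s --> t] --> (1 + T t) ^- 2.
    have cT := is_der_continuous (dT t).
    by apply: cvgV; [rewrite sqrf_eq0 lt0r_neq0|exact: (cvgM cT cT)].
  move=> t; apply: cvgD; apply: cvgZr_tmp; apply: cvgM (cT t); apply: cvgMr.
  + by apply: cvgD; [exact: is_der_continuous (dp t)|exact: cvg_cst].
  by apply: cvgD; [exact: is_der_continuous (dr t)|exact: cvg_cst].
- move=> t; rewrite -W_gt0 /W Wc divr_gt0 //.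
move=> t; rewrite Wc c'E.
have -> : enorm (al' t *: a + be' t *: b) = D / (1 + T t).
  apply/eqP; rewrite -(@eqrXn2 _ 2) ?enorm_ge0 ?divr_ge0 // ?(ltW (T0 t)) //.
  rewrite abE.
  have -> : (al' t * P + be' t * Q) ^+ 2 - al' t * be' t =
      D ^+ 2 * ((1 + T t) ^+ 2 + (p t * r t - 1) * (1 - 4 * P * Q)) / (1 + T t) ^+ 4.
    by have := lt0r_neq0 (T0 t); rewrite /al' /be' /T => h; field.
  by rewrite pr; apply/eqP; field; exact: lt0r_neq0 (T0 t).
by field; exact: lt0r_neq0 (T0 t).
Qed.

(** In the plane spanned by the hyperboloid lifts [Xs, X0] and [Ys, Y0] of [x] and [y],
    [a, P] and [b, Q] are the components on the two null directions. *)
Lemma geo_exists x y : enorm x < 1 -> enorm y < 1 ->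
  exists c, [/\ forall t, derivable c t 1, continuous (derive1 c),
    forall t, enorm (c t) < 1, c 0 = x /\ c 1 = y &
    forall t, enorm (derive1 c t) / (1 - enorm (c t) ^+ 2) =
      ell (1 + 2 * qd x y) / 2].
Proof.
move=> x1 y1; have Wx : 0 < W x by rewrite W_gt0.
have Wy : 0 < W y by rewrite W_gt0.
have [<-|xy] := eqVneq x y.
  exists (fun=> x); split=> //.
  - by rewrite (_ : derive1 _ = fun=> 0); [exact: cst_continuous|exact/funext/derive1_cst].
  move=> t; rewrite derive1_cst enorm0 mul0r /qd subrr enorm0 expr0n mul0r mulr0 addr0.
  by rewrite /ell expr1n subrr sqrtr0 addr0 ln1 mul0r.
set u := 1 + 2 * qd x y.
have u1 : 1 < u.
  rewrite /u ltrDl mulr_gt0 // /qd divr_gt0 //; last exact: mulr_gt0.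
  by rewrite exprn_gt0 // enorm_sub_gt0.
have u1' := ltW u1.
pose E := expR (ell u); have E1 : 1 < E.
  by have /andP[h _] := ell_bounds u1'; exact: lt_le_trans u1 h.
have E0 : E != 0 by rewrite gt_eqF // (lt_trans _ E1).
have EE : E + E^-1 = 2 * u by exact: ell_cosh.
pose F := E - E^-1.
have F0 : 0 < F by rewrite subr_gt0 (lt_trans _ E1) // invf_lt1 // (lt_trans _ E1).
pose X0 := (1 + enorm x ^+ 2) / W x; pose Y0 := (1 + enorm y ^+ 2) / W y.
pose Xs : V := (2 / W x) *: x; pose Ys : V := (2 / W y) *: y.
have XX : dot Xs Xs = X0 ^+ 2 - 1.
  by rewrite /Xs /X0 !dotE -sqr_enorm; move: (Wx); rewrite /W => h; field; rewrite gt_eqF.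
have YY : dot Ys Ys = Y0 ^+ 2 - 1.
  by rewrite /Ys /Y0 !dotE -sqr_enorm; move: (Wy); rewrite /W => h; field; rewrite gt_eqF.
have XY : dot Xs Ys = X0 * Y0 - u.
  rewrite /Xs /Ys /X0 /Y0 /u /qd sqr_enormB !dotE.
  by move: (Wx) (Wy); rewrite /W => h1 h2; field; rewrite !gt_eqF.
have XsE : Xs = (2 / W x) *: x by [].
have YsE : Ys = (2 / W y) *: y by [].
have X0E : X0 = (1 + enorm x ^+ 2) / W x by [].
have Y0E : Y0 = (1 + enorm y ^+ 2) / W y by [].
have X0p : 0 < X0 by rewrite divr_gt0 // ltr_wpDr ?sqr_ge0.
clearbody Xs Ys X0 Y0.
pose a := F^-1 *: (Ys - E^-1 *: Xs); pose b := F^-1 *: (E *: Xs - Ys).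
pose P := F^-1 * (Y0 - E^-1 * X0); pose Q := F^-1 * (E * X0 - Y0).
have uE : u = (E + E^-1) / 2 by rewrite EE; field.
have aa : dot a a = P ^+ 2.
  rewrite /a !dotE (dotC Ys Xs) XX YY XY uE /P; field.
  by rewrite E0 gt_eqF.
have bb : dot b b = Q ^+ 2.
  rewrite /b !dotE (dotC Ys Xs) XX YY XY uE /Q; field.
  by rewrite E0 gt_eqF.
have ab : dot a b = P * Q - 2^-1.
  have FF : u * (E + E^-1) - 2 = F * F / 2 by rewrite uE /F; field; rewrite E0.
  have -> : dot a b = P * Q - F^-1 * F^-1 * (u * (E + E^-1) - 2).
    rewrite /a /b !dotE (dotC Ys Xs) XX YY XY /P /Q; field.
    by rewrite E0 gt_eqF.
  by rewrite FF; field; rewrite gt_eqF.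
have PQX : P + Q = X0.
  rewrite /P /Q -mulrDr (_ : Y0 - E^-1 * X0 + (E * X0 - Y0) = F * X0).
    by rewrite mulKf // gt_eqF.
  by rewrite /F; ring.
(* both [(a, P)] and [(b, Q)] are null vectors, of product [1/2], and their sum is the lift
   of [x]: so both point to the future *)
have PQ : 0 < P * Q.
  have h : dot a b ^+ 2 <= (P * Q) ^+ 2 by rewrite exprMn -aa -bb sqr_dot_le.
  rewrite ltNge; apply/negP => h0; move: h; rewrite ab; nra.
have P0 : 0 < P by nra.
have Q0 : 0 < Q by nra.
have [g1 g2 g3 g4] := geo_path P0 Q0 (ell_ge0 u1') aa bb ab.
have FE : F = E - E^-1 by [].
have FE0 : E - E^-1 != 0 by rewrite -FE gt_eqF.
exists (geo a b P Q (ell u)); split => //; split.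
- rewrite /geo mulr0 oppr0 expR0 !mulr1 PQX -scalerDr.
  have -> : a + b = Xs.
    rewrite -scalerDr addrC -addrA [- Ys + _]addrA addNr add0r -scaleNr -scalerDl.
    by rewrite scalerA -FE mulVf ?scale1r // gt_eqF.
  rewrite XsE X0E scalerA (_ : _ * _ = 1) ?scale1r //; move: (Wx); rewrite /W => h.
  by field; rewrite !gt_eqF //; have := sqr_ge0 (enorm x); lra.
rewrite /geo mulr1 expRN -/E.
have -> : P * E + Q * E^-1 = Y0.
  have -> : P * E + Q * E^-1 = F^-1 * ((E - E^-1) * Y0).
    by rewrite /P /Q; field; rewrite E0 gt_eqF.
  by rewrite -FE mulKf // gt_eqF.
rewrite (mulrC E) (mulrC E^-1) -!scalerA -scalerDr.
have -> : E *: a + E^-1 *: b = Ys.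
  rewrite /a /b !scalerA (mulrC E) (mulrC E^-1) -!scalerA -scalerDr !scalerBr !scalerA.
  rewrite mulfV // mulVf // scale1r addrA subrK -scalerBl.
  by rewrite scalerA -FE mulVf ?scale1r // gt_eqF.
rewrite YsE Y0E scalerA (_ : _ * _ = 1) ?scale1r //; move: (Wy); rewrite /W => h.
by field; rewrite !gt_eqF //; have := sqr_ge0 (enorm y); lra.
Qed.

Notation H := (hyp R n).
Implicit Types z w : H.

Lemma hval_lt1 z : enorm (hval z) < 1.
Proof. by rewrite /hval; case: z => v h; exact: set_mem h. Qed.
Hint Resolve hval_lt1 : core.

(** The distance formula: [cosh d = 1 + 2 q]. *)
Lemma hdistE z w : hdist z w = ell (1 + 2 * qd (hval z) (hval w)).
Proof.
set D := ell _; pose L := [set path_length c | c in C1_path z w].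
have [c [c1 c2 c3 [c4 c5] c6]] := geo_exists (hval_lt1 z) (hval_lt1 w).
have LD : L (D / 2).
  exists c; first by split; [exact: c1|exact: c2|move=> t _; exact: c3|exact: c4|exact: c5].
  rewrite /path_length (@eq_Rintegral _ _ _ _ _ (cst (D / 2))); last by move=> t _; exact: c6.
  rewrite Rintegral_cst //= lebesgue_measure_itv /= lte01 oppr0 adde0 /=.
  by rewrite mulr1.
have lb : lbound L (D / 2).
  move=> _ [e [e1 e2 e3 e4 e5] <-].
  have := path_bound (hval_lt1 z) e1 e2 e3; rewrite e4 e5 /qd subrr enorm0 expr0n mul0r mulr0 addr0.
  rewrite {2}/ell expr1n subrr sqrtr0 addr0 ln1 subr0 -/D ler_pdivrMr // mulrC //.
rewrite /hdist -/L (_ : inf L = D / 2); first by field.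
apply/eqP; rewrite eq_le ge_inf //=; last by exists (D / 2).
by apply: lb_le_inf => //; exists (D / 2).
Qed.

End Curve.

(** * Extension of isometries to the closed ball *)

Section Ext.
Context {R : realType} {n : nat}.
Notation V := 'rV[R]_n.+1.
Notation H := (hyp R n).
Implicit Types (x y : V) (z w : H) (g h : H -> H).

Definition mkh x (h : enorm x < 1) : H := exist _ x (mem_set h).

Lemma hval_mkh x (h : enorm x < 1) : hval (mkh h) = x. Proof. by []. Qed.

Lemma hval0 : hval (origin : H) = 0. Proof. by []. Qed.

Lemma hval_inj : injective (@hval R n).
Proof. by move=> z w; exact: val_inj. Qed.

Lemma iso_qd g z w : is_isometry g ->
  qd (hval (g z)) (hval (g w)) = qd (hval z) (hval w).
Proof.
case=> ig _; have := ig z w; rewrite !hdistE => /ell_inj e.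
have q0 (u v : H) : 1 <= 1 + 2 * qd (hval u) (hval v) :> R.
  by rewrite lerDl mulr_ge0 // qd_ge0 // hval_lt1.
by have := e (q0 _ _) (q0 _ _); lra.
Qed.

(** The identity outside the closed ball, so that composition of isometries corresponds to
    composition of maps of the whole space. *)
Definition ext g x : V :=
  match pselect (enorm x < 1) with
  | left h => hval (g (mkh h))
  | right _ => if enorm x == 1 then bext g x else x
  end.

Lemma ext_in g z : ext g (hval z) = hval (g z).
Proof.
rewrite /ext; case: pselect => [h|]; last by have := hval_lt1 z.
by congr (hval (g _)); exact: hval_inj.
Qed.

Lemma ext_sphere g x : enorm x = 1 -> ext g x = bext g x.
Proof.
by rewrite /ext => x1; case: pselect => [h|_]; [exfalso; move: h; rewrite x1 ltxx|rewrite x1 eqxx].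
Qed.

Lemma ext_out g x : 1 < enorm x -> ext g x = x.
Proof.
move=> x1; rewrite /ext; case: pselect => [h|_]; first by have := lt_trans x1 h; rewrite ltxx.
by rewrite gt_eqF.
Qed.

Lemma ext0 g : ext g 0 = hval (g origin). Proof. by rewrite -hval0 ext_in. Qed.

Section Isometry.
Variables (g : H -> H) (ig : is_isometry g).
Let f := ext g.

Let W_pos z : 0 < W (hval z). Proof. by rewrite W_gt0 hval_lt1. Qed.

(** The formula for the derivative expresses that the distances to the image of [0] are
    preserved. *)
Lemma conf_in x y : enorm x < 1 -> enorm y < 1 ->
  W (f x) = jac f x * W x /\
  enorm (f x - f y) ^+ 2 = jac f x * jac f y * enorm (x - y) ^+ 2.
Proof.
move: x y; have key z : W (f (hval z)) = jac f (hval z) * W (hval z).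
  have := iso_qd z origin ig; rewrite hval0 => q.
  have := qd0 (hval_lt1 z); rewrite -q /qd /jac /f ext_in ext0.
  move: (W_pos z) (W_pos (g z)) (W_pos (g origin)).
  move: (W (hval z)) (W (hval (g z))) (W (hval (g origin))) => a b c0 a0 b0 c1 e.
  have e' : enorm (hval (g z) - hval (g origin)) ^+ 2 / c0 = b * (a^-1 - 1).
    by rewrite -e; field; rewrite !gt_eqF.
  by rewrite e'; field; rewrite gt_eqF.
move=> x y x1 y1; rewrite -(hval_mkh x1) -(hval_mkh y1).
move: (mkh x1) (mkh y1) => z w {x y x1 y1}; split; first exact: key.
have := iso_qd z w ig; rewrite /qd /f !ext_in => q.
have -> : enorm (hval (g z) - hval (g w)) ^+ 2 =
    enorm (hval z - hval w) ^+ 2 / (W (hval z) * W (hval w)) * (W (hval (g z)) * W (hval (g w))).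
  by rewrite -q; field; rewrite !gt_eqF.
have := key z; have := key w; rewrite /f !ext_in => -> ->.
by field; rewrite !gt_eqF.
Qed.

Let K := 1 + 4 / W (f 0).

Let K0 : 0 < K.
Proof.
have : 0 < W (f 0) by rewrite /f ext0.
by move=> h; rewrite addr_gt0 // divr_gt0.
Qed.

(** The derivative is bounded, hence the limits defining the extension exist. *)
Lemma lip_in x y : enorm x < 1 -> enorm y < 1 -> enorm (f x - f y) <= K * enorm (x - y).
Proof.
move=> x1 y1; have [_ e] := conf_in x1 y1.
have jK u : enorm u < 1 -> 0 <= jac f u <= K.
  move=> u1; rewrite -(hval_mkh u1); move: (mkh u1) => z; rewrite /jac /K /f ext_in ext0.
  have g1 := hval_lt1 (g z); have g2 := hval_lt1 (g origin).
  have gW := W_pos (g origin); have gZ := W_pos (g z).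
  rewrite addr_ge0 ?divr_ge0 ?sqr_ge0 ?(ltW gW) ?(ltW gZ) //=.
  apply: lerD; first exact: W_le1.
  rewrite ler_pM2r ?invr_gt0 // (_ : 4 = 2 ^+ 2); last by ring.
  rewrite ler_pXn2r ?nnegrE ?enorm_ge0 //.
  have := enormD (hval (g z)) (- hval (g origin)); rewrite enormN; lra.
have /andP[j1 j2] := jK x x1; have /andP[j3 j4] := jK y y1.
rewrite -(@ler_pXn2r _ 2) ?nnegrE ?enorm_ge0 ?mulr_ge0 ?enorm_ge0 ?(ltW K0) // e exprMn.
by apply: ler_wpM2r; rewrite ?sqr_ge0 // expr2 ler_pM.
Qed.

Lemma near_hyp x : enorm x <= 1 -> forall d, 0 < d -> exists w, enorm (x - hval w) < d.
Proof.
move=> x1 d d0; pose s := Num.min (2^-1) (d / 2).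
have s0 : 0 < s by rewrite lt_min invr_gt0 ltr0n divr_gt0.
have s1 : s <= 2^-1 by rewrite ge_min lexx.
have s2 : s <= d / 2 by rewrite ge_min lexx orbT.
have e0 := enorm_ge0 x.
have h : enorm ((1 - s) *: x) < 1.
  rewrite enormZ ger0_norm; last by lra.
  have := mulr_ge0 (ltW s0) e0; nra.
exists (mkh h); rewrite hval_mkh scalerBl scale1r opprB addrC subrK enormZ gtr0_norm //.
nra.
Qed.

Lemma bext_cvg x : enorm x = 1 -> forall e, 0 < e -> exists2 d, 0 < d &
  forall w, enorm (x - hval w) < d -> enorm (f x - f (hval w)) < e.
Proof.
move=> x1 e e0; have x1' : enorm x <= 1 by rewrite x1.
pose F := filter_from (nbhs x) (preimage (@hval R n)).
have FF : ProperFilter F.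
  apply: filter_from_proper.
    apply: filter_from_filter; first by exists setT; exact: filterT.
    move=> A B nA nB; exists (A `&` B); first exact: filterI.
    by move=> z [].
  move=> A /nbhs_enormP[d d0 dA].
  have [w hw] := near_hyp x1' d0.
  by exists w; exact: dA.
have cv : hval (g z) @[z --> F] --> bext g x.
  apply: cauchy_cvg; apply: cauchy_exP => eps eps0.
  have d0 : 0 < eps / (2 * K) by rewrite divr_gt0 // mulr_gt0.
  have [w0 hw0] := near_hyp x1' d0.
  exists (hval (g w0)); exists [set y | enorm (x - y) < eps / (2 * K)].
    by apply/nbhs_enormP; exists (eps / (2 * K)).
  move=> w /= hw; rewrite -ball_normE /=; apply: le_lt_trans (le_mxnorm_enorm _) _.
  have := lip_in (hval_lt1 w0) (hval_lt1 w); rewrite /f !ext_in => h.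
  apply: le_lt_trans h _; rewrite -ltr_pdivlMl //.
  have := enorm_tri (hval w0) x (hval w); rewrite (enormC (hval w0) x).
  have -> : K^-1 * eps = eps / (2 * K) + eps / (2 * K) by field; rewrite gt_eqF.
  by move: hw hw0; move: (eps / (2 * K)) => q; lra.
have /(_ _ e e0) [A /nbhs_enormP[d d0 dA] AF] := (cvg_enormP _ _).1 cv.
exists d => // w hw; rewrite enormC {2}/f ext_sphere // /f ext_in; exact: (AF w (dA _ hw)).
Qed.

Lemma ext_approx x : enorm x <= 1 -> forall e, 0 < e -> exists2 d, 0 < d &
  forall w, enorm (x - hval w) < d -> enorm (f x - f (hval w)) < e.
Proof.
rewrite le_eqVlt => /orP[/eqP|] x1; first exact: bext_cvg.
move=> e e0; exists (e / K); first by rewrite divr_gt0.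
move=> w hw; apply: le_lt_trans (lip_in x1 (hval_lt1 w)) _.
by rewrite -ltr_pdivlMl // mulrC.
Qed.

Lemma ext_lip x y : enorm x <= 1 -> enorm y <= 1 -> enorm (f x - f y) <= K * enorm (x - y).
Proof.
move=> x1 y1; apply/ler_addgt0Pr => e e0.
pose r := e / (2 * (1 + K)).
have r0 : 0 < r by rewrite divr_gt0 // mulr_gt0 // addr_gt0.
have [d d0 hd] := ext_approx x1 r0; have [d' d0' hd'] := ext_approx y1 r0.
have m0 : 0 < Num.min d r by rewrite lt_min d0.
have m0' : 0 < Num.min d' r by rewrite lt_min d0'.
have [w hw] := near_hyp x1 m0; have [w' hw'] := near_hyp y1 m0'.
move: hw hw'; rewrite !lt_min => /andP[hw1 hw2] /andP[hw1' hw2'].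
have := hd _ hw1; have := hd' _ hw1' => h1 h2.
have h3 := lip_in (hval_lt1 w) (hval_lt1 w').
have h4 := enorm_tri (f x) (f (hval w)) (f y).
have h5 := enorm_tri (f (hval w)) (f (hval w')) (f y).
have h6 := enorm_tri (hval w) x (hval w').
have h7 := enorm_tri x y (hval w').
rewrite (enormC (f (hval w')) (f y)) in h5; rewrite (enormC (hval w) x) in h6.
have -> : e = 2 * r + K * (2 * r) by rewrite /r; field; rewrite gt_eqF // addr_gt0.
have : K * enorm (hval w - hval w') <= K * (enorm (x - y) + 2 * r).
  by apply: ler_wpM2l; [exact: ltW|lra].
rewrite mulrDr; lra.
Qed.

(** Identities extend to the sphere by continuity along this sequence. *)
Definition rad k x : V := (1 - k.+1%:R^-1) *: x.

Lemma rad_lt1 k x : enorm x <= 1 -> enorm (rad k x) < 1.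
Proof.
move=> x1; have k0 : 0 < k.+1%:R^-1 :> R by rewrite invr_gt0.
have k1 : k.+1%:R^-1 <= 1 :> R by rewrite invf_le1 // ler1n.
rewrite enormZ ger0_norm ?subr_ge0 //; have := enorm_ge0 x.
by move: k.+1%:R^-1 k0 k1 => q q0 q1; nra.
Qed.

Lemma rad_near x : enorm x <= 1 -> forall e, 0 < e -> \forall k \near \oo, enorm (rad k x - x) < e.
Proof.
move=> x1 e e0; have := near_infty_natSinv_lt (PosNum e0).
apply: filterS => k /= hk; rewrite /rad scalerBl scale1r addrAC subrr sub0r enormN enormZ.
rewrite gtr0_norm ?invr_gt0 //; apply: le_lt_trans hk.
by rewrite ler_piMr // invr_ge0.
Qed.

Lemma cvg_rad x : enorm x <= 1 -> rad k x @[k --> \oo] --> x.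
Proof. by move=> x1; apply/cvg_enormP; exact: rad_near. Qed.

Lemma cvg_ext x : enorm x <= 1 -> f (rad k x) @[k --> \oo] --> f x.
Proof.
move=> x1; apply/cvg_enormP => e e0.
have d0 : 0 < e / K by rewrite divr_gt0.
apply: filterS (rad_near x1 d0) => k hk.
apply: le_lt_trans (ext_lip (ltW (rad_lt1 k x1)) x1) _.
by rewrite -ltr_pdivlMl // mulrC.
Qed.

Lemma cvg_enorm (u : nat -> V) x : u k @[k --> \oo] --> x -> enorm (u k) @[k --> \oo] --> enorm x.
Proof. by move=> h; apply: (@cvg_comp _ _ _ u enorm _ (nbhs x) _ h); exact: enorm_continuous. Qed.

Lemma cvg_sqr_enorm (u : nat -> V) x : u k @[k --> \oo] --> x ->
  enorm (u k) ^+ 2 @[k --> \oo] --> enorm x ^+ 2.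
Proof. by move=> /cvg_enorm h; exact: (cvgM h h). Qed.

Lemma cvg_W (u : nat -> V) x : u k @[k --> \oo] --> x -> W (u k) @[k --> \oo] --> W x.
Proof. by move=> h; apply: cvgB; [exact: cvg_cst|exact: cvg_sqr_enorm]. Qed.

Lemma cvg_jac x : enorm x <= 1 -> jac f (rad k x) @[k --> \oo] --> jac f x.
Proof.
move=> x1; have h := cvg_ext x1; apply: cvgD; first exact: cvg_W.
apply: cvgMl; apply: cvg_sqr_enorm; apply: cvgB h _; exact: cvg_cst.
Qed.

Lemma ext_le1 x : enorm x <= 1 -> enorm (f x) <= 1.
Proof.
move=> x1; have h := cvg_W (cvg_ext x1).
rewrite -W_ge0 -(cvg_lim _ h) //; apply: limr_ge; first by apply/cvg_ex; exists (W (f x)).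
apply: nearW => k; have xk := rad_lt1 k x1.
by rewrite W_ge0 -(hval_mkh xk) /f ext_in ltW // hval_lt1.
Qed.

Lemma conf_ext : conf f.
Proof.
move=> x x1.
have lt1 k y : enorm y <= 1 -> enorm (rad k y) < 1 by move=> y1; exact: rad_lt1.
have eW : W (f x) = jac f x * W x.
  have h : W (f (rad k x)) @[k --> \oo] --> W (f x) by exact: cvg_W (cvg_ext x1).
  have h' : jac f (rad k x) * W (rad k x) @[k --> \oo] --> jac f x * W x.
    exact: cvgM (cvg_jac x1) (cvg_W (cvg_rad x1)).
  have E : (fun k => W (f (rad k x))) = (fun k => jac f (rad k x) * W (rad k x)).
    by apply/funext => k; have [] := conf_in (lt1 k _ x1) (lt1 k _ x1).
  by rewrite E in h; exact: (cvg_unique _ h h').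
split=> //.
  have f1 := ext_le1 x1; have f01 : 0 < W (f 0) by rewrite /f ext0.
  have [fx1|fx1] := ltrP (enorm (f x)) 1.
    by rewrite /jac ltr_pwDl // ?W_gt0 // divr_ge0 ?sqr_ge0 // ltW.
  rewrite /jac ltr_wpDl ?W_ge0 // divr_gt0 // exprn_gt0 // enorm_sub_gt0.
  by apply: contraTneq fx1 => ->; rewrite -ltNge -W_gt0.
move=> y y1.
have h : enorm (f (rad k x) - f (rad k y)) ^+ 2 @[k --> \oo] --> enorm (f x - f y) ^+ 2.
  by apply: cvg_sqr_enorm; exact: cvgB (cvg_ext x1) (cvg_ext y1).
have h' : jac f (rad k x) * jac f (rad k y) * enorm (rad k x - rad k y) ^+ 2
    @[k --> \oo] --> jac f x * jac f y * enorm (x - y) ^+ 2.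
  apply: cvgM; first exact: cvgM (cvg_jac x1) (cvg_jac y1).
  by apply: cvg_sqr_enorm; exact: cvgB (cvg_rad x1) (cvg_rad y1).
have E : (fun k => enorm (f (rad k x) - f (rad k y)) ^+ 2) = (fun k =>
  jac f (rad k x) * jac f (rad k y) * enorm (rad k x - rad k y) ^+ 2).
  by apply/funext => k; have [] := conf_in (lt1 k _ x1) (lt1 k _ y1).
by rewrite E in h; exact: (cvg_unique _ h h').
Qed.

End Isometry.

Lemma iso_comp g h : is_isometry g -> is_isometry h -> is_isometry (g \o h).
Proof. by move=> [g1 g2] [h1 h2]; split; [move=> x y /=; rewrite g1 h1|exact: bij_comp]. Qed.

Lemma ext_id : ext id = id.
Proof.
have iid : is_isometry (@id H) by split=> //; exists id.
apply/funext => x; have [x1|x1] := ltrP 1 (enorm x); first exact: ext_out.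
have h1 := cvg_ext iid x1; have h2 := cvg_rad x1.
have E : (fun k => ext id (rad k x)) = (fun k => rad k x).
  by apply/funext => k; rewrite -[in LHS](hval_mkh (rad_lt1 k x1)) ext_in.
by rewrite E in h1; exact: (cvg_unique _ h1 h2).
Qed.

Lemma ext_comp g h : is_isometry g -> is_isometry h -> ext (g \o h) = ext g \o ext h.
Proof.
move=> ig ih; have igh := iso_comp ig ih.
apply/funext => x /=; have [x1|x1] := ltrP 1 (enorm x); first by rewrite !ext_out.
have h1 := cvg_ext igh x1.
have hx1 := ext_le1 ih x1.
suff h0 : ext (g \o h) (rad k x) @[k --> \oo] --> ext g (ext h x).
  exact: (cvg_unique _ h1 h0).
apply/cvg_enormP => e e0.
pose K := 1 + 4 / W (ext g 0).
have K0 : 0 < K by rewrite addr_gt0 // divr_gt0 // ext0 W_gt0 hval_lt1.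
have d0 : 0 < e / K by rewrite divr_gt0.
have h2 : \forall k \near \oo, enorm (ext h (rad k x) - ext h x) < e / K.
  exact: ((cvg_enormP _ _).1 (cvg_ext ih x1) _ d0).
apply: filterS h2 => k hk; have xk := rad_lt1 k x1.
have -> : ext (g \o h) (rad k x) = ext g (ext h (rad k x)) by rewrite -(hval_mkh xk) !ext_in.
apply: le_lt_trans (ext_lip ig (ext_le1 ih (ltW xk)) hx1) _.
by rewrite -ltr_pdivlMl // mulrC.
Qed.

Lemma ext_inj g h : is_isometry g -> is_isometry h ->
  (forall x, enorm x <= 1 -> ext g x = ext h x) -> g = h.
Proof.
move=> ig ih e; apply/funext => z; apply: hval_inj; rewrite -!ext_in; apply: e.
exact/ltW/hval_lt1.
Qed.

End Ext.

(** * Discreteness *)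

Section Discrete.
Context {R : realType} {n : nat}.
Notation V := 'rV[R]_n.+1.
Notation H := (hyp R n).
Implicit Types (x y : V) (z w : H) (g h : H -> H) (G : set (H -> H)).

Lemma nbhs_hyp z e : 0 < e -> nbhs z [set w | enorm (hval z - hval w) < e].
Proof.
move=> e0.
have c : {for z, continuous (set_val : set_type (@unit_ball R n) -> V)}.
  exact: initial_continuous.
have /c : nbhs (hval z) [set y | enorm (hval z - y) < e] by apply/nbhs_enormP; exists e.
by [].
Qed.

Lemma open_hyp (O : set H) z : open O -> O z -> exists2 e : R, 0 < e &
  forall w, enorm (hval z - hval w) < e -> O w.
Proof.
case=> B oB <- Bz; have /nbhs_enormP[e e0 h] : nbhs (hval z) B by exact: open_nbhs_nbhs.
by exists e => // w /h.
Qed.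

(** By compactness of [K], a map close enough to the identity sends [K] into a given
    neighbourhood [O] of [K]. *)
Lemma uniform_compact_open (h : nat -> H -> H) :
  (forall k z, enorm (hval (h k z) - hval z) < k.+1%:R^-1) ->
  forall A : set {compact-open, H -> H}, nbhs (id : {compact-open, H -> H}) A ->
  \forall k \near \oo, A (h k).
Proof.
move=> hk; apply/(@compact_open_cvgP H H (h k @[k --> \oo]) id _) => K O cK oO KO.
have nc := (compact_near_coveringP K).1 cK.
suff : \forall k \near \oo, K `<=` (fun z => O (h k z)).
  by apply: filterS => k Ok _ [z Kz <-]; exact: Ok.
apply: (nc nat \oo (fun k z => O (h k z))) => z Kz.
have [|e e0 he] := @open_hyp O z oO; first by apply: KO; exists z.
have e2 : 0 < e / 2 by rewrite divr_gt0.
exists ([set w | enorm (hval z - hval w) < e / 2], [set k : nat | k.+1%:R^-1 < e / 2]).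
  split; first exact: nbhs_hyp.
  exact: (near_infty_natSinv_lt (PosNum e2)).
move=> [w k] [/= wz ke]; apply: he.
have := enorm_tri (hval z) (hval w) (hval (h k w)).
have := hk k w; rewrite (enormC (hval (h k w)) (hval w)) => a1 a2.
have a3 := lt_trans a1 ke; move: a2 a3 wz.
rewrite -[X in _ -> _ -> _ -> _ < X](_ : e / 2 + e / 2 = e); last by field.
by move=> a2 a3 wz; apply: le_lt_trans a2 _; exact: ltrD.
Qed.

Lemma iso_W_inv g h : is_isometry g -> cancel h g -> W (ext h 0) = W (ext g 0).
Proof.
move=> ig hK; have := iso_qd (h origin) origin ig; rewrite hK hval0 qdC => q.
have := qd0 (hval_lt1 (h origin)); have := qd0 (hval_lt1 (g origin)).
by rewrite !ext0 q => -> /invr_inj.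
Qed.

(** Infinitely many isometries moving [0] by a bounded amount: two of them are
    uniformly close, being equi-Lipschitz maps of a totally bounded set. *)
Lemma close_pair (u : nat -> H -> H) r e : (forall i, is_isometry (u i)) ->
  (forall i, r <= W (ext (u i) 0)) -> 0 < r -> 0 < e ->
  exists i j, (i < j)%N /\ forall z, enorm (hval (u i z) - hval (u j z)) < e.
Proof.
move=> iu ru r0 e0; pose K := 1 + 4 / r; have K0 : 0 < K by rewrite addr_gt0 // divr_gt0.
pose d := e / (4 * K + 2); have d0 : 0 < d by rewrite divr_gt0 // addr_gt0 // mulr_gt0.
have eE : e = K * (2 * d) + K * (2 * d) + 2 * d.
  by rewrite /d; field; rewrite gt_eqF // addr_gt0 // mulr_gt0.
have lipK i x y : enorm x <= 1 -> enorm y <= 1 ->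
    enorm (ext (u i) x - ext (u i) y) <= K * enorm (x - y).
  move=> x1 y1; apply: le_trans (ext_lip (iu i) x1 y1) _.
  apply: ler_wpM2r; first exact: enorm_ge0.
  rewrite /K lerD2l ler_pM2l // lef_pV2 ?posrE // (lt_le_trans r0) //.
have [s sP] := ball_net (m := n.+1) d0.
(* points of the net may lie outside the ball, where nothing is known of the maps *)
pose rep (c : V) : V := xget 0 [set x | enorm x <= 1 /\ enorm (x - c) < d].
have rep1 c : enorm (rep c) <= 1.
  by rewrite /rep; case: xgetP => [x -> []|]; rewrite ?enorm0.
have repP x c : enorm x <= 1 -> enorm (x - c) < d -> enorm (rep c - c) < d.
  move=> x1 xc; suff [] : [set x | enorm x <= 1 /\ enorm (x - c) < d] (rep c) by [].
  by apply: xgetPex; exists x.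
have labP x : enorm x <= 1 -> exists k : 'I_(size s).+1, enorm (x - nth 0 s k) < d.
  move=> /sP[c cs xc]; have ci : (index c s < (size s).+1)%N by rewrite ltnS index_size.
  by exists (Ordinal ci); rewrite /= nth_index.
pose lab x : 'I_(size s).+1 := xget ord0 [set k : 'I_(size s).+1 | enorm (x - nth 0 s k) < d].
have labE x : enorm x <= 1 -> enorm (x - nth 0 s (lab x)) < d.
  by move=> /labP h; exact: (@xgetPex _ ord0 _ h).
pose L i : {ffun 'I_(size s) -> 'I_(size s).+1} :=
  [ffun k : 'I_(size s) => lab (ext (u i) (rep (nth 0 s k)))].
have [|i [j [ij Lij]]] :=
    @repeated_value _ [set: {ffun 'I_(size s) -> 'I_(size s).+1}] L _ (fun=> I).
  exact: finite_finset.
exists i, j; split=> // z; have z1 := ltW (hval_lt1 z).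
have [c cs zc] := sP _ z1.
have ci : (index c s < size s)%N by rewrite index_mem.
have := congr1 (fun F : {ffun 'I_(size s) -> 'I_(size s).+1} => F (Ordinal ci)) Lij.
rewrite !ffunE /= nth_index // => E.
have h1 := labE _ (ext_le1 (iu i) (rep1 c)); have h2 := labE _ (ext_le1 (iu j) (rep1 c)).
rewrite -E enormC in h2.
have rc := repP _ _ z1 zc.
have zr : enorm (hval z - rep c) < 2 * d.
  by have := enorm_tri (hval z) c (rep c); rewrite (enormC c (rep c)); lra.
have l1 := lipK i _ _ z1 (rep1 c); have l2 := lipK j _ _ (rep1 c) z1.
rewrite (enormC (rep c)) in l2; rewrite -!ext_in.
set y := nth 0 s _ in h1 h2.
have t1 := enorm_tri (ext (u i) (hval z)) (ext (u i) (rep c)) (ext (u j) (hval z)).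
have t2 := enorm_tri (ext (u i) (rep c)) y (ext (u j) (hval z)).
have t3 := enorm_tri y (ext (u j) (rep c)) (ext (u j) (hval z)).
rewrite eE; have l3 : K * enorm (hval z - rep c) < K * (2 * d) by rewrite ltr_pM2l.
move: l3 l1 l2 h1 h2 t1 t2 t3; clear; lra.
Qed.

(** With [u i] and [u j] close, the quotient of [u j] by [u i] is close to the identity
    because the inverse of [u i] is Lipschitz as well; this contradicts that the identity is
    isolated. *)
Lemma kleinian_finite G r : kleinian G -> 0 < r ->
  finite_set [set g | G g /\ r <= W (ext g 0)].
Proof.
move=> [[Giso Gid Gcomp Ginv] Gdisc] r0; apply: contrapT => /infinite_seq[u uA uinj].
have /= [_ [A nA AG]] := Gdisc _ Gid.
have iu i : is_isometry (u i) by apply: Giso; case: (uA i).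
have ru i : r <= W (ext (u i) 0) by case: (uA i).
have K0 : 0 < 1 + 4 / r by rewrite addr_gt0 // divr_gt0.
have next k : {h | G h /\ h <> id & forall z, enorm (hval (h z) - hval z) < k.+1%:R^-1}.
  apply: cid2.
  have e0 : 0 < k.+1%:R^-1 / (1 + 4 / r) :> R by rewrite divr_gt0 // invr_gt0.
  have [i [j [ij close]]] := close_pair iu ru r0 e0.
  have [v Gv [v1 v2]] := Ginv _ (uA i).1.
  exists (v \o u j); [split; first exact: Gcomp Gv (uA j).1|].
    move=> E; have : u i = u j.
      by apply/funext => z; rewrite -[RHS]v2; congr (u i _); have := congr1 (fun F => F z) E.
    by move/uinj => ijE; rewrite ijE ltnn in ij.
  move=> z /=; rewrite -{2}(v1 z) -(ext_in v (u j z)) -(ext_in v (u i z)).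
  have l1 := ext_lip (Giso _ Gv) (ltW (hval_lt1 (u j z))) (ltW (hval_lt1 (u i z))).
  apply: le_lt_trans l1 _.
  rewrite (iso_W_inv (iu i) v2).
  have c1 : 1 + 4 / W (ext (u i) 0) <= 1 + 4 / r.
    by rewrite lerD2l ler_pM2l // lef_pV2 ?posrE // (lt_le_trans r0).
  apply: le_lt_trans (ler_wpM2r (enorm_ge0 _) c1) _.
  by rewrite -ltr_pdivlMl // mulrC enormC.
pose h k := s2val (next k).
have Gh k : G (h k) /\ h k <> id by exact: s2valP (next k).
have hk k : forall z, enorm (hval (h k z) - hval z) < k.+1%:R^-1 by exact: s2valP' (next k).
have [N _ hN] := uniform_compact_open hk nA.
have : (A `&` G) (h N) by split; [exact: hN N (leqnn N)|exact: (Gh N).1].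
by rewrite AG => /(Gh N).2.
Qed.

Lemma ext_kgroup G : kleinian G -> kgroup (@ext R n @` G).
Proof.
move=> kG; have [[Giso Gid Gcomp Ginv] _] := kG; split.
- by move=> _ [g Gg <-]; exact: conf_ext (Giso _ Gg).
- by exists id => //; exact: ext_id.
- by move=> _ _ [g Gg <-] [h Gh <-]; exists (g \o h);
    [exact: Gcomp|rewrite ext_comp //; exact: Giso].
- move=> _ [g Gg <-]; have [h Gh [gh hg]] := Ginv _ Gg; exists (ext h); first by exists h.
  move=> x _; have /(congr1 (fun F => F x)) /= := ext_comp (Giso _ Gh) (Giso _ Gg).
  have /(congr1 (fun F => F x)) /= := ext_comp (Giso _ Gg) (Giso _ Gh).
  have -> : g \o h = id by apply/funext.
  have -> : h \o g = id by apply/funext.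
  by rewrite ext_id /= => <- <-.
- by move=> _ _ [g Gg <-] [h Gh <-] e; rewrite (ext_inj (Giso _ Gg) (Giso _ Gh) e).
move=> r r0; rewrite (_ : [set f | _] = @ext R n @` [set g | G g /\ r <= W (ext g 0)]).
  exact/finite_image/kleinian_finite.
apply/seteqP; split => [_ [[g Gg <-] rg]|_ [g [Gg rg] <-]]; first by exists g.
by split=> //; exists g.
Qed.

End Discrete.

(** * Orbits, limit points and rays *)

Section HyperbolicDistance.
Context {R : realType} {n : nat}.
Notation V := 'rV[R]_n.+1.
Notation H := (hyp R n).
Implicit Types (x y p : V) (z w o : H) (g h : H -> H) (G : set (H -> H)).

Lemma qdh_ge0 z w : 0 <= qd (hval z) (hval w).
Proof. by apply: qd_ge0; exact: hval_lt1. Qed.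

Lemma Wh_gt0 z : 0 < W (hval z). Proof. by rewrite W_gt0 hval_lt1. Qed.

Lemma expR_hdist z w : 1 + 2 * qd (hval z) (hval w) <= expR (hdist z w) <=
  2 * (1 + 2 * qd (hval z) (hval w)).
Proof. by rewrite hdistE; apply: ell_bounds; rewrite lerDl mulr_ge0 // qdh_ge0. Qed.

(** [path_bound] along the geodesic from [w] to [v]. *)
Lemma hdist_tri z w v : hdist z v <= hdist z w + hdist w v.
Proof.
have [c [c1 c2 c3 [c4 c5] c6]] := geo_exists (hval_lt1 w) (hval_lt1 v).
have := path_bound (hval_lt1 z) c1 c2 (fun t _ => c3 t); rewrite c4 c5 -!hdistE.
have -> : path_length c = hdist w v / 2.
  rewrite /path_length hdistE.
  rewrite (@eq_Rintegral _ _ _ _ _ (cst (ell (1 + 2 * qd (hval w) (hval v)) / 2))); last first.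
    by move=> t _; exact: c6.
  rewrite Rintegral_cst //= lebesgue_measure_itv /= lte01 oppr0 adde0 /=.
  by rewrite mulr1.
by move=> h; lra.
Qed.

Lemma W_le_1sub x : enorm x <= 1 -> 1 - enorm x <= W x <= 2 * (1 - enorm x).
Proof. by rewrite /W; have := enorm_ge0 x; move: (enorm x) => t t0 t1; apply/andP; split; nra. Qed.

Lemma expR_hdist_W o w : W (hval o) / 16 / W (hval w) <= expR (hdist o w) <=
  18 / W (hval o) / W (hval w).
Proof.
have /andP[h1 h2] := expR_hdist o w.
have q0 := qdh_ge0 o w; have Wo := Wh_gt0 o; have Ww := Wh_gt0 w.
apply/andP; split.
  apply: le_trans h1; rewrite ler_pdivrMr //.
  by have := W_harnack (hval_lt1 w) (hval_lt1 o) q0 ; rewrite qdC => /(_ (lexx _)); lra.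
apply: le_trans h2 _.
have e2 : enorm (hval o - hval w) ^+ 2 <= 4.
  have := enormD (hval o) (- hval w); rewrite enormN.
  have := hval_lt1 o; have := hval_lt1 w; have := enorm_ge0 (hval o - hval w).
  have := enorm_ge0 (hval o); have := enorm_ge0 (hval w); nra.
have W1 := W_le1 (hval o); have W2 := W_le1 (hval w).
rewrite -mulrA -invfM ler_pdivlMr ?mulr_gt0 //.
have -> : 2 * (1 + 2 * qd (hval o) (hval w)) * (W (hval o) * W (hval w)) =
    2 * (W (hval o) * W (hval w)) + 4 * enorm (hval o - hval w) ^+ 2.
  by rewrite /qd; field; rewrite !gt_eqF.
have h3 : W (hval o) * W (hval w) <= 1 by rewrite mulr_ile1 // ltW.
lra.
Qed.

Lemma enorm_qd_W C z w : 0 <= C -> qd (hval z) (hval w) <= C ->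
  enorm (hval z - hval w) <= (2 + 16 * C) * W (hval z).
Proof.
move=> C0 qC; have Wz := Wh_gt0 z; have Ww := Wh_gt0 w.
have Wle := W_harnack (hval_lt1 z) (hval_lt1 w) C0 qC.
have A0 : 0 <= 2 + 16 * C by lra.
rewrite -(@ler_pXn2r _ 2) ?nnegrE ?enorm_ge0 ?mulr_ge0 ?(ltW Wz) //.
have -> : enorm (hval z - hval w) ^+ 2 = qd (hval z) (hval w) * W (hval z) * W (hval w).
  by rewrite /qd; field; rewrite !gt_eqF.
rewrite exprMn; apply: (@le_trans _ _ (C * W (hval z) * W (hval w))).
  by apply: ler_wpM2r (ltW Ww) _ _ _; exact: ler_wpM2r (ltW Wz) _ _ qC.
apply: (@le_trans _ _ (C * W (hval z) * ((2 + 16 * C) * W (hval z)))).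
  by apply: ler_wpM2l => //; rewrite mulr_ge0 // ltW.
rewrite [leLHS](_ : _ = C * (2 + 16 * C) * W (hval z) ^+ 2); last by ring.
by apply: ler_wpM2r; rewrite ?sqr_ge0 //; nra.
Qed.

(** Hence limit points, conical points and the Poincare series do not depend on the base
    point. *)
Lemma orbit_close o : exists2 C, 1 <= C & forall g, is_isometry g ->
  [/\ W (hval (g o)) <= C * W (ext g 0), W (ext g 0) <= C * W (hval (g o)),
      enorm (hval (g o) - ext g 0) <= C * W (ext g 0) &
      enorm (hval (g o) - ext g 0) <= C * W (hval (g o))].
Proof.
pose C := qd (hval o) 0; have C0 : 0 <= C by rewrite /C -(hval0 (R := R)) qdh_ge0.
exists (2 + 16 * C); first by lra.
move=> g ig; rewrite ext0.
have q : qd (hval (g o)) (hval (g origin)) <= C by rewrite iso_qd.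
have q' : qd (hval (g origin)) (hval (g o)) <= C by rewrite qdC.
split; [exact: W_harnack (hval_lt1 _) (hval_lt1 _) C0 q'|
  exact: W_harnack (hval_lt1 _) (hval_lt1 _) C0 q|
  by rewrite enormC; exact: enorm_qd_W|exact: enorm_qd_W].
Qed.

End HyperbolicDistance.

Section Transfer.
Context {R : realType} {n : nat}.
Notation V := 'rV[R]_n.+1.
Notation H := (hyp R n).
Implicit Types (x y p : V) (z w : H) (g h : H -> H).
Variables (G : set (H -> H)) (o : H).
Hypothesis kG : kleinian G.
Notation Gam := (@ext R n @` G).

Let Giso g : G g -> is_isometry g. Proof. by case: kG => -[+ _ _ _] _; apply. Qed.

Lemma Gam_ext g : G g -> Gam (ext g). Proof. by move=> Gg; exists g. Qed.

Lemma orbit_near C : (forall g, is_isometry g ->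
    [/\ W (hval (g o)) <= C * W (ext g 0), W (ext g 0) <= C * W (hval (g o)),
      enorm (hval (g o) - ext g 0) <= C * W (ext g 0) &
      enorm (hval (g o) - ext g 0) <= C * W (hval (g o))]) -> 1 <= C ->
  forall x g e, enorm x = 1 -> G g -> 0 < e ->
  (enorm (x - hval (g o)) < e / (1 + 2 * C) -> enorm (ext g 0 - x) < e) /\
  (enorm (ext g 0 - x) < e / (1 + 2 * C) -> enorm (x - hval (g o)) < e).
Proof.
move=> HC C1 x g e x1 Gg e0; have [_ _ h1 h2] := HC _ (Giso Gg).
have C0 : 0 < 1 + 2 * C by lra.
have n1 : enorm (hval (g o)) <= 1 by exact/ltW/hval_lt1.
have n2 : enorm (ext g 0) <= 1 by rewrite ext0; exact/ltW/hval_lt1.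
have w1 := W_le_dist x1 n1; have w2 := W_le_dist x1 n2.
have t1 := enorm_tri (ext g 0) (hval (g o)) x.
have t2 := enorm_tri x (ext g 0) (hval (g o)).
rewrite (enormC (ext g 0) (hval (g o))) (enormC (hval (g o)) x) in t1.
rewrite (enormC (ext g 0) (hval (g o))) (enormC x (ext g 0)) in t2.
rewrite (enormC (hval (g o)) x) in w1.
rewrite !ltr_pdivlMr //; move: h1 h2 w1 w2 t1 t2 C1; clear.
by move: (enorm _) (enorm _) (enorm _) (W _) (W _) => a b c u v; split; nra.
Qed.

Lemma limit_setE : limit_set G o = limpt Gam.
Proof.
have [C C1 HC] := orbit_close o; have C0 : 0 < 1 + 2 * C by lra.
apply/seteqP; split=> x.
  move=> [x1 Lx]; split=> // e e0; have d0 : 0 < e / (1 + 2 * C) by rewrite divr_gt0.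
  have [|y [_ [g Gg <-] hx]] := Lx [set y | enorm (x - y) < e / (1 + 2 * C)].
    by apply/nbhs_enormP; exists (e / (1 + 2 * C)).
  by exists (ext g); [exact: Gam_ext|exact: (orbit_near HC C1 x1 Gg e0).1].
move=> [x1 Lx]; split=> // U /nbhs_enormP[e e0 eU].
have d0 : 0 < e / (1 + 2 * C) by rewrite divr_gt0.
have [_ [g Gg <-] gx] := Lx _ d0; exists (hval (g o)); split.
- by apply: contraTneq (hval_lt1 (g o)) => ->; rewrite x1 ltxx.
- by exists g.
by apply: eU; exact: (orbit_near HC C1 x1 Gg e0).2.
Qed.

Lemma conical_pointsE : conical_points G o = conic Gam.
Proof.
have [C C1 HC] := orbit_close o; have C0 : 0 < 1 + 2 * C by lra.
rewrite /conical_points limit_setE; apply/seteqP; split=> x.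
  move=> [[x1 _] [u [Gu ux [k hk]]]]; split=> //; exists (C + C * `|k|) => e e0.
  have d0 : 0 < e / (1 + 2 * C) by rewrite divr_gt0.
  have [N _ /(_ N (leqnn N)) /= uN] := (cvg_enormP _ _).1 ux _ d0.
  have Gg := Gu N; exists (ext (u N)); split; first exact: Gam_ext.
    by apply: (orbit_near HC C1 x1 Gg e0).1; rewrite enormC.
  have [h1 _ h3 _] := HC _ (Giso Gg).
  have hN := hk N; have t1 := enorm_tri (ext (u N) 0) (hval (u N o)) x.
  rewrite (enormC (ext (u N) 0) (hval (u N o))) (enormC (hval (u N o)) x) in t1.
  have n1 : enorm (hval (u N o)) <= 1 by exact/ltW/hval_lt1.
  have /andP[n2 _] := W_le_1sub n1.
  have k1 : k * (1 - enorm (hval (u N o))) <= `|k| * (C * W (ext (u N) 0)).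
    apply: (@le_trans _ _ (`|k| * (1 - enorm (hval (u N o))))).
      by apply: ler_wpM2r; [rewrite subr_ge0|exact: ler_norm].
    by apply: ler_wpM2l => //; lra.
  rewrite mulrDl -[C * `|k| * _]mulrA [C * (_ * _)]mulrCA; lra.
move=> cx; have x1 : enorm x = 1 by case: cx.
have [_ [k hk]] := cx.
split.
  by split=> // e e0; have [f [Gf fx _]] := hk _ e0; exists f.
have k0 (i : nat) : 0 < i.+1%:R^-1 / (1 + 2 * C) :> R by rewrite divr_gt0 // invr_gt0.
have next (i : nat) : {g | G g & enorm (x - hval (g o)) < i.+1%:R^-1 /\
    enorm (ext g 0 - x) <= k * W (ext g 0)}.
  apply: cid2; have [_ [[g Gg <-] gx gk]] := hk _ (k0 i); exists g => //; split=> //.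
  by apply: (orbit_near HC C1 x1 Gg _).2; rewrite ?invr_gt0.
pose u i := s2val (next i).
have Gu i : G (u i) by exact: s2valP (next i).
have hu i : enorm (x - hval (u i o)) < i.+1%:R^-1 /\
    enorm (ext (u i) 0 - x) <= k * W (ext (u i) 0) by exact: s2valP' (next i).
exists u; split=> //.
  apply/cvg_enormP => e e0; apply: filterS (near_infty_natSinv_lt (PosNum e0)) => i /= ie.
  by rewrite enormC; exact: lt_trans (hu i).1 ie.
exists (2 * (C + `|k| * C) + 1) => i.
have [h1 h2 h3 h4] := HC _ (Giso (Gu i)); have [_ ki] := hu i.
have n1 := hval_lt1 (u i o); have /andP[_ n2] := W_le_1sub (ltW n1).
have t1 := enorm_tri x (ext (u i) 0) (hval (u i o)).
rewrite (enormC x (ext (u i) 0)) (enormC (ext (u i) 0) (hval (u i o))) in t1.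
have W0 : 0 <= W (ext (u i) 0) by rewrite ext0 ltW // Wh_gt0.
have k1 : k * W (ext (u i) 0) <= `|k| * (C * W (hval (u i o))).
  apply: (@le_trans _ _ (`|k| * W (ext (u i) 0))); first by apply: ler_wpM2r; rewrite ?ler_norm.
  exact: ler_wpM2l.
have k2 : (C + `|k| * C) * W (hval (u i o)) <= (C + `|k| * C) * (2 * (1 - enorm (hval (u i o)))).
  by apply: ler_wpM2l => //; rewrite addr_ge0 ?mulr_ge0 //; lra.
move: t1 ki h4 k1 k2 n1; clear.
lra.
Qed.

End Transfer.

Section LightSums.
Context {R : realType} {T : choiceType}.
Implicit Types (w : T -> R) (A : set T).

Lemma light_esum w A : (forall x, 0 <= w x) ->
  light w A <-> (\esum_(x in A) (w x)%:E < +oo)%E.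
Proof.
move=> w0; split.
  move=> [M HM]; apply: (@le_lt_trans _ _ M%:E); last exact: ltry.
  apply: ge_ereal_sup => _ [F [fF FA] <-].
  rewrite fsbig_finite // sumEFin lee_fin; apply: HM => x /=.
  by rewrite in_fset_set // => /set_mem; exact: FA.
move=> fin; exists (fine (\esum_(x in A) (w x)%:E)) => F FA.
rewrite -lee_fin fineK; last first.
  by rewrite ge0_fin_numE //; apply: esum_ge0 => x _; rewrite lee_fin.
apply: esum_ge; exists [set` F]; first by split=> //; exact: finite_fset.
by rewrite fsbig_finite; [rewrite set_fsetK sumEFin|exact: finite_fset].
Qed.

Lemma light_le w w' (c : R) A : 0 <= c -> (forall x, A x -> w x <= c * w' x) ->
  light w' A -> light w A.
Proof.
move=> c0 h [M HM]; exists (c * M) => F FA.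
apply: (@le_trans _ _ (c * \sum_(x <- F) w' x)); last by apply: ler_wpM2l => //; exact: HM.
rewrite big_distrr /= big_seq [leRHS]big_seq; apply: ler_sum => x xF.
by apply: h; exact: FA.
Qed.

End LightSums.

Section Rays.
Context {R : realType} {n : nat}.
Notation V := 'rV[R]_n.+1.
Notation H := (hyp R n).
Implicit Types (x y p : V) (z w : H) (g h : H -> H).

(** [W (c t)] decreases like [e^-t] and [|c s - c t|^2 <= e^(t - s) W (c s) W (c t)]: the
    factors [e^t] cancel, so that [t] can tend to infinity. *)
Lemma ray_conic (c : R -> H) x : geodesic_ray c -> hval (c t) @[t --> +oo] --> x ->
  exists2 C, 0 <= C & forall s, 0 <= s -> enorm (hval (c s) - x) <= C * W (hval (c s)).
Proof.
move=> gc cx; pose a := W (hval (c 0)); have a0 : 0 < a by exact: Wh_gt0.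
pose C := 18 / a * (16 / a) + 1; have C1 : 1 <= C.
  by rewrite /C lerDr mulr_ge0 // divr_ge0 // ltW.
exists C; first by lra.
move=> s s0; apply/ler_addgt0Pr => e e0.
have := (cvg_enormP _ _).1 cx _ e0 => -[M [_ HM]].
pose t := Num.max s (M + 1).
have ts : s <= t by rewrite le_max lexx.
have tM : M < t by rewrite lt_max ltrDl ltr01 orbT.
have t0 : 0 <= t by exact: le_trans ts.
have hx := HM _ tM.
have t1 := enorm_tri (hval (c s)) (hval (c t)) x.
suff : enorm (hval (c s) - hval (c t)) <= C * W (hval (c s)).
  by move: t1 hx => /=; lra.
have Ws := Wh_gt0 (c s); have Wt := Wh_gt0 (c t).
rewrite -(@ler_pXn2r _ 2) ?nnegrE ?enorm_ge0 ?mulr_ge0 ?(ltW Ws) //; last by lra.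
have ds : hdist (c 0) (c s) = s by rewrite gc // sub0r normrN ger0_norm.
have dt : hdist (c 0) (c t) = t by rewrite gc // sub0r normrN ger0_norm.
have dst : hdist (c s) (c t) = t - s by rewrite gc // distrC ger0_norm // subr_ge0.
have /andP[b1 _] := expR_hdist_W (c 0) (c s); have /andP[_ b2] := expR_hdist_W (c 0) (c t).
have /andP[b3 _] := expR_hdist (c s) (c t); rewrite ds -/a in b1; rewrite dt -/a in b2.
rewrite dst expRD expRN in b3.
have e2 : enorm (hval (c s) - hval (c t)) ^+ 2 =
    qd (hval (c s)) (hval (c t)) * W (hval (c s)) * W (hval (c t)).
  by rewrite /qd; field; rewrite !gt_eqF.
rewrite e2; move: (W (hval (c s))) (W (hval (c t))) (qd _ _) Ws Wt b1 b2 b3 => u v q u0 v0 b1 b2 b3.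
have E0 := expR_gt0 s; have F0 := expR_gt0 t.
have h1 : a * (expR s)^-1 <= 16 * u.
  rewrite ler_pdivrMr //; move: b1; rewrite ler_pdivrMr // ler_pdivrMr //; lra.
have h2 : a * (expR t * v) <= 18.
  by move: b2; rewrite ler_pdivlMr // ler_pdivlMr //; lra.
have h3 : q <= expR t * (expR s)^-1.
  have := mulr_gt0 F0 (etrans (invr_gt0 (expR s)) E0).
  by move: b3; move: (expR t * _) => r; lra.
have h4 : q * u * v <= (expR t * v) * (expR s)^-1 * u.
  by rewrite [leRHS](_ : _ = expR t * (expR s)^-1 * u * v); [rewrite !ler_pM2r|ring].
apply: le_trans h4 _.
have h5 : (expR t * v) * (expR s)^-1 <= 18 / a * (16 / a * u).
  apply: ler_pM; rewrite ?mulr_ge0 ?invr_ge0 ?(ltW E0) ?(ltW F0) ?(ltW v0) //.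
    by rewrite ler_pdivlMr // mulrC.
  by rewrite mulrAC ler_pdivlMr // mulrC.
apply: (@le_trans _ _ (18 / a * (16 / a * u) * u)); first by rewrite ler_pM2r.
rewrite exprMn; apply: (@le_trans _ _ (C * u ^+ 2)).
  rewrite [leLHS](_ : _ = 18 / a * (16 / a) * u ^+ 2); last by ring.
  by rewrite ler_pM2r ?exprn_gt0 // /C; lra.
by rewrite ler_pM2r ?exprn_gt0 // expr2 ler_peMr //; lra.
Qed.

End Rays.

Section BoundedRays.
Context {R : realType} {n : nat}.
Notation V := 'rV[R]_n.+1.
Notation H := (hyp R n).
Implicit Types (x y p : V) (z w : H) (g h : H -> H).

Lemma ell_expR (E : R) : 1 <= E -> ell ((E + E^-1) / 2) = ln E.
Proof.
move=> E1; have E0 : 0 < E by lra.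
have i1 : E^-1 <= E by apply: (@le_trans _ _ 1); rewrite ?invf_le1.
rewrite /ell (_ : ((E + E^-1) / 2) ^+ 2 - 1 = ((E - E^-1) / 2) ^+ 2); last by field; rewrite gt_eqF.
rewrite sqrtr_sqr ger0_norm ?divr_ge0 ?subr_ge0 //; congr ln; field; rewrite gt_eqF //.
Qed.

Lemma hdistC z w : hdist z w = hdist w z.
Proof. by rewrite !hdistE qdC. Qed.

Lemma hdist_ge0 z w : 0 <= hdist z w.
Proof. by rewrite hdistE ell_ge0 // lerDl mulr_ge0 // qdh_ge0. Qed.

Lemma hdist_le C z w : qd (hval z) (hval w) <= C -> hdist z w <= ln (2 * (1 + 2 * C)).
Proof.
move=> qC; have q0 := qdh_ge0 z w; have /andP[_ h] := expR_hdist z w.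
rewrite -ler_expR lnK ?posrE; lra.
Qed.

(** The factor is [tanh (t/2)]: [t] is the hyperbolic arc length. *)
Definition radial x t : V := ((expR t - 1) / (expR t + 1)) *: x.

Lemma radial_lt1 x t : enorm x = 1 -> enorm (radial x t) < 1.
Proof.
move=> x1; have t0 := expR_gt0 t; rewrite /radial enormZ x1 mulr1 ltr_norml.
by rewrite ltr_pdivrMr ?ltr_pdivlMr; [apply/andP; split; lra| |]; lra.
Qed.

Lemma W_radial x t : enorm x = 1 -> W (radial x t) = 4 * expR t / (expR t + 1) ^+ 2.
Proof.
move=> x1; have t0 := expR_gt0 t.
rewrite /W /radial enormZ x1 mulr1 real_normK ?num_real //; field.
by rewrite gt_eqF // addr_gt0.
Qed.

Lemma qd_radial x s t : enorm x = 1 -> qd (radial x s) (radial x t) =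
  (expR s - expR t) ^+ 2 / (4 * expR s * expR t).
Proof.
move=> x1; have t0 := expR_gt0 t; have s0 := expR_gt0 s.
rewrite /qd !W_radial // /radial -scalerBl enormZ x1 mulr1 real_normK ?num_real //.
by field; rewrite !gt_eqF ?addr_gt0.
Qed.

Section Ray.
Variables (x : V) (x1 : enorm x = 1).

Definition rray t : H := mkh (radial_lt1 t x1).

Lemma rray_geodesic : geodesic_ray rray.
Proof.
suff main s t : s <= t -> hdist (rray s) (rray t) = `|s - t|.
  move=> s t _ _; have /orP[st|ts] := le_total s t; first exact: main.
  by rewrite hdistC distrC; exact: main.
move=> st; rewrite hdistE !hval_mkh qd_radial // distrC ger0_norm ?subr_ge0 //.
have t0 := expR_gt0 t; have s0 := expR_gt0 s.
rewrite -[RHS]expRK -ell_expR; last by rewrite -expR0 ler_expR subr_ge0.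
by congr ell; rewrite expRD expRN; field; rewrite !gt_eqF.
Qed.

Lemma rray_cvg : hval (rray t) @[t --> +oo] --> x.
Proof.
apply/cvg_enormP => e e0.
exists (2 / e); split; first exact: num_real.
move=> t /= et; rewrite hval_mkh /radial.
have t1 : 1 + t <= expR t by exact: expR_ge1Dx.
have d0 : 0 < 2 / e by rewrite divr_gt0.
have t0 := expR_gt0 t.
have -> : (expR t - 1) / (expR t + 1) *: x - x = - (2 / (expR t + 1)) *: x.
  by rewrite -{2}(scale1r x) -scalerBl; congr (_ *: _); field; rewrite gt_eqF // addr_gt0.
rewrite enormZ x1 mulr1 normrN gtr0_norm ?divr_gt0 ?addr_gt0 //.
rewrite ltr_pdivrMr ?addr_gt0 //.
have : 2 = e * (2 / e) by field; rewrite gt_eqF.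
move: t1 et d0 t0; move: (2 / e) (expR t) => d E t1 et d0 t0 E2.
by rewrite {1}E2 ltr_pM2l //; lra.
Qed.

Lemma rray0 : rray 0 = origin.
Proof. by apply: hval_inj; rewrite hval_mkh /radial expR0 subrr mul0r scale0r. Qed.

Lemma rray_at (tau : R) : 0 < tau <= 1 -> exists2 t, 0 <= t & hval (rray t) = (1 - tau) *: x.
Proof.
move=> /andP[t0 t1]; have r1 : 1 <= (2 - tau) / tau by rewrite ler_pdivlMr //; lra.
exists (ln ((2 - tau) / tau)); first exact: ln_ge0.
rewrite hval_mkh /radial lnK ?posrE; last by lra.
by congr (_ *: _); field; rewrite gt_eqF //=; lra.
Qed.

End Ray.

Variables (G : set (H -> H)) (o : H) (kG : kleinian G).
Notation Gam := (@ext R n @` G).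

Let Giso g : G g -> is_isometry g. Proof. by case: kG => -[+ _ _ _] _; apply. Qed.

(** A bounded projection of the radial ray gives orbit points near all its points.
    Conversely any ray ending at [x] stays near the radial one by [ray_conic], and points near
    the orbit project near the image of the origin. *)
Lemma bounded_limit_pointsE :
  bounded_limit_points G o = [set x | limpt Gam x /\ bounded_ray Gam x].
Proof.
rewrite /bounded_limit_points (limit_setE o kG); apply/seteqP; split=> x [Lx h]; split=> //.
  have x1 : enorm x = 1 by case: Lx.
  have [M HM] := h _ (rray_geodesic x1) (rray_cvg x1).
  exists (expR (M + 1)) => tau tau01; have [t t0 <-] := rray_at x1 tau01.
  have := HM t 0 t0 (lexx 0); rewrite rray0 /quotient_dist => qM.
  have [||_ [g Gg <-] gM] := @inf_lt R [set hdist (rray x1 t) (g origin) | g in G] (M + 1).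
  - by exists (hdist (rray x1 t) origin); exists id => //; case: kG => -[].
  - by lra.
  exists (ext g); first by exists g.
  rewrite ext0; have /andP[h1 _] := expR_hdist (rray x1 t) (g origin).
  have : expR (hdist (rray x1 t) (g origin)) < expR (M + 1) by rewrite ltr_expR.
  have := qdh_ge0 (rray x1 t) (g origin); lra.
move=> c gc cx; have x1 : enorm x = 1 by case: Lx.
have [C C0 hC] := ray_conic gc cx; have [B hB] := h.
pose L := ln (2 * (1 + 2 * (1 + C) ^+ 2)) + ln (2 * (1 + 2 * B)).
have near s : 0 <= s -> exists2 g, G g & hdist (c s) (g origin) <= L.
  move=> s0; have Ws := Wh_gt0 (c s); have hs := hC s s0.
  have tau01 : 0 < W (hval (c s)) <= 1 by rewrite Ws W_le1.
  have [_ [g Gg <-]] := hB _ tau01; rewrite ext0 => qg.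
  have [y1 /andP[Wy _] ye] := ray_W x1 tau01.
  exists g => //; apply: le_trans (hdist_tri _ (mkh y1) _) _.
  apply: lerD; last exact: hdist_le.
  apply: hdist_le; rewrite hval_mkh /qd.
  have Wy0 : 0 < W ((1 - W (hval (c s))) *: x) by exact: lt_le_trans Wy.
  rewrite ler_pdivrMr ?mulr_gt0 //.
  have t1 := enorm_tri (hval (c s)) x ((1 - W (hval (c s))) *: x).
  rewrite (enormC x) ye in t1.
  have t2 : enorm (hval (c s) - (1 - W (hval (c s))) *: x) <= (1 + C) * W (hval (c s)).
    by rewrite mulrDl mul1r; lra.
  apply: (@le_trans _ _ (((1 + C) * W (hval (c s))) ^+ 2)).
    rewrite ler_pXn2r ?nnegrE ?enorm_ge0 //; apply: mulr_ge0; [lra|exact: ltW].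
  by rewrite exprMn ler_wpM2l ?sqr_ge0 // expr2 ler_pM2l.
exists (L + L) => s t s0 t0.
have [g Gg gL] := near s s0; have [g' Gg' gL'] := near t t0.
have [[_ _ Gcomp Ginv] _] := kG; have [k Gk [k1 k2]] := Ginv _ Gg'.
have lb : has_lbound [set hdist (c s) (f (c t)) | f in G].
  by exists 0 => _ [f _ <-]; exact: hdist_ge0.
apply: le_trans (ge_inf lb _) _; first by exists (g \o k); [exact: Gcomp|].
rewrite /=; apply: le_trans (hdist_tri _ (g origin) _) _; apply: lerD => //.
rewrite -{1}(k1 origin) (Giso Gg).1 (Giso Gk).1 hdistC; exact: gL'.
Qed.

Lemma badE p x : enorm p = 1 ->
  (exists2 k : R, 0 < k & forall g, G g ->
     enorm (x - bext g p) > k * (1 - enorm (hval (g origin)))) <-> bad_at Gam p x.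
Proof.
move=> p1; split=> -[k k0 hk].
  exists (k / 2); first by rewrite divr_gt0.
  move=> _ [g Gg <-]; rewrite (ext_sphere _ p1) ext0; apply: le_lt_trans (hk g Gg).
  have /andP[_ h] := W_le_1sub (ltW (hval_lt1 (g origin))).
  by rewrite -mulrA ler_pM2l //; lra.
exists k => // g Gg; have := hk _ (Gam_ext Gg); rewrite (ext_sphere _ p1) ext0.
apply: le_lt_trans; rewrite ler_pM2l //.
by have /andP[h _] := W_le_1sub (ltW (hval_lt1 (g origin))).
Qed.

(** [e^-d(o, g o)] and [W (g 0)] differ by bounded factors. *)
Lemma poincare_light s : 0 <= s ->
  (\esum_(g in G) (expR (- (s * hdist o (g o))))%:E < +oo)%E <-> light (wt s) Gam.
Proof.
move=> s0; have [C C1 HC] := orbit_close o; have C0 : 0 < C by lra.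
have Wo := Wh_gt0 o.
pose D g := expR (hdist o (g o)).
have D0 g : 0 < D g by exact: expR_gt0.
have aE g : expR (- (s * hdist o (g o))) = (D g)^-1 `^ s.
  by rewrite -mulrN mulrC expRM expRN.
have wE g : wt s (ext g) = W (ext g 0) `^ s by [].
have Wg g : 0 < W (ext g 0) by rewrite ext0 Wh_gt0.
have up g : G g -> (D g)^-1 <= 16 / W (hval o) * C * W (ext g 0).
  move=> Gg; have [h1 _ _ _] := HC _ (Giso Gg); have /andP[h _] := expR_hdist_W o (g o).
  have Wgo := Wh_gt0 (g o).
  apply: (@le_trans _ _ (16 / W (hval o) * W (hval (g o)))).
    rewrite (_ : _ * _ = (W (hval o) / 16 / W (hval (g o)))^-1); last first.
      by field; rewrite !gt_eqF.
    by rewrite lef_pV2 ?posrE ?divr_gt0.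
  rewrite -(mulrA _ C); apply: ler_wpM2l h1; apply: divr_ge0 => //; exact: ltW.
have dn g : G g -> W (ext g 0) <= C * (18 / W (hval o)) * (D g)^-1.
  move=> Gg; have [_ h1 _ _] := HC _ (Giso Gg); have /andP[_ h] := expR_hdist_W o (g o).
  have Wgo := Wh_gt0 (g o).
  apply: le_trans h1 _; rewrite -(mulrA C); apply: ler_wpM2l; first exact: ltW.
  rewrite ler_pdivlMr //.
  by move: h; rewrite -/(D g) ler_pdivlMr // mulrC.
have re : (\esum_(f in Gam) (wt s f)%:E = \esum_(g in G) (wt s (ext g))%:E)%E.
  apply: reindex_esum; split.
  - by move=> g Gg; exists g.
  - by move=> g h /set_mem Gg /set_mem Gh e; apply: ext_inj => [||x _]; rewrite ?e //; exact: Giso.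
  - by move=> _ [g Gg <-]; exists g.
have lg : light (wt s) Gam <-> light (fun g => wt s (ext g)) G.
  split=> [/(light_esum _ (wt_ge0 s))|/(light_esum _ (fun g => wt_ge0 s (ext g)))].
    by rewrite re => /(light_esum _ (fun g => wt_ge0 s (ext g))).
  by rewrite -re => /(light_esum _ (wt_ge0 s)).
have le : light (fun g => expR (- (s * hdist o (g o)))) G <->
    light (fun g => wt s (ext g)) G.
  have K1 : 0 <= 16 / W (hval o) * C.
    by apply: mulr_ge0; [apply: divr_ge0 => //; exact: ltW|exact: ltW].
  have K2 : 0 <= C * (18 / W (hval o)).
    by apply: mulr_ge0; [exact: ltW|apply: divr_ge0 => //; exact: ltW].
  have D1 g : 0 <= (D g)^-1 by rewrite invr_ge0 ltW.
  split.
    apply: (@light_le _ _ _ _ ((C * (18 / W (hval o))) `^ s)); first exact: powR_ge0.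
    move=> g Gg; rewrite aE wE -powRM //; apply: ge0_ler_powR => //; last exact: dn.
      by rewrite nnegrE ltW.
    by rewrite nnegrE; apply: mulr_ge0.
  apply: (@light_le _ _ _ _ ((16 / W (hval o) * C) `^ s)); first exact: powR_ge0.
  move=> g Gg; rewrite aE wE -powRM //; last exact: ltW.
  apply: ge0_ler_powR => //; last exact: up.
    by rewrite nnegrE.
  by rewrite nnegrE; apply: mulr_ge0 => //; exact: ltW.
rewrite -(light_esum _ (fun g => expR_ge0 _)) le; exact: (iff_sym lg).
Qed.

End BoundedRays.

(** * The theorem *)

Section Parabolic.
Context {R : realType} {n : nat}.
Notation V := 'rV[R]_n.+1.
Notation H := (hyp R n).
Implicit Types (x y p : V) (z w : H) (g h : H -> H).
Variables (G : set (H -> H)) (o : H).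
Hypotheses (kG : kleinian G) (inf : non_elementary G o)
  (gf : geometrically_finite G o).
Notation Gam := (@ext R n @` G).

(** Countability holds because a parabolic element determines its fixed point. *)
Lemma kleinian_cusped : cusped Gam (parabolic_points G o).
Proof.
have [_ dich disj] := gf; have Lim := limit_setE o kG; have Con := conical_pointsE o kG.
split.
- pose F (f : V -> V) : V := xget 0 [set x | enorm x = 1 /\ f x = x].
  apply: (@sub_countable _ _ _ (F @` Gam)); last first.
    apply: (@sub_countable _ _ _ Gam); [exact: card_image_le|].
    exact: kg_countable (ext_kgroup kG).
  apply: subset_card_le => p [[p1 _] [g [Gg [_ _ [q [_ uq]]] gp]]].
  exists (ext g); first exact: Gam_ext.
  have [f1 fF] : [set x | enorm x = 1 /\ ext g x = x] (F (ext g)).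
    by apply: xgetPex; exists p; rewrite /= ext_sphere.
  have <- : q = p by exact: uq.
  by symmetry; apply: uq; split=> //; rewrite -ext_sphere.
- by move=> x; rewrite -Lim dich => -[|]; [rewrite Con; left|right].
- by move=> p [Lp _]; rewrite -Lim.
- move=> p Pp cp; have : (conical_points G o `&` parabolic_points G o) p by rewrite Con.
  by rewrite disj.
- move=> p [[p1 _] [g [Gg [_ nofix _] gp]]]; exists (ext g).
    by split; [exact: Gam_ext|rewrite ext_sphere].
  move=> z z1; rewrite -(hval_mkh z1) ext_in => /hval_inj; exact: nofix.
by rewrite -Lim.
Qed.

Lemma badly_approximableE P : P `<=` parabolic_points G o ->
  badly_approximable G o P =
  [set x | limpt Gam x /\ forall p, P p -> bad_at Gam p x].
Proof.
move=> PP; have Lim := limit_setE o kG.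
have p1 p : P p -> enorm p = 1 by move=> /PP[[]].
apply/seteqP; split=> x.
  move=> [Lx h]; rewrite /= -Lim; split=> // p Pp.
  by apply: (badE G x (p1 p Pp)).1; have [] := h p Pp.
move=> [Lx h]; split; first by rewrite Lim.
by move=> p Pp; split; [rewrite Lim|apply: (badE G x (p1 p Pp)).2; exact: h].
Qed.

End Parabolic.

Theorem corollary5p3 (R : realType) (n : nat)
    (G : set (hyp R n -> hyp R n)) (o : hyp R n) (P : set 'rV[R]_n.+1)
    (G_kleinian : kleinian G)
    (G_nonelementary : non_elementary G o)
    (G_geometrically_finite : geometrically_finite G o)
    (P_representatives : parabolic_representatives G o P) :
  badly_approximable G o P = bounded_limit_points G o /\
  hausdorff_dim (badly_approximable G o P) = critical_exponent G o.
Proof.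
have kg := ext_kgroup G_kleinian.
have cu := kleinian_cusped G_kleinian G_nonelementary G_geometrically_finite.
have [PP _ Prep] := P_representatives.
have Prep' q : parabolic_points G o q ->
    exists g p, [/\ (@ext R n @` G) g, P p & q = g p].
  move=> /Prep[g [p [Gg Pp ->]]]; exists (ext g), p; split=> //.
  by have [[p1 _] _] := PP _ Pp; rewrite ext_sphere.
have eq : badly_approximable G o P = bounded_limit_points G o.
  rewrite (badly_approximableE G_kleinian PP) (bounded_limit_pointsE o G_kleinian).
  apply/seteqP; split=> x [Lx h]; split=> //.
    exact: (bad_bounded kg cu PP Prep' Lx h).
  by move=> p Pp; apply: (bounded_bad kg cu (PP _ Pp)) => //; case: Lx.
split=> //; rewrite eq (bounded_limit_pointsE o G_kleinian).
set A := [set x | _].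
(* a parabolic point is infinitely well approximated by itself *)
have AC x : A x -> conic (@ext R n @` G) x.
  move=> [Lx bx]; have [//|px] := cu_dich cu Lx.
  have x1 : enorm x = 1 by case: Lx.
  have [k k0 hk] := bounded_bad kg cu px x1 bx.
  have := hk _ (kg_id kg); rewrite subrr enorm0 W0; lra.
have inf : infinite_set (limpt (@ext R n @` G)) by exact: cu_inf cu.
have lightS s s' : 0 <= s -> s <= s' -> light (wt s) (@ext R n @` G) ->
    light (wt s') (@ext R n @` G).
  move=> s0 ss'; apply: (@light_le _ _ _ _ 1) => // f Gf; rewrite mul1r.
  apply: ger_powR => //; rewrite (kg_Wgt0 kg Gf) /=; exact: W_le1.
apply/eqP; rewrite eq_le; apply/andP; split.
  apply: le_ereal_inf_tmp => _ [s [s0 fin] <-].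
  have ls : light (wt s) (@ext R n @` G) by apply/(poincare_light o G_kleinian s0).
  apply/lee_addgt0Pr => e e0; rewrite -EFinD; apply: ereal_inf_lbound.
  exists (s + e) => //; split; first by rewrite ltr_wpDl.
  apply: (@conic_hausdorff _ _ _ kg (s + e / 2)) => //; [|lra|].
    by rewrite ltr_wpDl // divr_gt0.
  by apply: lightS ls; lra.
apply: le_ereal_inf_tmp => _ [t [t0 Ht] <-].
apply/lee_addgt0Pr => e e0; rewrite -EFinD; apply: ereal_inf_lbound.
exists (t + e) => //; have te : 0 <= t + e by lra.
split=> //; apply/(poincare_light o G_kleinian te).
apply: contrapT => nl; have tt : t < t + e by lra.
by apply: (heavy_hausdorff kg t0 tt inf nl _ Ht) => x Lx bx; split.
Qed.
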